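(* Let $k\ge1$, let $a_1,\dots,a_k$ be free random variables in a non-commutative probability space, and let $$a:=\sum_{1\le i,j\le k}w_{i,j}\,a_ia_j,$$ where $w_{i,j}\in\mathbb{R}$ and $w_{j,i}=w_{i,j}$ for $1\le i\le j\le k$. Then, for every $n\ge1$, the free cumulants of $a$ are given by $$\kappa_n(a)=\sum_{(\mathcal{G},C)\in OCG^{(k)}_n}2^{f_C}\,w_{\mathcal{G}}\prod_{i=1}^{k}\Big(\prod_{v\in Q_i}\kappa_{d(v)}(a_i)\Big),$$ where $f_C$ is the number of flexible edges of $\mathcal{G}$ without counting the first edge of $C$, $d(v)$ is the degree of the vertex $v$ in $\mathcal{G}$, $Q_i$ is the set of vertices of color $i$, and $w_{\mathcal{G}}$ is the product of the weights of the edges of the colored graph $\mathcal{G}$.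
   Context: A non-commutative probability space $(\mathcal{A},\varphi)$ is a unital algebra over $\mathbb{C}$ with a linear functional $\varphi$, $\varphi(1)=1$. The free cumulants are the multilinear functionals $\kappa_n:\mathcal{A}^n\to\mathbb{C}$ determined recursively by $\varphi(a_1\cdots a_n)=\sum_{\pi\in\mathcal{NC}(n)}\prod_{V\in\pi}\kappa_{|V|}(a_V)$, where $\mathcal{NC}(n)$ is the set of non-crossing partitions of $\{1,\dots,n\}$ and for $V=\{v_1<\dots<v_k\}$, $\kappa_{|V|}(a_V)=\kappa_k(a_{v_1},\dots,a_{v_k})$; $\kappa_n(a):=\kappa_n(a,\dots,a)$. Freeness of $a_1,\dots,a_k$ is free independence, equivalently $\kappa_n(a_{i_1},\dots,a_{i_n})=0$ whenever $n\ge2$ and the indices $i_1,\dots,i_n$ are not all equal. Cacti. In a graph with loops and multiple edges allowed, a cycle is a finite sequence $(v_1,e_1,\dots,v_j,e_j)$ of vertices and edges such that $e_i$ connects $v_i$ with $v_{i+1}$ for $i=1,\dots,j$ (with $v_{j+1}=v_1$); repetitions are allowed. A simple cycle is a cycle with pairwise distinct vertices and pairwise distinct edges, considered up to cyclic rotation and reversal (a loop gives one with $j=1$, a pair of parallel edges one with $j=2$). A cactus is a connected graph in which every edge belongs to at most one simple cycle; an edge is rigid if it belongs to a simple cycle and flexible otherwise. An outercycle (orientation) of a cactus $\mathcal{G}$ is a cycle $C$ passing exactly once through every rigid edge and exactly twice through every flexible edge. $OCG_n$ is the set of oriented cacti $(\mathcal{G},C)$ ($\mathcal{G}$ a cactus,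 $C$ an outercycle) with exactly $n$ edges; two outercycles of $\mathcal{G}$ are considered the same if an automorphism of $\mathcal{G}$ (acting on vertices and edges) carries one entrywise to the other, and oriented cacti are taken up to isomorphism (cyclic rotations of an outercycle are not otherwise identified). Loops count twice in the degree. $OCG^{(k)}_n$ is the set of $k$-colored oriented cacti with $n$ edges: an oriented cactus $(\mathcal{G},C)\in OCG_n$ together with an arbitrary coloring $\lambda:V_{\mathcal{G}}\to\{1,\dots,k\}$ of its vertices (taken up to isomorphism preserving outercycle and coloring). $Q_i:=\lambda^{-1}(i)\subset V_{\mathcal{G}}$, and $w_{\mathcal{G}}:=\prod_{(v,u)\in E_{\mathcal{G}}}w_{\lambda(v),\lambda(u)}$, the product over all edges of $\mathcal{G}$ (with multiplicity). *)

(* Defs.v *)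
From HB Require Import structures.
From mathcomp Require Import all_boot all_order all_algebra.
From mathcomp Require Import boolp reals.
From mathcomp Require Import complex.

Set Implicit Arguments.
Unset Strict Implicit.
Unset Printing Implicit Defensive.

Import Order.TTheory GRing.Theory Num.Theory.

Local Open Scope ring_scope.


Definition noncrossing n (P : {set {set 'I_n}}) : bool :=
  [forall V in P, forall W in P,
   forall i1 : 'I_n, forall i2 : 'I_n, forall i3 : 'I_n, forall i4 : 'I_n,
     [&& i1 < i2, i2 < i3, i3 < i4,
         i1 \in V, i3 \in V, i2 \in W & i4 \in W]%N ==> (V == W)].

Definition NC n : {set {set {set 'I_n}}} :=
  [set P | partition P [set: 'I_n] & noncrossing P].

Section FreeProbability.
Variables (F : comNzRingType) (A : algType F) (phi : A -> F).

(* The moment-cumulant formula solved for the term of the one-block partition.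
   [enum_val] enumerates a block V of 'I_n in increasing order, so
   [a \o enum_val] is a_V.  The blocks of any other partition have fewer than n
   elements, so that fuel n is enough; see [moment_cumulant]. *)
Fixpoint cumulant_rec (fuel n : nat) (a : 'I_n -> A) : F :=
  if fuel is fuel'.+1 then
    phi (\prod_(i < n) a i)
    - \sum_(P in NC n | P != [set [set: 'I_n]])
        \prod_(V in P) cumulant_rec fuel' (fun j : 'I_#|V| => a (enum_val j))
  else 0.

Definition free_cumulant n (a : 'I_n -> A) : F := cumulant_rec n a.

Definition cumulant1 n (a : A) : F := @free_cumulant n (fun=> a).

(* [horner_alg b] maps the polynomial p to p(b), so its image is the unital
   subalgebra generated by b. *)
Definition freely_independent k (a : 'I_k -> A) : Prop :=
  forall s : seq ('I_k * {poly F}),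
    s != [::] ->
    sorted (fun x y => x.1 != y.1) s ->
    (forall x, x \in s -> phi (horner_alg (a x.1) x.2) = 0) ->
    phi (\prod_(x <- s) horner_alg (a x.1) x.2) = 0.

Lemma NC_block_gt0 n (P : {set {set 'I_n}}) (V : {set 'I_n}) :
  P \in NC n -> V \in P -> (0 < #|V|)%N.
Proof.
rewrite inE => /andP[/and3P[_ _ P0] _] VP; rewrite card_gt0.
by apply: contraNneq P0 => <-.
Qed.

Lemma NC_block_lt n (P : {set {set 'I_n}}) (V : {set 'I_n}) :
  P \in NC n -> P != [set [set: 'I_n]] -> V \in P -> (#|V| < n)%N.
Proof.
move=> PN PT VP; have cVn : (#|V| <= n)%N by rewrite -[n in leqRHS]card_ord max_card.
rewrite ltn_neqAle cVn andbT; apply: contraNneq PT => cV.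
have VT : V = [set: 'I_n].
  by apply/eqP; rewrite eqEcard subsetT cardsT card_ord cV leqnn.
apply/eqP/setP => W; rewrite inE; apply/idP/eqP => [WP|->]; last by rewrite -VT.
have := PN; rewrite inE => /andP[/and3P[_ /trivIsetP tP _] _].
rewrite -VT; apply/eqP; apply: contraT => WV.
have := tP _ _ WP VP WV; rewrite VT -setI_eq0 setIT => /eqP W0.
by have := NC_block_gt0 PN WP; rewrite W0 cards0.
Qed.

Lemma cumulant_rec_fuel N M n (a : 'I_n -> A) : (0 < n)%N ->
  (n <= N)%N -> (n <= M)%N -> cumulant_rec N a = cumulant_rec M a.
Proof.
elim: N M n a => [|N IHN] [|M] n a n0 nN nM;
  do ?by [move: nN; rewrite leqNgt n0 | move: nM; rewrite leqNgt n0].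
congr (_ + - _); apply: eq_bigr => P /andP[PN PT].
apply: eq_bigr => V VP; have lt := NC_block_lt PN PT VP.
by apply: IHN; [exact: NC_block_gt0 PN VP | rewrite -ltnS (leq_trans lt) ..].
Qed.

Lemma NC_one_block n : (0 < n)%N -> [set [set: 'I_n]] \in NC n.
Proof.
move=> n0; rewrite inE; apply/andP; split.
  rewrite /partition /cover big_set1 eqxx inE eq_sym -card_gt0.
  rewrite cardsT card_ord n0 andbT /=.
  by apply/trivIsetP => B C /[!inE] /eqP-> /eqP->; rewrite eqxx.
apply/forall_inP => V /[!inE] /eqP->; apply/forall_inP => W /[!inE] /eqP->.
by do 4! apply/forallP => ?; rewrite eqxx implybT.
Qed.

Lemma moment_cumulant n (a : 'I_n -> A) : (0 < n)%N ->
  phi (\prod_(i < n) a i)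
  = \sum_(P in NC n)
      \prod_(V in P) free_cumulant (fun j : 'I_#|V| => a (enum_val j)).
Proof.
move=> n0; rewrite (bigD1 [set [set: 'I_n]]) ?NC_one_block //= big_set1.
set S := (X in _ = _ + X).
have E : forall m (b : 'I_m -> A) (h : m = n) , b =1 (fun j => a (cast_ord h j)) ->
    free_cumulant b = phi (\prod_(i < n) a i) - S.
  move=> m b h; case: n / h a @S n0 => a S m0 /= eb.
  have -> : b = a by apply/funext => j; rewrite eb cast_ord_id.
  rewrite /free_cumulant (@cumulant_rec_fuel _ m.+1) //=; congr (_ + - _).
  apply: eq_bigr => P /andP[PN PT]; apply: eq_bigr => V VP.
  have := NC_block_lt PN PT VP; have := NC_block_gt0 PN VP => V0 lt.
  by apply: cumulant_rec_fuel => //; exact: ltnW.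
have cT : #|[set: 'I_n]| = n by rewrite cardsT card_ord.
rewrite (E _ _ cT) ?subrK // => j; congr a.
apply: val_inj; rewrite /= (enum_val_nth (Ordinal n0)) /=.
have -> : enum [set: 'I_n] = enum 'I_n.
  by apply: eq_enum => i; rewrite inE.
by rewrite nth_enum_ord //; have := ltn_ord j; move: (nat_of_ord j) => i; rewrite cT.
Qed.

End FreeProbability.


(* A multigraph gives an ordered pair of ends to each edge.  The order is
   immaterial: it is ignored by [joins], hence by walks and isomorphisms. *)
Definition multigraph (V E : finType) := {ffun E -> V * V}.

Section Cacti.
Variables (V E : finType) (G : multigraph V E).

Definition joins (e : E) (u v : V) : bool := (G e == (u, v)) || (G e == (v, u)).

(* The sequence (v_1, e_1, ..., v_j, e_j) is [:: (v_1, e_1); ...; (v_j, e_j)] *)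
Definition graph_cycle (c : seq (V * E)) : bool :=
  (c != [::]) && path.cycle (fun x y => joins x.2 x.1 y.1) c.

(* (v_1, e_1, ..., v_j, e_j) becomes (v_j, e_(j-1), ..., v_2, e_1, v_1, e_j) *)
Definition reverse_cycle (c : seq (V * E)) : seq (V * E) :=
  zip (rev (unzip1 c)) (rot 1 (rev (unzip2 c))).

Definition same_cycle (c c' : seq (V * E)) : Prop :=
  exists i, c' = rot i c \/ c' = rot i (reverse_cycle c).

Definition simple_cycle (c : seq (V * E)) : bool :=
  [&& graph_cycle c, uniq (unzip1 c) & uniq (unzip2 c)].

Definition connected_graph : Prop :=
  (0 < #|V|)%N /\ forall u v, connect (fun x y => [exists e, joins e x y]) u v.

Definition cactus : Prop :=
  connected_graph /\
  forall e c c', simple_cycle c -> simple_cycle c' ->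
    e \in unzip2 c -> e \in unzip2 c' -> same_cycle c c'.

Definition rigid (e : E) : bool :=
  `[< exists2 c, simple_cycle c & e \in unzip2 c >].

Definition outercycle (c : seq (V * E)) : Prop :=
  graph_cycle c /\
  forall e, count_mem e (unzip2 c) = if rigid e then 1%N else 2%N.

Definition degree (v : V) : nat :=
  (\sum_(e : E) (((G e).1 == v) + ((G e).2 == v)))%N.

(* The number f_C of flexible edges other than the first edge of c *)
Definition flexible_count (c : seq (V * E)) : nat :=
  #|[set e | ~~ rigid e & Some e != ohead (unzip2 c)]|.

End Cacti.


(* Multigraphs with n edges together with a walk and a colouring of the
   vertices.  The bounds on the number of vertices and on the length of the
   walk lose nothing: a connected graph with n edges has at most n + 1
   vertices, and an outercycle has at most 2n entries. *)
Definition colored_walk (k n : nat) : finType :=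
  {m : 'I_n.+2 & (multigraph 'I_m 'I_n * (n.*2).-bseq ('I_m * 'I_n)
                  * {ffun 'I_m -> 'I_k})%type}.

Section ColoredWalks.
Variables k n : nat.
Implicit Types X Y : colored_walk k n.

Definition vertex X : finType := 'I_(tag X).
Definition graph_of X : multigraph (vertex X) 'I_n := (tagged X).1.1.
Definition walk_of X : seq (vertex X * 'I_n) := (tagged X).1.2.
Definition color_of X : vertex X -> 'I_k := (tagged X).2.

Definition oriented_cactus X : Prop :=
  cactus (graph_of X) /\ outercycle (graph_of X) (walk_of X).

Definition isomorphic X Y : Prop :=
  exists (f : vertex X -> vertex Y) (g : 'I_n -> 'I_n),
  [/\ bijective f, bijective g,
      forall e u v, joins (graph_of Y) (g e) (f u) (f v)
                    = joins (graph_of X) e u v,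
      walk_of Y = [seq (f x.1, g x.2) | x <- walk_of X]
    & forall v, color_of (f v) = color_of v].

Definition oriented_cacti : {set colored_walk k n} :=
  [set X | `[< oriented_cactus X >]].

Definition isomorphism_classes : {set {set colored_walk k n}} :=
  equivalence_partition (fun X Y => `[< isomorphic X Y >]) oriented_cacti.

Definition OCG : {set colored_walk k n} :=
  transversal isomorphism_classes oriented_cacti.

Lemma isomorphic_refl X : isomorphic X X.
Proof.
exists id, id; split=> //; try by exists id.
by rewrite -[LHS]map_id; apply: eq_map => -[].
Qed.

Lemma isomorphic_sym X Y : isomorphic X Y -> isomorphic Y X.
Proof.
move=> [f [g [[f' fK f'K] [g' gK g'K] Hj Hw Hc]]]; exists f', g'; split.
- by exists f.
- by exists g.
- by move=> e u v; rewrite -Hj !f'K g'K.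
- rewrite Hw -map_comp -[LHS]map_id; apply: eq_map => -[v e] /=.
  by rewrite fK gK.
- by move=> v; rewrite -Hc f'K.
Qed.

Lemma isomorphic_trans X Y Z :
  isomorphic X Y -> isomorphic Y Z -> isomorphic X Z.
Proof.
move=> [f [g [bf bg Hj Hw Hc]]] [f' [g' [bf' bg' Hj' Hw' Hc']]].
exists (f' \o f), (g' \o g); split; try exact: bij_comp.
- by move=> e u v; rewrite Hj' Hj.
- by rewrite Hw' Hw -map_comp.
- by move=> v; rewrite Hc' Hc.
Qed.

Lemma OCG_transversal : is_transversal OCG isomorphism_classes oriented_cacti.
Proof.
apply/transversalP/equivalence_partitionP => X Y Z _ _ _; split.
  exact/asboolP/isomorphic_refl.
move=> /asboolP XY; apply/asboolP/asboolP; first exact/isomorphic_trans/isomorphic_sym.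
exact: isomorphic_trans.
Qed.

End ColoredWalks.

Definition graph_weight (F : comNzRingType) k n (w : 'I_k -> 'I_k -> F)
    (X : colored_walk k n) : F :=
  \prod_(e < n) w (color_of (graph_of X e).1) (color_of (graph_of X e).2).

(* Main.v *)
Require Import Defs.
From mathcomp Require Import all_boot all_order all_algebra.
From mathcomp Require Import boolp reals complex zify.

(* Expand the moments of the quadratic form as sums over noncrossing partitions
   of the 2n points formed by the two factors of each of the n copies of it: by
   freeness the blocks are monochromatic. Grouping the partitions according to
   the partition of the n copies that they generate shows that the n-th cumulant
   is the part of the sum where the two-point pairs connect all the blocks.

   Such a connected partition, with its blocks as vertices and the pairs as
   edges, is a plane graph with every edge on the outer face, hence a cactus;
   the boundary walk of the outer face is an outercycle. It runs along the outer
   side of each edge once, in the order of the pairs, and along the inner side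
   of exactly the flexible edges. Conversely an outercycle gives back the
   partition as soon as one knows which of the two passages through each
   flexible edge is the outer one, the first passage of all being outer: these
   are 2^f_C choices.

   Both directions rest on small cuts. Two vertices of a cactus are separated by
   one flexible edge or by two rigid ones, so four alternating visits of two
   vertices by an outercycle are impossible, as they would cross such a cut three
   times; and two arcs of the same complementary region of a noncrossing
   partition cut the graph in the edges that they bound. *)

(** Freeness is given through alternating products of centred polynomials, not through mixed
    cumulants, so the expansion of a word over noncrossing partitions has to be derived from it; the
    cumulants of the form then follow because the moment formula determines them. No topology of the
    plane is used. A face is a class of arcs of a circle of 2n points that no block separates, and
    the parity of the crossings of a cut by a closed walk plays the role of the Jordan curve
    theorem. The delicate half of the bijection is injectivity: the partition records only the outer
    passages, whereas an isomorphism of oriented cacti has to match the whole walk. The missing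
    passages run through distinct flexible edges, and a trail of distinct flexible edges is
    determined by its ends, so they can be filled in in only one way. Automorphisms do no harm to
    the count 2^f_C: an isomorphism respects the walk entrywise and the walk meets every edge, so no
    two choices on one representative are identified. *)

Set Implicit Arguments.
Unset Strict Implicit.
Unset Printing Implicit Defensive.

(** * Walks in multigraphs and cuts of cacti *)

Section Trails.
Variables (V E : finType) (G : multigraph V E).
Implicit Types (u v w : V) (e f g : E) (c d : seq (V * E)) (Z : {set V}).

Definition opposite e u : V := if (G e).1 == u then (G e).2 else (G e).1.

Lemma joinsC e u v : joins G e u v = joins G e v u.
Proof. by rewrite /joins orbC. Qed.

Lemma joins_opposite e u v : joins G e u v -> opposite e u = v.
Proof.
rewrite /opposite => /orP[] /eqP -> /=; rewrite ?eqxx //.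
by case: eqP.
Qed.

Lemma joins_ends e : joins G e (G e).1 (G e).2.
Proof. by rewrite /joins; case: (G e) => ? ? /=; rewrite eqxx. Qed.

Lemma joins_same e u v x y : joins G e u v -> joins G e x y ->
  (x == u) && (y == v) || (x == v) && (y == u).
Proof.
rewrite /joins; case: (G e) => a b; rewrite !xpair_eqE.
by move=> /orP[] /andP[/eqP-> /eqP->] /orP[] /andP[/eqP-> /eqP->];
  rewrite !eqxx ?orbT.
Qed.

(** The open version of [graph_cycle]. It carries both end vertices, so that walks can be cut and
    concatenated, and computes the next vertex by [opposite], which keeps it boolean. *)
Fixpoint trail u c v : bool :=
  if c is (x, e) :: c' then
    [&& x == u, joins G e u (opposite e u) & trail (opposite e u) c' v]
  else u == v.

Lemma trail_joins u e w c v : joins G e u w ->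
  trail u ((u, e) :: c) v = trail w c v.
Proof. by move=> j /=; rewrite (joins_opposite j) j eqxx. Qed.

Lemma trail_consP x e c u v :
  reflect (exists w, [/\ x = u, joins G e u w & trail w c v])
          (trail u ((x, e) :: c) v).
Proof.
apply: (iffP idP) => [/and3P[/eqP xu j t]|[w [-> j t]]]; first by exists (opposite e u).
by rewrite (trail_joins _ _ j).
Qed.

Lemma trail_head u x e c v : trail u ((x, e) :: c) v -> x = u.
Proof. by case/trail_consP => ? []. Qed.

Lemma trail_cat u c d v :
  trail u (c ++ d) v <-> exists2 w, trail u c w & trail w d v.
Proof.
elim: c u => [|[x e] c IHc] u; first by split=> [t|[w /eqP->]//]; exists u => /=.
rewrite cat_cons; split.
  by case/trail_consP => w [-> j /IHc[z t1 t2]]; exists z; rewrite ?(trail_joins _ _ j).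
case=> z /trail_consP[w [-> j t1]] t2; rewrite (trail_joins _ _ j).
by apply/IHc; exists z.
Qed.

Lemma trail_rcons u c x e v : trail u (rcons c (x, e)) v =
  trail u c x && joins G e x v.
Proof.
rewrite -cats1; apply/idP/andP.
  move/trail_cat => [w t1 /trail_consP[z [-> j /eqP <-]]]; by split.
by case=> t j; apply/trail_cat; exists x; rewrite ?(trail_joins _ _ j) /=.
Qed.

Lemma path_trail u e c (z : V * E) :
  path (fun a b : V * E => joins G a.2 a.1 b.1) (u, e) (rcons c z)
  = trail u ((u, e) :: c) z.1.
Proof.
elim: c u e => [|[x f] c IHc] u e.
  rewrite [LHS]/= andbT /= eqxx /=; apply/idP/andP => [j|[j /eqP <-]//].
  by rewrite (joins_opposite j).
rewrite [LHS]/= IHc; apply/andP/idP => [[j t]|/trail_consP[w [_ j t]]].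
  by rewrite (trail_joins _ _ j).
by have xw := trail_head t; rewrite -xw in t j; rewrite j.
Qed.

Lemma graph_cycle_trail u e c :
  graph_cycle G ((u, e) :: c) = trail u ((u, e) :: c) u.
Proof. exact: path_trail. Qed.

Lemma graph_cycleP c :
  reflect (exists2 u, c != [::] & trail u c u) (graph_cycle G c).
Proof.
case: c => [|[u e] c]; first by apply: (iffP idP) => // -[].
rewrite graph_cycle_trail; apply: (iffP idP) => [t|[v _ t]]; first by exists u.
by have uv := trail_head t; rewrite -uv in t.
Qed.

Lemma trail_next u c v x e : trail u c v -> (x, e) \in c ->
  joins G e x (opposite e x) /\ opposite e x \in rcons (unzip1 c) v.
Proof.
elim: c u => // -[y f] c IHc u /trail_consP[w [-> j t]].
rewrite inE => /orP[/eqP[-> ->]|xc]; last first.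
  by have [? ?] := IHc _ t xc; rewrite /= inE orbC; split=> //; apply/orP; left.
rewrite (joins_opposite j); split=> //=.
rewrite inE orbC; case: c {IHc} t => [/eqP ->|[z g] c /trail_consP[z' [-> _ _]]] /=.
  by rewrite inE eqxx.
by rewrite inE eqxx.
Qed.

(** A second passage through the first edge would start or end at [x], so that [x] would be visited
    twice. *)
Lemma trail_uniq u c v :
  trail u c v -> uniq (rcons (unzip1 c) v) -> uniq (unzip2 c).
Proof.
elim: c u => // -[x e] c IHc u /trail_consP[w [-> j t]] /= /andP[uc uq].
rewrite (IHc w) // andbT; apply: contra uc => /mapP[[y f] yc /= ef].
rewrite -{f}ef in yc.
have [j' o] := trail_next t yc.
case/orP: (joins_same j j') => /andP[/eqP yE /eqP oE]; last by rewrite -oE.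
by rewrite mem_rcons inE -yE; apply/orP; right; apply/mapP; exists (y, e).
Qed.

Definition crosses Z e := ((G e).1 \in Z) (+) ((G e).2 \in Z).

Lemma crosses_joins Z e u v :
  joins G e u v -> crosses Z e = (u \in Z) (+) (v \in Z).
Proof. by rewrite /crosses => /orP[] /eqP -> //=; rewrite addbC. Qed.

Lemma trail_parity Z u c v : trail u c v ->
  odd (count (fun x => crosses Z x.2) c) = (u \in Z) (+) (v \in Z).
Proof.
elim: c u => [|[x e] c IHc] u; first by move/eqP->; rewrite addbb.
case/trail_consP => w [-> j t]; rewrite /= oddD (IHc _ t) (crosses_joins _ j).
by case: (u \in Z); case: (w \in Z); case: (v \in Z).
Qed.

Lemma graph_cycle_parity Z c :
  graph_cycle G c -> odd (count (fun x => crosses Z x.2) c) = false.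
Proof. by case/graph_cycleP => u _ /(trail_parity Z) ->; rewrite addbb. Qed.

Definition adjacent_off (S : pred E) : rel V :=
  fun x y => [exists e, ~~ S e && joins G e x y].

Lemma adjacent_off_sym S : symmetric (adjacent_off S).
Proof. by move=> x y; apply: eq_existsb => e; rewrite joinsC. Qed.

Lemma connect_off_sym S : connect_sym (adjacent_off S).
Proof. by apply: sym_connect_sym; apply: adjacent_off_sym. Qed.

Lemma trail_connect S u c v : trail u c v -> all (fun x => ~~ S x.2) c ->
  connect (adjacent_off S) u v.
Proof.
elim: c u => [|[x e] c IHc] u; first by move/eqP->.
case/trail_consP => w [-> j t] /= /andP[eS cS]; apply: connect_trans (IHc _ t cS).
by apply: connect1; apply/existsP; exists e; rewrite eS.
Qed.

Lemma path_off_trail S u (p : seq V) : path (adjacent_off S) u p ->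
  exists c, [/\ trail u c (last u p), unzip1 c = belast u p &
                all (fun x => ~~ S x.2) c].
Proof.
elim: p u => [|v p IHp] u; first by exists [::]; split=> //=.
case/andP => /existsP[e /andP[eS j]] /IHp[c [t c1 cS]].
by exists ((u, e) :: c); rewrite (trail_joins _ _ j) /= c1 eS.
Qed.

Lemma connect_off_trail S u v : connect (adjacent_off S) u v ->
  exists c, [/\ trail u c v, uniq (rcons (unzip1 c) v) &
                all (fun x => ~~ S x.2) c].
Proof.
case/connectP => p0 p0p ->; case: (shortenP p0p) => p pp up _.
have [c [t c1 cS]] := path_off_trail pp.
by exists c; rewrite c1 -lastI.
Qed.

(** A simple path from [t] back to [s] off [S] is closed by [e]. If [e] is a loop, the path is
    empty. *)
Lemma simple_cycle_through (S : pred E) e s t : joins G e s t -> S e ->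
  connect (adjacent_off S) t s ->
  exists c, [/\ simple_cycle G ((s, e) :: c), trail t c s &
                all (fun x => ~~ S x.2) c].
Proof.
move=> j Se /connect_off_trail[c [tc uc cS]]; exists c; split=> //.
have tc' : trail s ((s, e) :: c) s by rewrite (trail_joins _ _ j).
rewrite /simple_cycle graph_cycle_trail tc' /=.
move: (uc); rewrite rcons_uniq => /andP[-> ->] /=.
rewrite (trail_uniq tc uc) andbT.
by apply/negP => /mapP[x xc eE]; move: (allP cS _ xc); rewrite -eE Se.
Qed.

Lemma unzip2_reverse_cycle c :
  unzip2 (reverse_cycle c) = rot 1 (rev (unzip2 c)).
Proof. by rewrite unzip2_zip // !size_rot !size_rev !size_map. Qed.

Lemma same_cycle_edges c d : same_cycle c d -> unzip2 d =i unzip2 c.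
Proof.
by case=> i [] -> e; rewrite /unzip2 map_rot mem_rot // -/unzip2
  unzip2_reverse_cycle mem_rot mem_rev.
Qed.

(** Otherwise [e] would lie on a second simple cycle, one that avoids [f]. *)
Lemma cactus_disconnected c e f s t : cactus G -> simple_cycle G c ->
  e \in unzip2 c -> f \in unzip2 c -> f != e -> joins G e s t ->
  ~~ connect (adjacent_off (pred2 e f)) t s.
Proof.
move=> [_ cG] sc ec fc fe j; apply/negP.
have Se : pred2 e f e by rewrite /= eqxx.
move=> /(simple_cycle_through j Se)[d [sd _ dS]].
have := same_cycle_edges (cG e c _ sc sd ec (mem_head _ _)) f.
rewrite fc /= inE (negPf fe) /= => /mapP[x xd fx].
by have := allP dS _ xd; rewrite /= -fx eqxx orbT.
Qed.

Lemma rigid_connect e s t : joins G e s t ->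
  connect (adjacent_off (pred1 e)) t s -> rigid G e.
Proof.
move=> j /(simple_cycle_through (S := pred1 e) j (eqxx e))[c [sc _ _]].
by apply/asboolP; exists ((s, e) :: c); rewrite //= inE eqxx.
Qed.

(** [Z] is the component of [u] once the edges of [S] are removed. These edges all end at [u], which
    the path [p] avoids, so [p] uses none of them and [v] stays with [y] on the other side. Only
    edges of [S] cross [Z]. *)
Lemma separating_cut (S : pred E) u y v c (p : seq V) :
  (forall f, S f -> exists z, joins G f u z) ->
  ~~ connect (adjacent_off S) y u ->
  path (adjacent_off pred0) y p -> last y p = v -> u \notin y :: p ->
  (count (fun x => S x.2) c <= 2)%N ->
  exists Z : {set V}, [/\ u \in Z, v \notin Z &
    (count (fun x => crosses Z x.2) c <= 2)%N].
Proof.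
move=> Su nyu yp <- up cS.
exists [set z | connect (adjacent_off S) u z]; rewrite !inE connect0; split=> //.
  apply: contra nyu => uv; rewrite connect_off_sym; apply: connect_trans uv _.
  rewrite connect_off_sym.
  elim: p y yp up => // z p IHp y /andP[/existsP[e /andP[_ j]] zp] up.
  apply: (@connect_trans _ _ z); last first.
    by apply: IHp => //; apply: contra up => h; rewrite inE h orbT.
  apply: connect1; apply/existsP; exists e; rewrite j andbT; apply/negP => /Su[z' j'].
  by move: up; rewrite !inE; case/orP: (joins_same j j') => /andP[/eqP-> _];
    rewrite eqxx ?orbT.
apply: leq_trans cS; apply: sub_count => -[x e] /=; apply: contraLR => eS.
rewrite /crosses !inE.
have same a b : joins G e a b ->
    connect (adjacent_off S) u a -> connect (adjacent_off S) u b.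
  move=> j ua; apply: connect_trans ua _; apply: connect1.
  by apply/existsP; exists e; rewrite eS.
have j := joins_ends e.
suff -> : connect (adjacent_off S) u (G e).1 = connect (adjacent_off S) u (G e).2.
  by rewrite addbb.
by apply/idP/idP; apply: same => //; rewrite joinsC.
Qed.

Lemma outercycle_cut c u v : cactus G -> outercycle G c -> u != v ->
  exists Z : {set V}, [/\ u \in Z, v \notin Z &
    (count (fun x => crosses Z x.2) c <= 2)%N].
Proof.
move=> cG oc uv; have [[_ conn] _] := cG.
have /connectP[p0 p0p vE] : connect (adjacent_off pred0) u v := conn u v.
case: (shortenP p0p) vE => -[|y p] /= pp up _ vE; first by rewrite vE eqxx in uv.
case/andP: pp => /existsP[e /= j] pp; case/andP: up => up _.
have cnt f : (count (fun x : V * E => x.2 == f) c <= 2)%N.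
  by have := oc.2 f; rewrite count_map /preim /= => ->; case: ifP.
have cntr f : rigid G f -> count (fun x : V * E => x.2 == f) c = 1%N.
  by move=> rf; have := oc.2 f; rewrite count_map rf.
have [yu|nyu] := boolP (connect (adjacent_off (pred1 e)) y u); last first.
  apply: (separating_cut _ nyu pp (esym vE) up (cnt e)) => f /eqP ->.
  by exists y.
have re := rigid_connect j yu.
(* The simple path p starts with e and does not come back to u, so that it also
   avoids the other edge f at u of the cycle through e. *)
have [d [sd td dS]] := simple_cycle_through (S := pred1 e) j (eqxx e) yu.
case/lastP: d => [|d [z f]] in sd td dS.
  by move: up; rewrite inE -(eqP td) eqxx.
move: td; rewrite trail_rcons => /andP[td jf].
have fd : f \in unzip2 ((u, e) :: rcons d (z, f)).
  by apply/mapP; exists (z, f); rewrite // inE mem_rcons mem_head orbT.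
have fe : f != e by have := allP dS (z, f); rewrite mem_rcons mem_head; apply.
have rf : rigid G f by apply/asboolP; exists ((u, e) :: rcons d (z, f)).
apply: (separating_cut (S := pred2 e f) _ _ pp (esym vE) up).
- by move=> g /orP[] /eqP ->; [exists y | exists z; rewrite joinsC].
- by apply: (cactus_disconnected cG sd _ fd fe j); rewrite /= inE eqxx.
- have := count_predUI (fun x : V * E => x.2 == e) (fun x => x.2 == f) c.
  by rewrite (cntr e) // (cntr f) // => h; apply: leq_trans (leq_addr _ _) (eq_leq h).
Qed.

Lemma opposite_trail u c v : trail u c v ->
  [seq opposite x.2 x.1 | x <- c] = behead (rcons (unzip1 c) v).
Proof.
elim: c u => // -[x e] c IHc u /trail_consP[w [-> j t]].
rewrite /= (joins_opposite j) (IHc _ t).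
by case: c t {IHc} => [/eqP ->|[z f] c /trail_head ->].
Qed.

Definition reversed c := rev [seq (opposite x.2 x.1, x.2) | x <- c].

Lemma trail_reversed u c v : trail u c v -> trail v (reversed c) u.
Proof.
elim: c u => [|[x e] c IHc] u; first by move/eqP->; exact: eqxx.
case/trail_consP => w [-> j t]; rewrite /reversed /= rev_cons trail_rcons.
by rewrite (joins_opposite j) joinsC j andbT; exact: IHc.
Qed.

(** The reversed trail starts again at [v_1], whereas [reverse_cycle] starts at [v_j]; hence the
    rotation. *)
Lemma reverse_cycleE c : graph_cycle G c -> reverse_cycle c = rot 1 (reversed c).
Proof.
case/graph_cycleP => u; case: c => // -[y e] c _ t.
have yu := trail_head t; rewrite yu in t *.
rewrite -[RHS]zip_unzip /reverse_cycle; congr zip; last first.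
  by rewrite /unzip2 map_rot /reversed map_rev -map_comp.
rewrite /reversed [in RHS]/unzip1 map_rot map_rev -map_comp.
have -> : map (fst \o (fun x => (opposite x.2 x.1, x.2))) ((u, e) :: c)
    = behead (rcons (unzip1 ((u, e) :: c)) u) by exact: opposite_trail t.
by rewrite /= rev_rcons rot1_cons rev_cons.
Qed.

Lemma simple_cycle_reverse c : simple_cycle G c -> simple_cycle G (reverse_cycle c).
Proof.
case/and3P => gc u1 u2; apply/and3P; split; last first.
- by rewrite unzip2_reverse_cycle rot_uniq rev_uniq.
- by rewrite unzip1_zip ?rev_uniq // size_rot !size_rev !size_map.
rewrite reverse_cycleE // /graph_cycle rot_cycle -size_eq0 size_rot size_eq0.
by case/graph_cycleP: gc => u c0 /trail_reversed t; apply/graph_cycleP; exists u;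
  rewrite // /reversed -size_eq0 size_rev size_map size_eq0.
Qed.

Lemma simple_cycle_rot i c : simple_cycle G c -> simple_cycle G (rot i c).
Proof.
case/and3P => /andP[c0 gc] u1 u2; apply/and3P; split.
- by rewrite /graph_cycle rot_cycle -size_eq0 size_rot size_eq0 c0.
- by rewrite /unzip1 map_rot rot_uniq.
- by rewrite /unzip2 map_rot rot_uniq.
Qed.

Lemma mem_reverse_cycle c x e :
  graph_cycle G c -> (x, e) \in c -> (opposite e x, e) \in reverse_cycle c.
Proof.
move=> gc xc; rewrite reverse_cycleE // mem_rot mem_rev.
by apply/mapP; exists (x, e).
Qed.

(** Two simple closed trails share the beginning [p]. The next edge [e] of the first one occurs in
    the second after [p]; as [w] is not [u] and is visited once, [e] can only be the step that
    leaves [w]. So [p] grows by one step. *)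
Lemma simple_trail_sub u w (p c d : seq (V * E)) :
  trail u p w -> p != [::] -> trail w c u -> trail w d u ->
  uniq (unzip1 (p ++ c)) -> uniq (unzip1 (p ++ d)) ->
  uniq (unzip2 (p ++ c)) ->
  {subset unzip2 (p ++ c) <= unzip2 (p ++ d)} -> c = d.
Proof.
elim: c d w p => [|[x e] c IHc] d w p tp p0 tc td uc ud ec sub.
  case: d => [//|[x e] d] in td ud sub *.
  case: p => // -[y f] p in p0 tp uc ec ud sub *.
  move: ud; rewrite (trail_head td) (trail_head tp) -(eqP tc) /=.
  by rewrite /unzip1 map_cat mem_cat inE eqxx orbT.
have [z [xw j tc']] := trail_consP _ _ _ _ _ tc; rewrite {}xw in tc uc ec sub *.
have wp : w \notin unzip1 p.
  move: uc; rewrite /unzip1 map_cat cat_uniq => /and3P[_ /hasPn h _].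
  by apply: h; rewrite inE eqxx.
have ep : e \notin unzip2 p.
  move: ec; rewrite /unzip2 map_cat cat_uniq => /and3P[_ /hasPn h _].
  by apply: h; rewrite inE eqxx.
have wu : w != u.
  apply: contraNneq wp => ->; case: (p) p0 tp => // -[y f] p' _ /trail_head -> /=.
  by rewrite inE eqxx.
case: d => [|[y f] d] in td ud sub *; first by rewrite -(eqP td) eqxx in wu.
have [z' [yw j' td']] := trail_consP _ _ _ _ _ td; rewrite {}yw in td ud sub *.
have wd : w \notin unzip1 d.
  by move: ud; rewrite /unzip1 map_cat cat_uniq /= => /and3P[_ _ /andP[]].
have ef : e = f.
  have : e \in unzip2 (p ++ (w, f) :: d).
    by apply: sub; rewrite /unzip2 map_cat mem_cat inE eqxx orbT.
  rewrite /unzip2 map_cat mem_cat (negPf ep) /= inE => /orP[/eqP//|].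
  case/mapP => -[x' e'] xd /= eE; rewrite -{e'}eE in xd.
  have [j2 o] := trail_next td' xd.
  case/orP: (joins_same j j2) => /andP[/eqP xE /eqP yE].
    by case/negP: wd; rewrite -xE; apply/mapP; exists (x', e).
  by move: o; rewrite yE mem_rcons inE (negPf wu) (negPf wd).
rewrite -{f}ef in j' td sub ud *; have zz := joins_opposite j.
rewrite (joins_opposite j') in zz; rewrite {}zz in td' j'; congr cons.
apply: (IHc d z (rcons p (w, e))); rewrite ?cat_rcons //.
- by rewrite trail_rcons tp.
- by rewrite -size_eq0 size_rcons.
Qed.

(** After a rotation, and a reversal if the common edge is run the other way, [d] starts with the
    first step of [c], and [simple_trail_sub] applies. *)
Lemma simple_cycle_sub c d : simple_cycle G c -> simple_cycle G d ->
  {subset unzip2 c <= unzip2 d} -> same_cycle d c.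
Proof.
have rooted x e c1 d0 : simple_cycle G ((x, e) :: c1) -> simple_cycle G d0 ->
    (x, e) \in d0 -> {subset unzip2 ((x, e) :: c1) <= unzip2 d0} ->
    exists i, (x, e) :: c1 = rot i d0.
  move=> sc sd xd sub; have [i d1 dE] := rot_to xd; exists i; rewrite dE; congr cons.
  have := simple_cycle_rot i sd; rewrite dE => /and3P[gd ud _].
  case/and3P: sc => gc uc ec.
  rewrite !graph_cycle_trail in gc gd.
  have [w [_ j tc]] := trail_consP _ _ _ _ _ gc.
  rewrite (trail_joins _ _ j) in gd.
  apply: (simple_trail_sub (p := [:: (x, e)]) _ _ tc gd uc ud ec) => //.
    by rewrite (trail_joins _ _ j) /=.
  by move=> f /sub; rewrite -[_ ++ d1]/((x, e) :: d1) -dE /unzip2 map_rot mem_rot.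
case: c => [|[x e] c] sc sd sub; first by case/and3P: sc.
have [w [_ j _]] : exists w, [/\ x = x, joins G e x w & trail w c x].
  by apply/trail_consP; rewrite -graph_cycle_trail; case/and3P: sc.
have /mapP[[y f] yd /= eE] := sub e (mem_head _ _); rewrite -{f}eE in yd.
have gd : graph_cycle G d by case/and3P: sd.
have jy : joins G e y (opposite e y).
  by have /graph_cycleP[u _ td] := gd; case: (trail_next td yd).
case/orP: (joins_same j jy) => /andP[/eqP yE /eqP oE].
  rewrite yE in yd; have [i ->] := rooted _ _ _ _ sc sd yd sub.
  by exists i; left.
have xd : (x, e) \in reverse_cycle d by rewrite -oE; apply: mem_reverse_cycle.
have [|i ->] := rooted _ _ _ _ sc (simple_cycle_reverse sd) xd.
  by move=> f /sub; rewrite unzip2_reverse_cycle mem_rot mem_rev.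
by exists i; right.
Qed.

Lemma closed_trail_rigid u x e c : trail u ((x, e) :: c) u ->
  uniq (unzip2 ((x, e) :: c)) -> rigid G e.
Proof.
case/trail_consP => w [_ j t] /= /andP[ec _]; apply: (rigid_connect j).
apply: trail_connect t _; apply/allP => -[y f] yc; apply: contraNN ec => /eqP fe.
by apply/mapP; exists (y, f).
Qed.

(** If the first edges [e] and [f] differ, one of them is rigid. When [d] avoids [e], going on along
    [c] and back along [d] joins the ends of [e] without [e]. When [d] meets [e] later, its part
    before [e] either returns to [u], which makes [f] rigid, or joins the ends of [e] off [e]. *)
Lemma bridge_trail_uniq u v c d : trail u c v -> trail u d v ->
  uniq (unzip2 c) -> uniq (unzip2 d) ->
  all (fun x => ~~ rigid G x.2) c -> all (fun x => ~~ rigid G x.2) d -> c = d.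
Proof.
elim: c u d => [|[x e] c IHc] u [|[y f] d] // tc td uc ud rc rd.
- rewrite -(eqP tc) in td.
  by move: rd; rewrite /= (closed_trail_rigid td ud).
- rewrite -(eqP td) in tc.
  by move: rc; rewrite /= (closed_trail_rigid tc uc).
have [w [xu j tc']] := trail_consP _ _ _ _ _ tc.
have [z [yu j' td']] := trail_consP _ _ _ _ _ td.
have [re rc'] := andP rc; have [rf rd'] := andP rd; have [ec uc'] := andP uc.
have [fd ud'] := andP ud; rewrite /= in re rf.
have off (b : seq (V * E)) : e \notin unzip2 b -> all (fun x => ~~ pred1 e x.2) b.
  move=> eb; apply/allP => -[a g] ab; apply: contraNN eb => /eqP ge.
  by apply/mapP; exists (a, g).
have [ef|nef] := eqVneq e f.
  rewrite -ef in j'; have wz := joins_opposite j; rewrite (joins_opposite j') in wz.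
  by rewrite ef xu yu; congr cons; apply: (IHc w); rewrite // -wz.
case/negP: re; have wv : connect (adjacent_off (pred1 e)) w v.
  by apply: trail_connect tc' (off _ ec).
have [ed|ed] := boolP (e \in unzip2 ((y, f) :: d)); last first.
  apply: (rigid_connect j); apply: connect_trans wv _; rewrite connect_off_sym.
  exact: trail_connect td (off _ ed).
move: ed; rewrite /= inE (negPf nef) /= => /mapP[[a g] ad /= ge]; rewrite -{g}ge in ad.
case/splitPr: ad => d1 d2 in td td' ud ud' fd rd rd' *.
move: td; rewrite -cat_cons => /trail_cat[b t1 t2].
have ba := trail_head t2; rewrite ba in t2 *.
have [b' [_ j2 _]] := trail_consP _ _ _ _ _ t2.
move: ud; rewrite -cat_cons /unzip2 map_cat cat_uniq => /and3P[u1 nh _].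
have e1 : e \notin unzip2 ((y, f) :: d1).
  by move/hasPn: nh; apply; rewrite inE eqxx.
case/orP: (joins_same j j2) => /andP[/eqP aE /eqP bE].
  rewrite aE in t1.
  by have := closed_trail_rigid t1 u1; rewrite (negPf rf).
rewrite aE in t1; apply: (rigid_connect j); rewrite connect_off_sym.
exact: trail_connect t1 (off _ e1).
Qed.

End Trails.

(** * Marked walks *)

Section GraphMorphism.
Variables (V V' E E' : finType) (G : multigraph V E) (G' : multigraph V' E').
Variables (f : V -> V') (g : E -> E').
Hypothesis joins_fg : forall e u v, joins G' (g e) (f u) (f v) = joins G e u v.
Implicit Types (c : seq (V * E)).

Definition map_walk c := [seq (f x.1, g x.2) | x <- c].

Lemma trail_map u c v : trail G u c v -> trail G' (f u) (map_walk c) (f v).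
Proof.
elim: c u => [|[x e] c IHc] u; first by move/eqP=> ->; exact: eqxx.
case/trail_consP => w [-> j t]; apply/trail_consP; exists (f w); split=> //.
  by rewrite joins_fg.
exact: IHc.
Qed.

Lemma unzip1_map_walk c : unzip1 (map_walk c) = map f (unzip1 c).
Proof. by rewrite /unzip1 -!map_comp. Qed.

Lemma unzip2_map_walk c : unzip2 (map_walk c) = map g (unzip2 c).
Proof. by rewrite /unzip2 -!map_comp. Qed.

Hypotheses (f_inj : injective f) (g_inj : injective g).

Lemma simple_cycle_map c : simple_cycle G c -> simple_cycle G' (map_walk c).
Proof.
case/and3P => /graph_cycleP[u c0 t] u1 u2; apply/and3P; split.
- by apply/graph_cycleP; exists (f u); [case: (c) c0 | exact: trail_map].
- by rewrite unzip1_map_walk map_inj_uniq.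
- by rewrite unzip2_map_walk map_inj_uniq.
Qed.

Lemma rigid_map e : rigid G e -> rigid G' (g e).
Proof.
case/asboolP => c sc ec; apply/asboolP; exists (map_walk c).
  exact: simple_cycle_map.
by rewrite unzip2_map_walk map_f.
Qed.

Lemma opposite_map e u v : joins G e u v ->
  opposite G' (g e) (f u) = f (opposite G e u).
Proof.
by move=> j; rewrite (joins_opposite j); apply: joins_opposite; rewrite joins_fg.
Qed.

End GraphMorphism.

Section Marks.
Variable E : finType.
Implicit Types (S : {set E}) (s seen : seq E) (b : bitseq).

(* An outercycle passes each edge once or twice; [marks S [::] s] selects the
   second passage through the edges of S and the first one through the others. *)
Fixpoint marks S seen s : bitseq :=
  if s is e :: s' then ((e \in S) == (e \in seen)) :: marks S (e :: seen) s'
  else [::].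

Lemma size_marks S seen s : size (marks S seen s) = size s.
Proof. by elim: s seen => //= e s IHs seen; rewrite IHs. Qed.

Lemma count_marks S seen s e : count_mem e (mask (marks S seen s) s) =
  if e \in seen then (if e \in S then count_mem e s else 0)
  else if e \in S then (count_mem e s).-1 else (0 < count_mem e s).
Proof.
elim: s seen => [|x s IHs] seen /=; first by do 2!case: ifP.
have [->|xe] := eqVneq x e.
  case: (boolP (e \in seen)) => xs; case: (boolP (e \in S)) => xS;
    by rewrite /= ?eqxx IHs inE eqxx ?xS ?(negPf xS).
have h (t : bool) : count_mem e (if t then x :: mask (marks S (x :: seen) s) s
    else mask (marks S (x :: seen) s) s) = count_mem e (mask (marks S (x :: seen) s) s).
  by case: t; rewrite //= (negPf xe).
by rewrite h IHs inE eq_sym (negPf xe).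
Qed.

(** A mask that selects each edge exactly once, among at most two passages, is determined by the set
    of edges whose first passage it skips. *)
Lemma marks_eq S b s : size b = size s ->
  (forall e, e \in s -> (e \in S) = ~~ nth false b (index e s)) ->
  (forall e, e \in s -> count_mem e s <= 2)%N ->
  (forall e, e \in s -> count_mem e (mask b s) = 1)%N ->
  b = marks S [::] s.
Proof.
move=> sb H1 H2 H3.
(* Invariant of the induction: an edge already seen has at most one passage left, and that one is
   selected exactly when the edge is in [S]. *)
suff main seen : (forall e, e \in s -> e \notin seen ->
      [/\ (e \in S) = ~~ nth false b (index e s), count_mem e s <= 2 &
          count_mem e (mask b s) = 1])%N ->
    (forall e, e \in s -> e \in seen ->
      count_mem e s <= 1 /\ count_mem e (mask b s) = (e \in S))%N ->
    b = marks S seen s.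
  by apply: main => // e es _; split; [exact: H1 | exact: H2 | exact: H3].
elim: s b sb seen {H1 H2 H3} => [|x s IHs] [|b0 b] // [sb] seen H1 H2 /=.
have xs0 (e : E) : (count_mem e s = 0)%N -> e \notin s by rewrite -has_pred1 has_count => ->.
have mask0 e : e \notin s -> count_mem e (mask b s) = 0%N.
  move=> es; apply/count_memPn; apply: contra es; exact: mem_mask.
case: (boolP (x \in seen)) => xseen.
  have [c1 c2] := H2 x (mem_head _ _) xseen.
  have xs : x \notin s by apply: xs0; move: c1; rewrite /= eqxx; lia.
  move: c2; case: b0 H1 H2 => H1 H2 /=; rewrite ?eqxx (mask0 _ xs) => c2.
    rewrite (_ : x \in S = true); last by case: (x \in S) c2.
    congr cons; apply: IHs => // e es.
      rewrite inE negb_or => /andP[ex eseen].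
      have := H1 e; rewrite inE es orbT => /(_ isT eseen) /=.
      by rewrite eq_sym (negPf ex).
    rewrite inE => /orP[/eqP ex|eseen]; first by rewrite ex (negPf xs) in es.
    have := H2 e; rewrite inE es orbT => /(_ isT eseen) /=.
    by case: eqVneq => // ex; rewrite -ex (negPf xs) in es.
  rewrite (_ : x \in S = false); last by case: (x \in S) c2.
  congr cons; apply: IHs => // e es.
    rewrite inE negb_or => /andP[ex eseen].
    have := H1 e; rewrite inE es orbT => /(_ isT eseen) /=.
    by rewrite eq_sym (negPf ex).
  rewrite inE => /orP[/eqP ex|eseen]; first by rewrite ex (negPf xs) in es.
  have := H2 e; rewrite inE es orbT => /(_ isT eseen) /=.
  by case: eqVneq => // ex; rewrite -ex (negPf xs) in es.
have [] := H1 x (mem_head _ _) xseen; rewrite /= eqxx /= => xS c1 c2.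
rewrite xS; congr cons; first by case: (b0).
apply: IHs => // e es.
  rewrite inE negb_or => /andP[ex eseen].
  have := H1 e; rewrite inE es orbT => /(_ isT eseen) /=.
  by rewrite eq_sym (negPf ex); case: (b0); rewrite //= eq_sym (negPf ex).
rewrite inE => /orP[/eqP ex|eseen].
  by rewrite ex xS; move: c1 c2; case: (b0); rewrite /= ?eqxx; lia.
have := H2 e; rewrite inE es orbT => /(_ isT eseen) /=.
have ex : x != e by apply: contraNneq xseen => ->.
by case: (b0); rewrite /= (negPf ex).
Qed.

Lemma marks_inj S S' s :
  {subset S <= s} -> {subset S' <= s} ->
  marks S [::] s = marks S' [::] s -> S = S'.
Proof.
have main seen : marks S seen s = marks S' seen s ->
    forall e, e \in s -> (e \in S) = (e \in S').
  elim: s seen => //= x s IHs seen [hx hs] e; rewrite inE => /orP[/eqP ->|].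
    by move: hx; do 3!case: (_ \in _).
  exact: IHs hs e.
move=> sS sS' /main h; apply/setP => e.
have [/h//|es] := boolP (e \in s).
by rewrite (negPf (contra (@sS e) es)) (negPf (contra (@sS' e) es)).
Qed.

Lemma count_mask_negb (T : Type) (a : pred T) b (s : seq T) : size b = size s ->
  (count a (mask b s) + count a (mask (map negb b) s) = count a s)%N.
Proof.
elim: s b => [|x s IHs] [|[] b] //= [/IHs <-]; last by rewrite addnCA.
by rewrite addnA.
Qed.

End Marks.

Lemma mask_cons_split (T : Type) b (s : seq T) x s' : size b = size s ->
  mask b s = x :: s' ->
  exists s1 s2 b2, [/\ s = s1 ++ x :: s2, b = nseq (size s1) false ++ true :: b2,
    size b2 = size s2 & mask b2 s2 = s'].
Proof.
elim: s b => [|y s IHs] [|[] b] //= [sb].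
  by case=> -> <-; exists [::], s, b.
case/(IHs _ sb) => s1 [s2 [b2 [-> -> sb2 <-]]].
by exists (y :: s1), s2, b2.
Qed.

Lemma mask_nil (T : Type) b (s : seq T) : size b = size s ->
  mask b s = [::] -> b = nseq (size s) false.
Proof. by elim: s b => [|y s IHs] [|[] b] //= [/IHs h /h ->]. Qed.

(** * Recovering a trail from its selected steps *)

Section MarkedTrails.
Variables (V E : finType) (G : multigraph V E).
Implicit Types (u v : V) (c d : seq (V * E)) (b : bitseq).

(** What is left of an outercycle when one passage through each edge is removed. *)
Definition bridges c := uniq (unzip2 c) && all (fun x => ~~ rigid G x.2) c.

Lemma bridges_cat c d : bridges (c ++ d) -> bridges c /\ bridges d.
Proof.
rewrite /bridges /unzip2 map_cat cat_uniq all_cat.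
by case/andP => /and3P[-> _ ->] /andP[-> ->].
Qed.

(** Between two consecutive selected steps the trail runs through distinct flexible edges from one
    prescribed vertex to another, hence in only one way by [bridge_trail_uniq]. Induction on the
    selected steps [o]. *)
Lemma marked_trail_uniq u v c d b b' :
  size b = size c -> size b' = size d -> mask b c = mask b' d ->
  trail G u c v -> trail G u d v ->
  bridges (mask (map negb b) c) -> bridges (mask (map negb b') d) ->
  c = d /\ b = b'.
Proof.
move Eo : (mask b c) => o; elim: o u c d b b' Eo => [|[x e] o IHo] u c d b b' mb sb sb'.
  move/esym => mb' tc td.
  rewrite (mask_nil sb mb) (mask_nil sb' mb') !map_nseq !mask_true //=.
  case/andP => uc rc /andP[ud rd].
  by rewrite (bridge_trail_uniq tc td uc ud rc rd).
move/esym => mb'.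
have [c1 [c2 [b2 [cE bE sb2 mb2]]]] := mask_cons_split sb mb.
have [d1 [d2 [b2' [dE bE' sb2' mb2']]]] := mask_cons_split sb' mb'.
rewrite {}cE {}bE {}dE {}bE' !map_cat !map_nseq /= => tc td.
rewrite !mask_cat ?size_nseq // !mask_true //= => /bridges_cat[bc1 bc2] /bridges_cat[bd1 bd2].
have [w tc1 tc2] := (trail_cat G u c1 ((x, e) :: c2) v).1 tc.
have [w' td1 td2] := (trail_cat G u d1 ((x, e) :: d2) v).1 td.
have [z [xw j tc3]] := trail_consP _ _ _ _ _ _ tc2.
have [z' [xw' j' td3]] := trail_consP _ _ _ _ _ _ td2.
rewrite -xw in tc1 j; rewrite -xw' in td1 j'.
have [/andP[? ?] /andP[? ?]] := (bc1, bd1).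
have -> : c1 = d1 by apply: (bridge_trail_uniq tc1 td1).
have zz : z = z' by rewrite -(joins_opposite j) (joins_opposite j').
rewrite -zz in td3.
by have [-> ->] := IHo z c2 d2 b2 b2' mb2 sb2 sb2' (esym mb2') tc3 td3 bc2 bd2.
Qed.

Lemma trail_drop u c v i : trail G u c v ->
  trail G (nth v (unzip1 c) i) (drop i c) v.
Proof.
elim: c u i => [|[x e] c IHc] u i t; first by rewrite nth_nil; exact: eqxx.
case: i => [|i]; first by have xu := trail_head t; rewrite drop0 [nth _ _ _]xu.
by have [w [_ _ /IHc]] := trail_consP _ _ _ _ _ _ t; apply.
Qed.

Lemma trail_segment u c v i j : trail G u c v -> (i <= j)%N ->
  trail G (nth v (unzip1 c) i) (take (j - i) (drop i c)) (nth v (unzip1 c) j).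
Proof.
move=> t ij; have := trail_drop i t; rewrite -{1}(cat_take_drop (j - i) (drop i c)).
case/trail_cat => w t1; rewrite drop_drop subnK // => t2.
suff -> : nth v (unzip1 c) j = w by [].
have := trail_drop 0 t2; rewrite drop0 /=.
have -> : nth v (unzip1 (drop j c)) 0 = nth v (unzip1 c) j.
  by rewrite /unzip1 map_drop nth_drop addn0.
case: (drop j c) t2 => [/eqP -> /eqP ->//|[x e] d /trail_head <- /trail_head <-//].
Qed.

(** The position [size c], allowed for [i4], is the return to the start; [nth] reads it as its
    default [u]. The three segments between the visits each cross the cut an odd number of times,
    against a total of at most two. *)
Lemma outercycle_noncrossing u c i1 i2 i3 i4 : cactus G -> outercycle G c ->
  trail G u c u -> (i1 < i2)%N -> (i2 < i3)%N -> (i3 < i4)%N ->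
  (i4 <= size c)%N ->
  nth u (unzip1 c) i1 = nth u (unzip1 c) i3 ->
  nth u (unzip1 c) i2 = nth u (unzip1 c) i4 ->
  nth u (unzip1 c) i1 = nth u (unzip1 c) i2.
Proof.
move=> cG oc t l12 l23 l34 l4 e13 e24; apply/eqP; apply: contraT => nv.
have [Z [Z1 Z2 cZ]] := outercycle_cut cG oc nv.
have seg i j (ij : (i <= j)%N) := trail_parity Z (trail_segment t ij).
have := seg _ _ (ltnW l34); rewrite -e24 -e13 Z1 (negPf Z2).
have := seg _ _ (ltnW l23); rewrite -e13 Z1 (negPf Z2).
have := seg _ _ (ltnW l12); rewrite Z1 (negPf Z2).
have := cZ; rewrite -{1}(cat_take_drop i1 c) -{1}(cat_take_drop (i2 - i1) (drop i1 c)).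
rewrite drop_drop (subnK (ltnW l12)) -{1}(cat_take_drop (i3 - i2) (drop i2 c)).
rewrite drop_drop (subnK (ltnW l23)) -{1}(cat_take_drop (i4 - i3) (drop i3 c)) !count_cat.
set A := count _ (take (i2 - _) _); set B := count _ (take (i3 - _) _).
set C := count _ (take (i4 - _) _); lia.
Qed.

End MarkedTrails.

(** * Noncrossing partitions *)

Section Points.
Variable n : nat.

Lemma half_ltn (x : 'I_n.*2) : (x./2 < n)%N.
Proof. by case: x => x /= ?; lia. Qed.

Definition half_ord (x : 'I_n.*2) : 'I_n := Ordinal (half_ltn x).

Lemma point_ltn (l : 'I_n) (b : bool) : (b + l.*2 < n.*2)%N.
Proof. by case: l => l /= ?; case: b; lia. Qed.

(** The points [2l] and [2l + 1] are the two factors of copy [l]. *)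
Definition point l b : 'I_n.*2 := Ordinal (point_ltn l b).

Lemma half_point l b : half_ord (point l b) = l.
Proof. by apply/val_inj; rewrite /= half_bit_double. Qed.

Lemma odd_point l b : odd (point l b) = b.
Proof. by rewrite /= oddD odd_double addbF oddb. Qed.

Lemma point_half x : point (half_ord x) (odd x) = x.
Proof. by apply/val_inj; rewrite /= odd_double_half. Qed.

Lemma big_points (R : Type) (idx : R) (op : Monoid.law idx) (F : 'I_n.*2 -> R) :
  \big[op/idx]_(x < n.*2) F x
  = \big[op/idx]_(l < n) op (F (point l false)) (F (point l true)).
Proof.
pose F' i := if insub i is Some x then F x else idx.
have F'E (x : 'I_n.*2) : F' x = F x by rewrite /F' valK.
transitivity (\big[op/idx]_(0 <= i < n.*2) F' i).
  by rewrite big_mkord; apply: eq_bigr.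
transitivity (\big[op/idx]_(0 <= i < n) op (F' i.*2) (F' i.*2.+1)).
  elim: (n) => [|m IHm]; first by rewrite !big_geq.
  by rewrite doubleS !big_nat_recr //= IHm Monoid.mulmA.
rewrite big_mkord; apply: eq_bigr => l _.
by rewrite -(F'E (point l false)) -(F'E (point l true)).
Qed.

End Points.

Section NoncrossingPartitions.
Variables (N M : nat) (q : 'I_N -> 'I_M).
Implicit Types (D U V W Z : {set 'I_N}) (P Q : {set {set 'I_N}}).

Definition NCD D := [set P | partition P D & noncrossing P].

(** With [half_ord] as [q], this is connectivity of the graph with the blocks as vertices and the
    pairs as edges, expressed on the points. *)
Definition glued P : rel 'I_N := fun x y =>
  [&& x \in cover P, y \in cover P &
      (q x == q y) || [exists V in P, (x \in V) && (y \in V)]].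

Definition connected_NC D :=
  [set P in NCD D | [forall x in D, forall y in D, connect (glued P) x y]].

Lemma glued_sym P : symmetric (glued P).
Proof.
move=> x y; rewrite /glued andbCA eq_sym; do 2!congr (_ && _).
by congr (_ || _); apply: eq_existsb => V; rewrite [(x \in V) && _]andbC.
Qed.

Lemma NCD_partition P D : P \in NCD D -> partition P D.
Proof. by rewrite inE => /andP[]. Qed.

Lemma NCD_cover P D : P \in NCD D -> cover P = D.
Proof. by move/NCD_partition/cover_partition. Qed.

Lemma NCD_sub P D V : P \in NCD D -> V \in P -> V \subset D.
Proof. by move/NCD_cover => <- VP; apply: bigcup_sup. Qed.

Lemma NCD_neq0 P D V : P \in NCD D -> V \in P -> exists x, x \in V.
Proof.
move/NCD_partition/and3P => [_ _ P0] VP; apply/set0Pn.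
by apply: contraNneq P0 => <-.
Qed.

Lemma NCD_block P D x V W :
  P \in NCD D -> V \in P -> W \in P -> x \in V -> x \in W -> V = W.
Proof.
by move/NCD_partition/partition_trivIset => tP VP WP xV xW;
  rewrite -(def_pblock tP VP xV) (def_pblock tP WP xW).
Qed.

Lemma noncrossingP P : reflect
  (forall V W (x y z t : 'I_N), V \in P -> W \in P ->
    (x < y)%N -> (y < z)%N -> (z < t)%N ->
    x \in V -> z \in V -> y \in W -> t \in W -> V = W)
  (noncrossing P).
Proof.
apply: (iffP forall_inP) => [nc V W x y z t VP WP xy yz zt xV zV yW tW|nc V VP].
  move/forall_inP/(_ W WP): (nc V VP).
  move=> /forallP/(_ x)/forallP/(_ y)/forallP/(_ z)/forallP/(_ t)/implyP h.
  by apply/eqP/h; rewrite xy yz zt xV zV yW.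
apply/forall_inP => W WP; do 4!apply/forallP => ?.
by apply/implyP => /and5P[xy yz zt xV /and3P[zV yW tW]]; apply/eqP/(nc V W _ _ _ _ VP WP xy yz zt).
Qed.

Lemma NCD_crossing P D V W (x y z t : 'I_N) : P \in NCD D -> V \in P -> W \in P ->
  (x < y)%N -> (y < z)%N -> (z < t)%N ->
  x \in V -> z \in V -> y \in W -> t \in W -> V = W.
Proof. by rewrite inE => /andP[_ /noncrossingP nc]; apply: nc. Qed.

Lemma connected_NCD P D : P \in connected_NC D -> P \in NCD D.
Proof. by rewrite inE => /andP[]. Qed.

Lemma connected_NCP P D x y : P \in connected_NC D -> x \in D -> y \in D ->
  connect (glued P) x y.
Proof. by rewrite inE => /andP[_ /forall_inP h] xD; apply/forall_inP/h. Qed.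

Lemma glued_closed P Z :
  (forall V x y, V \in P -> x \in V -> y \in V -> x \in Z -> y \in Z) ->
  (forall x y, x \in cover P -> y \in cover P -> q x = q y -> x \in Z -> y \in Z) ->
  forall x y, connect (glued P) x y -> (x \in Z) = (y \in Z).
Proof.
move=> hP hq; apply: closed_connect => x y /and3P[xP yP].
case/orP => [/eqP xy|/exists_inP[V VP /andP[xV yV]]].
  by apply/idP/idP; [apply: hq | apply: (hq _ _ yP xP)].
by apply/idP/idP; [apply: (hP V) | apply: (hP V)].
Qed.

End NoncrossingPartitions.

Section Kernel.
Variables (N : nat) (T : eqType) (lab : 'I_N -> T).

Definition kernel : {set {set 'I_N}} := preim_partition lab [set: 'I_N].

Lemma mem_kernel V x : V \in kernel -> x \in V -> V = [set y | lab y == lab x].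
Proof.
case/imsetP => z _ -> ; rewrite inE => /andP[_ /eqP zx].
by apply/setP => y; rewrite !inE /= zx eq_sym.
Qed.

Lemma kernel_block x : [set y | lab y == lab x] \in kernel.
Proof.
by apply/imsetP; exists x; rewrite // ; apply/setP => y; rewrite !inE eq_sym.
Qed.

Lemma kernel_NCD :
  (forall x y z t : 'I_N, (x < y)%N -> (y < z)%N -> (z < t)%N ->
     lab x = lab z -> lab y = lab t -> lab x = lab y) ->
  kernel \in NCD [set: 'I_N].
Proof.
move=> nc; rewrite inE preim_partitionP; apply/noncrossingP.
move=> V W x y z t VP WP xy yz zt xV zV yW tW.
rewrite (mem_kernel VP xV) (mem_kernel WP yW).
rewrite (nc _ _ _ _ xy yz zt) //; apply/eqP.
  by move: zV; rewrite (mem_kernel VP xV) inE eq_sym.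
by move: tW; rewrite (mem_kernel WP yW) inE eq_sym.
Qed.

End Kernel.

Lemma eq_kernel N (T T' : eqType) (lab : 'I_N -> T) (lab' : 'I_N -> T') :
  (forall x y, (lab x == lab y) = (lab' x == lab' y)) -> kernel lab = kernel lab'.
Proof.
move=> h; congr (imset _ _); apply/funext => x.
by apply/setP => y; rewrite !inE /= h.
Qed.

Lemma kernel_inj N (T T' : eqType) (lab : 'I_N -> T) (lab' : 'I_N -> T') :
  kernel lab = kernel lab' -> forall x y, (lab x == lab y) = (lab' x == lab' y).
Proof.
move=> e x y; have := kernel_block lab y; rewrite e => /mem_kernel/(_ (_ : y \in _)).
rewrite inE eqxx => /(_ isT)/setP/(_ x); by rewrite !inE.
Qed.

(** * Reading a partition off a marked outercycle *)

Section Labelling.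
Variables (V : finType) (n : nat) (G : multigraph V 'I_n).
Variables (lab : 'I_n.*2 -> V) (ed : 'I_n -> 'I_n).
Hypotheses (ed_bij : bijective ed)
  (ed_joins : forall l, joins G (ed l) (lab (point l false)) (lab (point l true))).

Lemma labelled_edge e u v : joins G e u v ->
  exists x y, [/\ half_ord x = half_ord y, lab x = u & lab y = v].
Proof.
case: ed_bij => ed' edK ed'K; rewrite -(ed'K e) => j.
case/orP: (joins_same (ed_joins (ed' e)) j) => /andP[/eqP -> /eqP ->].
  by exists (point (ed' e) false), (point (ed' e) true); rewrite !half_point.
by exists (point (ed' e) true), (point (ed' e) false); rewrite !half_point.
Qed.

Lemma labelling_surjective : connected_graph G -> (0 < n)%N ->
  forall v, exists x, lab x = v.
Proof.
move=> [_ conn] n0 v; pose e0 : 'I_n := Ordinal n0.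
have /connectP[p] := conn (G e0).1 v; case/lastP: p => [_ ->|p w].
  by have [x [_ [_ ? _]]] := labelled_edge (joins_ends G e0); exists x.
rewrite rcons_path last_rcons => /andP[_ /existsP[e j]] ->.
by have [_ [y [_ _ ?]]] := labelled_edge j; exists y.
Qed.

Lemma kernel_connected : connected_graph G -> (0 < n)%N ->
  kernel lab \in NCD [set: 'I_n.*2] ->
  kernel lab \in connected_NC (@half_ord n) [set: 'I_n.*2].
Proof.
move=> [c0 conn] n0 nc; rewrite inE nc /=.
have cv := NCD_cover nc.
apply/forall_inP => x _; apply/forall_inP => y _.
have same z t : lab z = lab t -> connect (glued (@half_ord n) (kernel lab)) z t.
  move=> zt; apply: connect1; rewrite /glued cv !inE /=; apply/orP; right.
  by apply/exists_inP; exists [set y | lab y == lab t]; rewrite ?kernel_block // !inE zt eqxx.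
have /connectP[p pp lp] := conn (lab x) (lab y).
elim: p x pp lp => [|w p IHp] x; first by move=> _ /= /esym; apply: same.
case/andP => /existsP[e j] pp lp; have [z [t [zt zx tw]]] := labelled_edge j.
apply: connect_trans (same _ _ (esym zx)) _.
apply: (@connect_trans _ _ t); last by apply: IHp; rewrite tw.
by apply: connect1; rewrite /glued cv !inE zt eqxx.
Qed.

(** The two points of a pair are the two ends of its edge, so a loop counts twice on both sides. *)
Lemma card_label v : #|[set x | lab x == v]| = degree G v.
Proof.
rewrite /degree (reindex ed); last by apply: onW_bij.
rewrite -sum1dep_card big_mkcond big_points; apply: eq_bigr => l _ /=.
case/orP: (ed_joins l) => /eqP -> /=; last rewrite addnC;
  by do 2!case: ifP.
Qed.

Lemma kernel_image : (forall v, exists x, lab x = v) ->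
  kernel lab = [set [set x | lab x == v] | v in [set: V]].
Proof.
move=> sur; apply/setP => B; apply/idP/imsetP => [BP|[v _ ->]]; last first.
  by have [x <-] := sur v; apply: kernel_block.
have [z zB] : exists z, z \in B.
  by have /imsetP[z _ ->] := BP; exists z; rewrite !inE /=.
by exists (lab z); rewrite // (mem_kernel BP zB).
Qed.

Local Open Scope ring_scope.

Lemma prod_kernel (F : GRing.ComNzRing.type) (f : {set 'I_n.*2} -> F) (g : V -> F) :
  (forall v, exists x, lab x = v) ->
  (forall v, f [set x | lab x == v] = g v) ->
  \prod_(B in kernel lab) f B = \prod_v g v.
Proof.
move=> sur fg; rewrite (kernel_image sur) big_imset /=.
  by apply: eq_big => [v|v _]; rewrite ?inE.
move=> u v _ _ /setP; have [x <-] := sur u => /(_ x).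
by rewrite !inE eqxx => /esym/eqP.
Qed.

Lemma prod_labelled_edges (F : GRing.ComNzRing.type) (w : V -> V -> F) :
  (forall u v, w u v = w v u) ->
  \prod_l w (lab (point l false)) (lab (point l true))
  = \prod_(e < n) w (G e).1 (G e).2.
Proof.
move=> wC; rewrite [RHS](reindex ed); last by apply: onW_bij.
by apply: eq_bigr => l _; case/orP: (ed_joins l) => /eqP -> //=.
Qed.

End Labelling.

Section Reading.
Variables (V : finType) (n : nat) (G : multigraph V 'I_n).
Implicit Types (c o : seq (V * 'I_n)) (S : {set 'I_n}).

Definition selected S c := mask (marks S [::] (unzip2 c)) c.

(** The point [2l] is the tail of the step [l] of [o], and [2l + 1] its head. The option spares a
    default vertex when [o] is too short. *)
Definition side o (x : 'I_n.*2) : option V :=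
  omap (fun d => if odd x then opposite G d.2 d.1 else d.1) (onth o (half_ord x)).

(** The edges whose outer passage may be the second one; the first passage of the whole walk is
    always outer. Its subsets are the 2^f_C choices. *)
Definition choices c : {set 'I_n} :=
  [set e | ~~ rigid G e & Some e != ohead (unzip2 c)].

Variables (c : seq (V * 'I_n)) (S : {set 'I_n}).
Hypotheses (cG : cactus G) (oc : outercycle G c) (Sc : S \subset choices c).

Let b := marks S [::] (unzip2 c).
Let size_b : size b = size c.
Proof. by rewrite size_marks size_map. Qed.

Lemma count_selected e : count_mem e (unzip2 (selected S c)) = 1%N.
Proof.
rewrite /selected /unzip2 map_mask count_marks in_nil oc.2.
case: (boolP (e \in S)) => [eS|_]; last by case: ifP.
by move/subsetP/(_ e eS): Sc; rewrite inE => /andP[/negPf ->].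
Qed.

Lemma perm_selected : perm_eq (unzip2 (selected S c)) (enum 'I_n).
Proof.
apply/allP => e _ /=.
by rewrite count_selected count_uniq_mem ?enum_uniq // mem_enum.
Qed.

Lemma size_selected : size (selected S c) = n.
Proof. by rewrite -(size_map snd) (perm_size perm_selected) size_enum_ord. Qed.

(** One passage of each edge is selected, which leaves none for a rigid edge and one for a flexible
    edge. *)
Lemma bridges_unselected : bridges G (mask (map negb b) c).
Proof.
have cnt e : (count_mem e (unzip2 (mask (map negb b) c)) <= ~~ rigid G e)%N.
  have := count_mask_negb (pred1 e) (_ : size b = size (unzip2 c)).
  rewrite size_map -!map_mask -/(unzip2 _) oc.2 => /(_ size_b).
  by have := count_selected e; rewrite /selected /unzip2 -/b => ->; case: ifP => _ /=; lia.
apply/andP; split.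
  apply/count_mem_uniq => e; have := cnt e.
  rewrite -has_pred1 has_count; case: (count_mem e _) => [|[|m]] //=.
  by case: (rigid G e).
apply/allP => -[v e] ve /=; have := cnt e; case: (rigid G e) => //=.
rewrite leqNgt -has_count has_pred1 => /negP[].
by apply/mapP; exists (v, e).
Qed.

Lemma reading_labels : exists (lab : 'I_n.*2 -> V) (ed : 'I_n -> 'I_n),
  [/\ forall x, side (selected S c) x = Some (lab x),
      selected S c = [seq (lab (point l false), ed l) | l <- enum 'I_n],
      forall l, joins G (ed l) (lab (point l false)) (lab (point l true)),
      bijective ed
    & forall x y z t : 'I_n.*2, (x < y)%N -> (y < z)%N -> (z < t)%N ->
        lab x = lab z -> lab y = lab t -> lab x = lab y].
Proof.
have [u c0 tc] := graph_cycleP _ _ oc.1.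
have [d0 _] : exists d0, d0 \in c by case: (c) c0 => // d c' _; exists d; rewrite mem_head.
set o := selected S c; pose P := mask b (iota 0 (size c)).
have oP : o = map (nth d0 c) P by rewrite map_mask map_nth_iota0 // take_size.
have sP : size P = n by rewrite -(size_map (nth d0 c)) -oP size_selected.
have Plt l : (l < n)%N -> (nth 0 P l < size c)%N.
  move=> ln; have : nth 0 P l \in iota 0 (size c).
    by apply: (mem_mask (m := b)); apply: mem_nth; rewrite sP.
  by rewrite mem_iota.
have Psorted l m : (l < m)%N -> (m < n)%N -> (nth 0 P l < nth 0 P m)%N.
  move=> lm mn; apply: (sorted_ltn_nth ltn_trans); rewrite ?inE ?sP //; last lia.
  by apply: subseq_sorted (iota_ltn_sorted 0 (size c)); [exact: ltn_trans | exact: mask_subseq].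
(* Position in the walk of the vertex read at [x]: that of the selected step for its tail, the
   following one for its head, possibly [size c]. *)
pose pos (x : 'I_n.*2) := (nth 0 P x./2 + odd x)%N.
pose lab x := nth u (unzip1 c) (pos x).
pose ed (l : 'I_n) : 'I_n := (nth d0 o l).2.
have onE (l : 'I_n) : nth d0 o l = nth d0 c (nth 0 P l).
  by rewrite oP (nth_map 0) // sP.
have lab0 l : lab (point l false) = (nth d0 o l).1.
  rewrite onE /lab /pos /= doubleK odd_double addn0 (nth_map d0) //.
  exact: Plt.
have lab1 l : lab (point l true) = opposite G (ed l) (nth d0 o l).1.
  rewrite /ed onE /lab /pos -[half _]/(uphalf l.*2) uphalf_double oddS /= odd_double /= addn1.
  have := opposite_trail tc => /(congr1 (fun s => nth u s (nth 0 P l))).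
  by rewrite (nth_map d0) ?Plt // => ->; rewrite nth_behead nth_rcons_default.
have edj l : joins G (ed l) (lab (point l false)) (lab (point l true)).
  rewrite lab0 lab1 /ed.
  have := mem_nth d0 (Plt l (ltn_ord l)); rewrite -onE.
  by case: (nth d0 o l) => x e /(trail_next tc) [].
have oE : o = [seq (lab (point l false), ed l) | l <- enum 'I_n].
  apply: (@eq_from_nth _ d0); first by rewrite size_selected size_map size_enum_ord.
  move=> i; rewrite size_selected => lin.
  rewrite (nth_map (Ordinal lin)) ?size_enum_ord // lab0 /ed !nth_enum_ord //.
  by case: (nth d0 o i).
exists lab, ed; split=> //.
- move=> x; rewrite /side onthE (nth_map d0) ?size_selected ?half_ltn //= -/o.
  by rewrite -[in RHS](point_half x); case: (odd x); rewrite ?lab1 ?lab0.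
- apply: injF_bij; apply/injectiveP; rewrite /injectiveb /dinjectiveb.
  have : uniq (unzip2 o) by rewrite (perm_uniq perm_selected) enum_uniq.
  by rewrite oE /unzip2 -map_comp.
move=> x y z t xy yz zt xz yt.
(* Only a weak inequality: the head of a selected step may be the tail of the next one. Points with
   different labels do have different positions, and this is all that the crossing argument
   needs. *)
have pos_mono (x1 x2 : 'I_n.*2) : (x1 < x2)%N -> (pos x1 <= pos x2)%N.
  move=> h; rewrite /pos; have [e|ne] := eqVneq x1./2 x2./2.
    by rewrite e leq_add2l; have := odd_double_half x1; have := odd_double_half x2; lia.
  have := Psorted x1./2 x2./2; have := half_ltn x2; have := odd_double_half x1.
  have := odd_double_half x2. lia.
have [//|nxy] := eqVneq (lab x) (lab y).
have neq (x1 x2 : 'I_n.*2) : (x1 < x2)%N -> lab x1 != lab x2 -> (pos x1 < pos x2)%N.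
  by move=> /pos_mono; rewrite leq_eqVlt => /orP[/eqP e|//]; rewrite /lab e eqxx.
apply: (outercycle_noncrossing cG oc tc (i1 := pos x) (i2 := pos y) (i3 := pos z) (i4 := pos t)) => //.
- exact: neq.
- by apply: neq; rewrite // -xz eq_sym.
- by apply: neq; rewrite // -xz -yt.
- rewrite /pos; have := Plt _ (half_ltn t); by case: odd => /=; lia.
Qed.

End Reading.

(** * The cactus of a noncrossing labelling *)

Section DescendingPaths.
Variables (R : rel nat) (p : pred nat).

(** Made for walking round a region by decreasing arcs: [R] has to be checked only between an
    element of [p] and the next lower one. *)
Lemma path_descending b k m :
  (forall a c, (k <= a)%N -> (a < c)%N -> (c < k + m)%N -> p a -> p c ->
     (forall d, (a < d)%N -> (d < c)%N -> ~~ p d) -> R c a) ->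
  (forall a, (k <= a)%N -> (a < k + m)%N -> p a ->
     (forall d, (a < d)%N -> (d < k + m)%N -> ~~ p d) -> R b a) ->
  path R b (filter p (rev (iota k m))).
Proof.
elim: m b => [//|m IHm] b H1 H2.
rewrite -[m.+1]addn1 iotaD rev_cat /=.
have H1' a c : (k <= a)%N -> (a < c)%N -> (c < k + m)%N -> p a -> p c ->
    (forall d, (a < d)%N -> (d < c)%N -> ~~ p d) -> R c a.
  by move=> ka ac cm; apply: H1 => //; lia.
case: ifP => pm /=.
  apply/andP; split; first by apply: H2 => //; lia.
  apply: IHm => // a ka am pa nd; apply: H1 => //; lia.
apply: IHm => // a ka am pa nd; apply: H2 => //; first lia.
move=> d ad dm; have [d_lt|d_ge] := ltnP d (k + m); first exact: nd.
by have -> : d = (k + m)%N by [lia]; rewrite pm.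
Qed.

Lemma last_descending b m : p b -> (m <= b)%N ->
  (forall d, (m <= d)%N -> (d < b)%N -> ~~ p d) ->
  let l := last b (filter p (rev (iota 0 m))) in
  [/\ p l, (l <= b)%N & forall d, (d < l)%N -> ~~ p d].
Proof.
elim: m b => [|m IHm] b pb mb nd; first by split=> // d; apply: nd.
rewrite -[m.+1]addn1 iotaD rev_cat /= add0n; case: ifP => pm /=.
  have [|? ? ?] := IHm m pm (leqnn m); first by move=> d; lia.
  by split=> //; lia.
apply: IHm => //; first lia.
move=> d md db; have [ed|nd'] := eqVneq d m; first by rewrite ed pm.
by apply: nd => //; lia.
Qed.

End DescendingPaths.

(** * Complementary regions and the boundary walk of the outer face *)

Section CactusOfLabelling.
Variables (V : finType) (n : nat) (lab : nat -> V).
Let N := n.*2.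
Hypothesis n_gt0 : (0 < n)%N.
Hypothesis lab_wrap : lab N = lab 0.
Hypothesis lab_noncrossing : forall x y z t, (x < y)%N -> (y < z)%N -> (z < t)%N ->
  (t < N)%N -> lab x = lab z -> lab y = lab t -> lab x = lab y.
Hypothesis lab_connected : forall Z : pred nat,
  (forall x y, (x < N)%N -> (y < N)%N -> lab x = lab y -> Z x -> Z y) ->
  (forall l, (l < n)%N -> Z l.*2 = Z l.*2.+1) ->
  forall x y, (x < N)%N -> (y < N)%N -> Z x -> Z y.
Hypothesis lab_surjective : forall v, exists2 x, (x < N)%N & lab x = v.

(* The points lie on a circle, and a stands for the arc between the points
   a - 1 and a, so that 0 and N are the same arc. Two arcs are related when they
   bound the same complementary region of the blocks, i.e. when no block meets
   both sides. *)
Definition between a b x := (x < a)%N (+) (x < b)%N.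

Definition same_region a b : bool :=
  [forall x : 'I_N, forall y : 'I_N,
     (lab x == lab y) ==> (between a b x == between a b y)].

Lemma same_regionP a b : reflect
  (forall x y, (x < N)%N -> (y < N)%N -> lab x = lab y -> between a b x -> between a b y)
  (same_region a b).
Proof.
apply: (iffP forallP) => [h x y xN yN xy|h x].
  move/forallP/(_ (Ordinal yN))/implyP: (h (Ordinal xN)) => /= /(_ (introT eqP xy)).
  by move/eqP->.
apply/forallP => y; apply/implyP => /eqP xy; apply/eqP; apply/idP/idP.
  exact: h.
by apply: h.
Qed.

Lemma same_region_refl : reflexive same_region.
Proof. by move=> a; apply/same_regionP => x y _ _ _; rewrite /between addbb. Qed.

Lemma same_region_sym : symmetric same_region.
Proof.
move=> a b; apply/same_regionP/same_regionP => h x y xN yN xy;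
  by rewrite /between addbC => /(h _ _ xN yN xy); rewrite /between addbC.
Qed.

Lemma same_region_trans : transitive same_region.
Proof.
move=> b a c /forallP ab /forallP bc; apply/forallP => x; apply/forallP => y.
apply/implyP => xy.
have /eqP h1 := implyP (forallP (ab x) y) xy.
have /eqP h2 := implyP (forallP (bc x) y) xy.
have E z : between a c z = between a b z (+) between b c z.
  by rewrite /between addbA -[_ (+) _ (+) (z < b)%N]addbA addbb addbF.
by rewrite !E h1 h2.
Qed.

Lemma same_region0N : same_region 0 N.
Proof. by apply/same_regionP => x y xN yN; rewrite /between xN yN. Qed.

(** Between two successive arcs the boundary of a region follows a single block. Let [z] be the last
    point before [b] of the block of the point [a]. As blocks do not cross, the arc [z + 1] is in
    the region of [a]; no arc of the region lies strictly between, so [z + 1] is [b]. *)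
Lemma region_step a b : (a < b)%N -> (b <= N)%N -> same_region a b ->
  (forall c, (a < c)%N -> (c < b)%N -> ~~ same_region a c) -> lab b.-1 = lab a.
Proof.
move=> ab bN /same_regionP sab nc.
pose Q z := (z < b)%N && (lab z == lab a).
have Qa : exists z, Q z by exists a; rewrite /Q ab eqxx.
have Qb z : Q z -> (z <= b)%N by case/andP => /ltnW.
have [z /andP[zb /eqP za] zmax] := ex_maxnP Qa Qb.
have az : (a <= z)%N by apply: zmax; rewrite /Q ab eqxx.
have szb : same_region a z.+1.
  apply/same_regionP => x y xN yN xy; have := sab x y xN yN xy; rewrite /between.
  have [xa|xa] := eqVneq (lab x) (lab a).
    have := zmax y; rewrite /Q -xy xa eqxx andbT.
    by lia.
  have ya : lab y != lab a by rewrite -xy.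
  have xna : x != a by apply: contraNneq xa => ->.
  have xnz : x != z by apply: contraNneq xa => ->; rewrite za.
  have yna : y != a by apply: contraNneq ya => ->.
  have ynz : y != z by apply: contraNneq ya => ->; rewrite za.
  have cr : ~ [/\ (a < x)%N, (x < z)%N & (z < y)%N].
    case=> h1 h2 h3; case/eqP: xa.
    by rewrite -(lab_noncrossing h1 h2 h3 yN (esym za) xy).
  by move=> h h'; apply: contraT => h''; case: cr; split; move: h h' h''; lia.
have := nc z.+1; rewrite szb ltnS az; case: ltnP => [_ /(_ isT isT)//|bz _].
by have -> : b.-1 = z by lia.
Qed.

(** [region_step] across the origin, from the lowest arc [m] of the region to the highest one [M].
    The last point of the block of [M] met before [m] on the circle is its largest point below [m]
    or, if there is none, its largest point. *)
Lemma region_wrap m M : (0 < m)%N -> (m <= M)%N -> (M < N)%N -> same_region m M ->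
  (forall c, (c < m)%N -> ~~ same_region m c) ->
  (forall c, (M < c)%N -> (c <= N)%N -> ~~ same_region m c) -> lab m.-1 = lab M.
Proof.
move=> m0 mM MN smM nlo nhi; have /same_regionP smMP := smM.
case: (boolP [exists z : 'I_N, (z < m)%N && (lab z == lab M)]) => [/existsP[z0 z0P]|nz].
  pose Q z := (z < m)%N && (lab z == lab M).
  have Qa : exists z, Q z by exists z0.
  have Qb z : Q z -> (z <= m)%N by case/andP => /ltnW.
  have [z /andP[zm /eqP zM] zmax] := ex_maxnP Qa Qb.
  have szm : same_region z.+1 m.
    apply/same_regionP => x y xN yN xy; have := smMP x y xN yN xy.
    have := smMP y x yN xN (esym xy); rewrite /between.
    have [xa|xa] := eqVneq (lab x) (lab M).
      by have := zmax x; rewrite /Q xa eqxx andbT; lia.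
    have ya : lab y != lab M by rewrite -xy.
    have xnM : x != M by apply: contraNneq xa => ->.
    have xnz : x != z by apply: contraNneq xa => ->; rewrite zM.
    have ynM : y != M by apply: contraNneq ya => ->.
    have ynz : y != z by apply: contraNneq ya => ->; rewrite zM.
    have cr1 : ~ [/\ (y < z)%N, (z < x)%N & (x < M)%N].
      case=> h1 h2 h3; case/eqP: ya.
      by rewrite (lab_noncrossing h1 h2 h3 MN (esym xy) zM).
    have cr2 : ~ [/\ (z < x)%N, (x < M)%N & (M < y)%N].
      case=> h1 h2 h3; case/eqP: xa.
      by rewrite -(lab_noncrossing h1 h2 h3 yN zM xy).
    move=> h h' h''; apply: contraT => h3; have [yM|yM] := ltnP y M.
      by case: cr1; split; move: h h' h'' h3; lia.
    by case: cr2; split; move: h h' h'' h3; lia.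
  have := nlo z.+1; rewrite same_region_sym szm; case: ltnP => [_ /(_ isT)//|bz _].
  by have -> : m.-1 = z by lia.
pose Q z := (z < N)%N && (lab z == lab M).
have Qa : exists z, Q z by exists M; rewrite /Q MN eqxx.
have Qb z : Q z -> (z <= N)%N by case/andP => /ltnW.
have [z /andP[zN /eqP zM] zmax] := ex_maxnP Qa Qb.
have Mz : (M <= z)%N by apply: zmax; rewrite /Q MN eqxx.
have no y : (y < N)%N -> lab y = lab M -> (m <= y)%N.
  move=> yN yM; rewrite leqNgt; apply: contra nz => ym.
  by apply/existsP; exists (Ordinal yN); rewrite /= ym yM eqxx.
have sMz : same_region M z.+1.
  apply/same_regionP => x y xN yN xy; have := smMP x y xN yN xy.
  have := smMP y x yN xN (esym xy); rewrite /between.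
  have [xa|xa] := eqVneq (lab x) (lab M).
    have ya : lab y = lab M by rewrite -xy.
    have := zmax y; have := no x xN xa; have := no y yN ya.
    by rewrite /Q ya eqxx andbT; lia.
  have ya : lab y != lab M by rewrite -xy.
  have xnM : x != M by apply: contraNneq xa => ->.
  have xnz : x != z by apply: contraNneq xa => ->; rewrite zM.
  have ynM : y != M by apply: contraNneq ya => ->.
  have ynz : y != z by apply: contraNneq ya => ->; rewrite zM.
  have cr1 : ~ [/\ (y < M)%N, (M < x)%N & (x < z)%N].
    case=> h1 h2 h3; case/eqP: ya.
    by rewrite (lab_noncrossing h1 h2 h3 zN (esym xy) (esym zM)).
  have cr2 : ~ [/\ (M < x)%N, (x < z)%N & (z < y)%N].
    case=> h1 h2 h3; case/eqP: xa.
    by rewrite -(lab_noncrossing h1 h2 h3 yN (esym zM) xy).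
  move=> h h' h''; apply: contraT => h3; have [yM|yM] := ltnP y M.
    by case: cr1; split; move: h h' h'' h3; lia.
  by case: cr2; split; move: h h' h'' h3; lia.
by have := nhi z.+1; rewrite (same_region_trans smM sMz) ltnS Mz zN => /(_ isT isT).
Qed.

(** The points between the two arcs form a union of blocks and, the arcs being even, of pairs. By
    connectedness they are all the points. *)
Lemma same_region_open a b : ~~ odd a -> ~~ odd b -> (a < b)%N -> (b <= N)%N ->
  same_region a b -> a = 0 /\ b = N.
Proof.
move=> ao bo ab bN /same_regionP sab.
have aN : (a < N)%N by lia.
have N0 : (0 < N)%N by rewrite /N double_gt0.
have aa : between a b a by rewrite /between ltnn ab.
have main x : (x < N)%N -> between a b x.
  move=> xN; apply: (lab_connected (Z := between a b)) aN xN aa; first exact: sab.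
  by move=> l ln; rewrite /between; lia.
have := main 0 N0; have := main N.-1; rewrite /between; lia.
Qed.

(** The other arcs of the region of [o] in the order in which its boundary is walked: downwards from
    [o], then downwards from [N - 1]. *)
Definition region_tail o := filter (same_region o) (rev (iota 0 o))
  ++ filter (same_region o) (rev (iota o.+1 (N - o.+1))).

Let R b a := lab b.-1 == lab a.

Lemma region_descending o b k m : (k + m <= b)%N -> (b <= N)%N -> same_region o b ->
  (forall d, (k + m <= d)%N -> (d < b)%N -> ~~ same_region o d) ->
  path R b (filter (same_region o) (rev (iota k m))).
Proof.
move=> kmb bN ob nb; have sE a c : same_region o a -> same_region a c = same_region o c.
  move=> oa; apply/idP/idP; apply: same_region_trans => //.
  by rewrite same_region_sym.
apply: path_descending => [a c ka ac cm oa oc nd|a ka am oa nd]; apply/eqP.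
  apply: region_step; rewrite ?sE //; first lia.
  by move=> d ad dc; rewrite sE ?nd.
apply: region_step; rewrite ?sE //; first lia.
move=> d ad db; rewrite sE //; have [dk|dk] := ltnP d (k + m); first exact: nd.
exact: nb.
Qed.

Lemma region_cycle o : (0 < o)%N -> (o < N)%N -> ~~ same_region o 0 ->
  path R o (rcons (region_tail o) o).
Proof.
move=> o0 oN no0.
have sE a c : same_region o a -> same_region a c = same_region o c.
  move=> oa; apply/idP/idP; apply: same_region_trans => //.
  by rewrite same_region_sym.
have -> : rcons (region_tail o) o = filter (same_region o) (rev (iota 0 o))
    ++ filter (same_region o) (rev (iota o (N - o))).
  rewrite /region_tail rcons_cat; congr (_ ++ _).
  have -> : (N - o = (N - o.+1).+1)%N by lia.
  by rewrite /= rev_cons filter_rcons same_region_refl.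
rewrite cat_path region_descending ?same_region_refl //=; last 2 first.
- lia.
- by move=> d; rewrite add0n; lia.
have [|pm mo nlo] := last_descending (same_region_refl o) (leqnn o).
  by move=> d; lia.
set m := last _ _ in pm mo nlo *.
have m0 : (0 < m)%N by rewrite lt0n; apply: contraNneq no0 => <-.
apply: path_descending => [a c ka ac cm oa oc nd|a ka am oa nd]; apply/eqP.
  by apply: region_step; rewrite ?sE //; [lia | move=> d ad dc; rewrite sE ?nd].
apply: region_wrap; rewrite ?sE //; try lia.
  by move=> c cm; rewrite sE // nlo.
move=> c ac cN; rewrite sE //; have [cN'|Nc] := ltnP c N; first by apply: nd; lia.
have -> : c = N by lia.
by apply: contra no0 => oN'; apply: same_region_trans oN' _; rewrite same_region_sym same_region0N.
Qed.

Lemma region_descent : path R N (region_tail N).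
Proof.
rewrite /region_tail (_ : N - N.+1 = 0)%N ?cats0; last lia.
by apply: region_descending; rewrite ?same_region_refl // => d; lia.
Qed.

Lemma mem_region_tail o a : (o <= N)%N ->
  (a \in region_tail o) = [&& (a < N)%N, a != o & same_region o a].
Proof.
move=> oN; rewrite mem_cat !mem_filter !mem_rev !mem_iota -andb_orr andbC andbA.
congr (_ && _); lia.
Qed.

Lemma uniq_region_tail o : uniq (region_tail o).
Proof.
rewrite cat_uniq !filter_uniq ?rev_uniq ?iota_uniq //= andbT.
apply/hasPn => a; rewrite !mem_filter !mem_rev !mem_iota => /andP[_ h].
by rewrite negb_and; apply/orP; right; lia.
Qed.

Definition side_edge (a : nat) : 'I_n := insubd (Ordinal n_gt0) a./2.

Lemma val_side_edge a : (a < N)%N -> side_edge a = a./2 :> nat.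
Proof. by move=> aN; rewrite val_insubd (_ : (a./2 < n)%N) //; lia. Qed.

Lemma side_edge_eq a (e : 'I_n) : (a < N)%N -> odd a ->
  (side_edge a == e) = (a == e.*2.+1).
Proof.
move=> aN oa; rewrite -val_eqE /= val_side_edge //.
by have := odd_double_half a; rewrite oa; lia.
Qed.

Definition labelled_graph : multigraph V 'I_n :=
  [ffun e : 'I_n => (lab e.*2, lab e.*2.+1)].
Let G := labelled_graph.

Lemma joins_labelled (e : 'I_n) : joins G e (lab e.*2) (lab e.*2.+1).
Proof. by rewrite /joins ffunE eqxx. Qed.

(** An inner side is run backwards, from the second point of its pair to the first. *)
Lemma joins_arc a : (a < N)%N -> odd a -> joins G (side_edge a) (lab a) (lab a.-1).
Proof.
move=> aN oa; have := joins_labelled (side_edge a); rewrite joinsC val_side_edge //.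
have h := odd_double_half a; rewrite oa in h.
have -> : a./2.*2 = a.-1 by lia.
by have -> : a.-1.+1 = a by lia.
Qed.

Definition arc_walk (s : seq nat) := [seq (lab a, side_edge a) | a <- s].
Definition closed_arcs (s : seq nat) := all (fun a => odd a && (a < N)%N) s.

Lemma trail_arcs b s : closed_arcs s -> path R b s ->
  trail G (lab b.-1) (arc_walk s) (lab (last b s).-1).
Proof.
elim: s b => [|a s IHs] b /=; first by rewrite eqxx.
case/andP => /andP[oa aN] cs /andP[/eqP -> ps].
exact/(@trail_consP _ _ G _ _ _ (lab a))/(ex_intro _ (lab a.-1))/And3/IHs/ps/cs/joins_arc.
Qed.

(** The inner sides walked between the outer side of edge [j] and that of the next edge. The filter
    removes something only for the last [j], namely the arc 0, which is the arc [N] itself. *)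
Definition inner_arcs j := filter odd (region_tail j.*2.+2).
Definition walk_segment j := (lab j.*2, side_edge j.*2) :: arc_walk (inner_arcs j).
Definition boundary_walk m := flatten [seq walk_segment j | j <- iota 0 m].

Lemma same_region_even_tail o a : ~~ odd o -> (0 < o)%N -> (o < N)%N ->
  a \in region_tail o -> odd a.
Proof.
move=> oo o0 oN; rewrite mem_region_tail ?(ltnW oN) // => /and3P[aN ao oa].
apply: contraT => ea; have [lt|gt|eq] := ltngtP o a.
- by have [] := same_region_open oo ea lt (ltnW aN) oa; lia.
- rewrite same_region_sym in oa.
  by have [] := same_region_open ea oo gt (ltnW oN) oa; lia.
- by rewrite eq eqxx in ao.
Qed.

Lemma closed_inner_arcs j : (j < n)%N -> closed_arcs (inner_arcs j).
Proof.
move=> jn; apply/allP => a; rewrite mem_filter mem_region_tail; last lia.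
by case/and4P => -> ->.
Qed.

Lemma trail_segment_labelled j : (j < n)%N ->
  trail G (lab j.*2) (walk_segment j) (lab j.+1.*2).
Proof.
move=> jn; have jj : joins G (side_edge j.*2) (lab j.*2) (lab j.*2.+1).
  by have := joins_labelled (side_edge j.*2); rewrite val_side_edge ?doubleK //; lia.
rewrite (trail_joins _ _ jj); set o := j.*2.+2.
(* The descent leaves the arc [o] at the vertex [lab o.-1] and closes at an arc [z] standing for
   [o]: [o] itself, or 0 when [o] is [N]. *)
have pl s z : path R o (rcons s z) -> closed_arcs s -> lab z = lab o ->
    trail G (lab j.*2.+1) (arc_walk s) (lab o).
  rewrite rcons_path => /andP[ps /eqP lz] cs <-; rewrite -lz.
  exact: (trail_arcs cs ps).
have := closed_inner_arcs jn; rewrite /inner_arcs -/o => cl.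
have [jn'|jn'] := ltnP j.+1 n.
  have oN : (o < N)%N by rewrite /o /N; lia.
  have fE : filter odd (region_tail o) = region_tail o.
    by apply/all_filterP/allP => a; apply: same_region_even_tail; rewrite // /o /= negbK odd_double.
  rewrite fE in cl *; apply: (pl _ o) => //; apply: region_cycle => //.
  apply/negP; rewrite same_region_sym => s0.
  by have [] := same_region_open _ _ _ (ltnW oN) s0; rewrite /= ?negbK ?odd_double //; lia.
have oE : o = N by rewrite /o /N; lia.
have -> : j.+1.*2 = N by rewrite /N; lia.
rewrite oE in cl pl *; apply: (pl _ 0) => //.
suff <- : region_tail N = rcons (filter odd (region_tail N)) 0 by exact: region_descent.
rewrite /region_tail (_ : N - N.+1 = 0)%N ?cats0; last lia.
have N0 : (0 < N)%N by rewrite /N double_gt0.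
rewrite -(prednK N0) (_ : iota 0 N.-1.+1 = 0 :: iota 1 N.-1) // rev_cons prednK //.
rewrite filter_rcons same_region_sym same_region0N filter_rcons /=; congr rcons.
apply/esym/all_filterP/allP => a; rewrite mem_filter mem_rev mem_iota => /andP[sa al].
apply: contraT => ea; rewrite same_region_sym in sa.
by have [] := same_region_open ea _ _ (leqnn N) sa; rewrite ?odd_double //; lia.
Qed.

Lemma trail_boundary m : (m <= n)%N -> trail G (lab 0) (boundary_walk m) (lab m.*2).
Proof.
elim: m => [|m IHm] mn; first exact: eqxx.
rewrite /boundary_walk -[m.+1]addn1 iotaD map_cat flatten_cat /= cats0 addn1.
apply/trail_cat; exists (lab m.*2); first by apply: IHm; lia.
exact: trail_segment_labelled.
Qed.

Lemma graph_cycle_boundary : graph_cycle G (boundary_walk n).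
Proof.
apply/graph_cycleP; exists (lab 0); first by rewrite /boundary_walk -[X in iota 0 X]prednK.
by rewrite -{2}lab_wrap; apply: trail_boundary.
Qed.

Definition boundary_mask m :=
  flatten [seq true :: nseq (size (inner_arcs j)) false | j <- iota 0 m].

Lemma size_boundary_mask m : size (boundary_mask m) = size (boundary_walk m).
Proof.
rewrite !size_flatten /shape -!map_comp; congr sumn; apply: eq_map => j /=.
by rewrite size_nseq size_map.
Qed.

Lemma mask_boundary m : mask (boundary_mask m) (boundary_walk m)
  = [seq (lab j.*2, side_edge j.*2) | j <- iota 0 m].
Proof.
rewrite /boundary_mask /boundary_walk; elim: (iota 0 m) => //= j s IHs.
rewrite mask_cat ?size_nseq ?size_map // IHs.
by rewrite -[size _](size_map (fun a => (lab a, side_edge a))) mask_false.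
Qed.

Lemma unzip2_mask_boundary :
  unzip2 (mask (boundary_mask n) (boundary_walk n)) = enum 'I_n.
Proof.
apply: (inj_map (@ord_inj n)); rewrite mask_boundary val_enum_ord -!map_comp.
rewrite -[RHS]map_id; apply/eq_in_map => j; rewrite mem_iota => jn /=.
by rewrite val_side_edge ?doubleK //; lia.
Qed.

Lemma count_arc_walk s (e : 'I_n) : closed_arcs s -> uniq s ->
  count_mem e (unzip2 (arc_walk s)) = (e.*2.+1 \in s).
Proof.
move=> /allP cs us; rewrite /unzip2 -map_comp count_map -count_uniq_mem //.
by apply: eq_in_count => a /cs/andP[oa aN] /=; rewrite side_edge_eq.
Qed.

(* The arc 2e + 1 runs along the edge e, and 2j + 2 from the edge j to the edge
   j + 1; the latter is open to the outer face. *)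
Definition opens (e : 'I_n) := [exists j : 'I_n, same_region j.*2.+2 e.*2.+1].

Lemma opens_inj (j j' : 'I_n) a :
  same_region j.*2.+2 a -> same_region j'.*2.+2 a -> j = j' :> nat.
Proof.
rewrite [same_region j'.*2.+2 a]same_region_sym => ja ja'.
have jj := same_region_trans ja ja'; have := ltn_ord j; have := ltn_ord j'.
have [lt|gt|//] := ltngtP j j' => j'n jn.
  by have [] := same_region_open _ _ _ _ jj; rewrite /= ?negbK ?odd_double // /N; lia.
rewrite same_region_sym in jj.
by have [] := same_region_open _ _ _ _ jj; rewrite /= ?negbK ?odd_double // /N; lia.
Qed.

(** One passage is the outer one, at the head of segment [e]. An inner one occurs in segment [j]
    when the arc [2e + 1] is in the region of [2j + 2], which happens for at most one [j]. *)
Lemma count_boundary (e : 'I_n) :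
  count_mem e (unzip2 (boundary_walk n)) = (opens e).+1.
Proof.
rewrite /unzip2 /boundary_walk map_flatten -map_comp count_flatten -map_comp sumnE big_map.
have -> : iota 0 n = [seq val j | j <- enum 'I_n] by rewrite val_enum_ord.
rewrite big_map big_enum /= (eq_bigr (fun j : 'I_n => (j == e) + same_region j.*2.+2 e.*2.+1)%N).
  rewrite big_split /= (bigD1 e) //= eqxx big1 => [|j /negPf -> //].
  rewrite addn0 add1n; congr _.+1.
  case: (boolP (opens e)) => [/existsP[j0 j0e]|/existsPn ne]; last first.
    by apply: big1 => j _; rewrite (negPf (ne j)).
  rewrite (bigD1 j0) //= j0e big1 // => j nj; apply/eqP; rewrite eqb0.
  apply: contra nj => je; apply/eqP/val_inj; exact: opens_inj je j0e.
move=> j _; rewrite /= -val_eqE /= val_side_edge ?doubleK; last by have := ltn_ord j; lia.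
rewrite -/(unzip2 _) count_arc_walk ?filter_uniq ?uniq_region_tail ?closed_inner_arcs //.
rewrite mem_filter /= odd_double /= mem_region_tail; last by have := ltn_ord j; rewrite /N; lia.
congr (_ + nat_of_bool _)%N; rewrite -[RHS]andTb andbA; congr (_ && _).
by have := ltn_ord e; rewrite /N; lia.
Qed.

Definition region_set a b : {set V} := [set lab x | x : 'I_N & between a b x].

Lemma mem_region_set a b x : same_region a b -> (x < N)%N ->
  (lab x \in region_set a b) = between a b x.
Proof.
move=> /same_regionP sab xN; apply/imsetP/idP => [[y]|h]; last first.
  by exists (Ordinal xN); rewrite // inE.
by rewrite inE => h xy; apply: sab h => //.
Qed.

Lemma crosses_region_set a b (e : 'I_n) : same_region a b ->
  crosses G (region_set a b) e = (a == e.*2.+1) (+) (b == e.*2.+1).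
Proof.
move=> sab; have eN := ltn_ord e; rewrite (crosses_joins _ (joins_labelled e)).
by rewrite !mem_region_set //; rewrite /between /N; lia.
Qed.

(** The even arc [2j + 2] runs along no edge, so the cut between it and [2e + 1] consists of [e]
    alone; a simple cycle through [e] would cross it exactly once. *)
Lemma opens_flexible (e : 'I_n) : opens e -> ~~ rigid G e.
Proof.
case/existsP => j je; apply/negP => /asboolP[c /and3P[gc _ uc] ec].
have := graph_cycle_parity (region_set j.*2.+2 e.*2.+1) gc.
rewrite (eq_count (a2 := fun x => x.2 == e)) => [|[v f] /=].
  by rewrite -[count _ c](count_map snd (pred1 e)) count_uniq_mem // ec.
rewrite crosses_region_set //.
have -> : (j.*2.+2 == f.*2.+1) = false by lia.
by rewrite /= eqSS -!muln2 eqn_pmul2r // eq_sym val_eqE.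
Qed.

Definition region_walk (e : 'I_n) := arc_walk (e.*2.+1 :: region_tail e.*2.+1).

Lemma closed_region_tail (e : 'I_n) : ~~ opens e ->
  closed_arcs (e.*2.+1 :: region_tail e.*2.+1).
Proof.
move=> ne; have eN := ltn_ord e; apply/allP => a; rewrite inE.
case/orP => [/eqP ->|]; first by rewrite /= odd_double /N; lia.
rewrite mem_region_tail; last by rewrite /N; lia.
case/and3P => aN _ ea; rewrite aN andbT; apply: contraNT ne => oa.
have [a0|a0] := posnP a.
  have jn : (n.-1 < n)%N by lia.
  apply/existsP; exists (Ordinal jn); rewrite same_region_sym.
  rewrite a0 in ea; have -> : (Ordinal jn).*2.+2 = N by rewrite /N /=; lia.
  exact: same_region_trans ea same_region0N.
have jn : (a./2.-1 < n)%N by rewrite /N in aN; lia.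
apply/existsP; exists (Ordinal jn); rewrite same_region_sym.
by have -> : (Ordinal jn).*2.+2 = a; last by []; have := odd_double_half a; rewrite /= ; lia.
Qed.

Lemma simple_region_walk (e : 'I_n) : ~~ opens e -> simple_cycle G (region_walk e).
Proof.
move=> ne; have cl := closed_region_tail ne; have eN := ltn_ord e.
set o := e.*2.+1 in cl *; have oN : (o < N)%N by rewrite /o /N; lia.
have us : uniq (o :: region_tail o).
  by rewrite /= uniq_region_tail mem_region_tail ?(ltnW oN) // eqxx andbF.
have so x : x \in o :: region_tail o -> same_region o x.
  rewrite inE => /orP[/eqP ->|]; first exact: same_region_refl.
  by rewrite mem_region_tail ?(ltnW oN) // => /and3P[].
apply/and3P; split.
- rewrite /region_walk -/o.
  have := region_cycle (isT : (0 < o)%N) oN.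
  have -> : ~~ same_region o 0.
    apply: contra ne => o0; have jn : (n.-1 < n)%N by lia.
    apply/existsP; exists (Ordinal jn).
    have -> : (Ordinal jn).*2.+2 = N by rewrite /N /=; lia.
    by rewrite same_region_sym; apply: same_region_trans o0 same_region0N.
  move=> /(_ isT); rewrite rcons_path => /andP[po /eqP lo].
  have /andP[/andP[oo _] ct] := cl.
  rewrite [arc_walk _]/= graph_cycle_trail (trail_joins _ _ (joins_arc oN oo)).
  by rewrite -lo; apply: trail_arcs.
- rewrite /region_walk -/o /unzip1 /arc_walk -map_comp map_inj_in_uniq //.
  move=> x y xo yo /= xy.
  (* If [x < y], the point [x] lies between the arcs [x] and [y] while the point [y] does not, so
     that in one region they cannot have the same label. *)
  have sxy : same_region x y.
    have := so x xo; rewrite same_region_sym => h.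
    exact: same_region_trans h (so y yo).
  have /andP[_ xN] := allP cl x xo; have /andP[_ yN] := allP cl y yo.
  have h1 := (same_regionP _ _ sxy) x y xN yN xy.
  have h2 := (same_regionP _ _ sxy) y x yN xN (esym xy).
  by move: h1 h2; rewrite /between; lia.
- rewrite /region_walk -/o /unzip2 /arc_walk -map_comp map_inj_in_uniq //.
  move=> x y /(allP cl)/andP[ox xN] /(allP cl)/andP[oy yN] /= /(congr1 val) /=.
  rewrite !val_side_edge //; have := odd_double_half x; have := odd_double_half y.
  by rewrite ox oy; lia.
Qed.

Lemma rigid_labelled (e : 'I_n) : rigid G e = ~~ opens e.
Proof.
apply/idP/idP; first by apply: contraL => /opens_flexible.
move=> ne; apply/asboolP; exists (region_walk e); first exact: simple_region_walk.
rewrite /region_walk /= inE; apply/orP; left; rewrite eq_sym side_edge_eq //.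
  by have := ltn_ord e; rewrite /N; lia.
by rewrite /= odd_double.
Qed.

(** Each further arc of the region gives a cut made of its edge and [e]; a cycle through [e] crosses
    it evenly, hence contains the other edge. So the region walk is, up to rotation and reversal,
    the only simple cycle through [e]. *)
Lemma region_walk_sub (e : 'I_n) c : ~~ opens e -> simple_cycle G c ->
  e \in unzip2 c -> {subset unzip2 (region_walk e) <= unzip2 c}.
Proof.
move=> ne /and3P[gc _ uc] ec f; rewrite /region_walk /unzip2 -map_comp.
case/mapP => a; rewrite -[e.*2.+1 :: _]/(e.*2.+1 :: region_tail e.*2.+1) => ae -> /=.
have /andP[oa aN] := allP (closed_region_tail ne) a ae.
have eN := ltn_ord e.
have [a_e|a_e] := eqVneq a e.*2.+1.
  by move: (side_edge_eq e aN oa); rewrite a_e eqxx => /eqP ->.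
have sae : same_region a e.*2.+1.
  move: ae; rewrite inE (negPf a_e) mem_region_tail /=; last by rewrite /N; lia.
  by rewrite same_region_sym => /and3P[].
apply: contraT => nf; have := graph_cycle_parity (region_set a e.*2.+1) gc.
rewrite (eq_in_count (a2 := fun x => x.2 == e)) => [|[v g] vg /=].
  by rewrite -[count _ c](count_map snd (pred1 e)) count_uniq_mem // ec.
rewrite crosses_region_set // -(side_edge_eq g aN oa).
have -> : (side_edge a == g) = false.
  by apply: contraNF nf => /eqP ->; apply/mapP; exists (v, g).
by rewrite /= eqSS -!muln2 eqn_pmul2r // eq_sym val_eqE.
Qed.

Lemma labelled_connected : connected_graph G.
Proof.
have N0 : (0 < N)%N by rewrite /N double_gt0.
split; first by apply/card_gt0P; exists (lab 0).
move=> u v; have [x xN <-] := lab_surjective u; have [y yN <-] := lab_surjective v.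
apply: (lab_connected (Z := fun y => connect (fun x y => [exists e, joins G e x y])
  (lab x) (lab y))) xN yN (connect0 _ _) => [a b _ _ -> //|l ln].
have j (e : 'I_n) : e = l :> nat -> joins G e (lab l.*2) (lab l.*2.+1).
  by move=> <-; apply: joins_labelled.
by apply/idP/idP => h; apply: connect_trans h (connect1 _); apply/existsP;
  exists (Ordinal ln); rewrite ?j // joinsC j.
Qed.

Lemma labelled_cactus : cactus G.
Proof.
split; first exact: labelled_connected.
move=> e c d sc sd ec ed; have [oe|ne] := boolP (opens e).
  by case/negP: (opens_flexible oe); apply/asboolP; exists c.
have sw := simple_region_walk ne.
have wd := same_cycle_edges (simple_cycle_sub sw sd (region_walk_sub ne sd ed)).
by apply: (simple_cycle_sub sd sc) => f; rewrite -wd; apply: region_walk_sub.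
Qed.

Lemma boundary_outercycle : outercycle G (boundary_walk n).
Proof.
split; first exact: graph_cycle_boundary.
by move=> e; rewrite count_boundary rigid_labelled; case: (opens e).
Qed.

Lemma boundary_selected : exists2 S : {set 'I_n}, S \subset choices G (boundary_walk n) &
  selected S (boundary_walk n) = [seq (lab j.*2, side_edge j.*2) | j <- iota 0 n].
Proof.
set c := boundary_walk n.
pose S : {set 'I_n} := [set e | ~~ nth false (boundary_mask n) (index e (unzip2 c))].
have bE : boundary_mask n = marks S [::] (unzip2 c).
  have c1 e : count_mem e (mask (boundary_mask n) (unzip2 c)) = 1%N.
    by rewrite -map_mask -/(unzip2 _) unzip2_mask_boundary count_uniq_mem ?enum_uniq // mem_enum.
  apply: marks_eq => [|e _|e _|e _]; last exact: c1.
  - by rewrite size_boundary_mask size_map.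
  - by rewrite inE.
  - by rewrite count_boundary; case: (opens e).
exists S; last by rewrite /selected -bE mask_boundary.
apply/subsetP => e eS; rewrite inE; apply/andP; split.
  have := count_marks S [::] (unzip2 c) e; rewrite -bE in_nil eS -map_mask.
  rewrite -/(unzip2 _) unzip2_mask_boundary count_uniq_mem ?enum_uniq // mem_enum.
  by rewrite count_boundary rigid_labelled; case: (opens e).
apply: contraL eS; rewrite inE negbK /c /boundary_walk /boundary_mask.
have -> : iota 0 n = 0 :: iota 1 n.-1 by rewrite -[in LHS](prednK n_gt0).
by move=> /eqP[->] /=; rewrite eqxx.
Qed.

End CactusOfLabelling.

(** * Size bounds and invariance under isomorphism *)

Lemma joinsE (V E : finType) (G : multigraph V E) e x y u v : joins G e x y ->
  joins G e u v = (u == x) && (v == y) || (u == y) && (v == x).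
Proof.
rewrite /joins => /orP[] /eqP ->; rewrite !xpair_eqE ![_ == u]eq_sym ![_ == v]eq_sym;
  by do ?case: (_ == _).
Qed.

(** Makes the constructed cactus fit into [colored_walk]. A vertex other than the start is sent to
    the edge by which the walk first enters it. If two vertices shared this edge, the later one
    would be its other end and would have been visited before. *)
Lemma walk_vertex_bound (V : finType) n (G : multigraph V 'I_n) c :
  cactus G -> outercycle G c -> (#|V| <= n.+1)%N.
Proof.
move=> cG oc; have [u c0 t] := graph_cycleP _ _ oc.1.
have [d0 d0c] : exists d0, d0 \in c by case: (c) c0 => // d c' _; exists d; rewrite mem_head.
have n0 : (0 < n)%N by apply: leq_ltn_trans (ltn_ord d0.2).
have u_c : nth u (unzip1 c) 0 = u by case: (c) c0 t => // -[x e] c' _ /trail_head.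
have vis v : v \in unzip1 c.
  have [e [w]] : exists e w, joins G e w v.
    have e0 := d0.2; have [[_ conn] _] := cG.
    have /connectP[p] := conn (G e0).1 v; case/lastP: p => [_ ->|p w].
      by exists e0, (G e0).2; rewrite joinsC joins_ends.
    rewrite rcons_path last_rcons => /andP[_ /existsP[e j]] ->.
    by exists e, (last (G e0).1 p).
  move=> j; have : e \in unzip2 c.
    by rewrite -has_pred1 has_count oc.2; case: ifP.
  case/mapP => -[x e'] xc /= eE; rewrite -{e'}eE in xc.
  have [j' o] := trail_next t xc.
  have uc : u \in unzip1 c by rewrite -u_c mem_nth // size_map; case: (c) c0.
  have oc' : opposite G e x \in unzip1 c.
    by move: o; rewrite mem_rcons inE => /orP[/eqP ->|].
  case/orP: (joins_same j j') => /andP[/eqP xE /eqP oE]; first by rewrite -oE.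
  by rewrite -xE; apply/mapP; exists (x, e).
pose idx v := index v (unzip1 c).
pose entry v := (nth d0 c (idx v).-1).2.
have idx_lt v : (idx v < size c)%N by rewrite -(size_map fst) index_mem vis.
have jn v : v != u -> (0 < idx v)%N /\ joins G (entry v) (nth u (unzip1 c) (idx v).-1) v.
  move=> vu; have i0 : (0 < idx v)%N.
    rewrite lt0n; apply: contraNneq vu => i0.
    by rewrite -(nth_index u (vis v)) -/(idx v) i0 u_c.
  split=> //; have ilt : ((idx v).-1 < size c)%N by have := idx_lt v; lia.
  have := opposite_trail t => /(congr1 (fun s => nth u s (idx v).-1)).
  rewrite (nth_map d0) // nth_behead nth_rcons_default prednK // nth_index //.
  rewrite (nth_map d0) //; have := mem_nth d0 ilt; rewrite /entry.
  by case: (nth d0 c _) => x e /(trail_next t)[j _] /= <-.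
have inj : {in [set~ u] &, injective entry}.
  move=> v v'; rewrite !inE => vu v'u ee; apply/eqP; apply: contraT => vv'.
  have [i0 j] := jn v vu; have [i0' j'] := jn v' v'u.
  wlog lt : v v' vu v'u ee vv' i0 j i0' j' / (idx v < idx v')%N.
    move=> wl; have [lt|lt|e] := ltngtP (idx v) (idx v'); first exact: (wl v v').
      by apply: (wl v' v); rewrite // eq_sym.
    by move/(congr1 (nth u (unzip1 c))): e vv'; rewrite !nth_index // => ->; rewrite eqxx.
  rewrite ee in j; case/orP: (joins_same j j') => /andP[_ /eqP v'E].
    by rewrite v'E eqxx in vv'.
  have lt' : ((idx v).-1 < idx v')%N by lia.
  by have := before_find u (a := pred1 v') lt'; rewrite /= v'E eqxx.
have := max_card [in entry @: [set~ u]]; rewrite card_in_imset // card_ord cardsC1.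
by have : (0 < #|V|)%N by [case: cG => -[]]; lia.
Qed.

Lemma outercycle_size (V : finType) n (G : multigraph V 'I_n) c :
  outercycle G c -> (size c <= n.*2)%N.
Proof.
case=> _ cnt; rewrite -(size_map snd) -/(unzip2 c) -sum1_size.
rewrite (partition_big id predT) //=.
apply: (@leq_trans (\sum_(e < n) 2)%N); last by rewrite sum_nat_const card_ord muln2.
apply: leq_sum => e _; rewrite -big_filter sum1_size size_filter cnt; by case: ifP.
Qed.

Section MarksMap.
Variables (E E' : finType) (g : E -> E').
Hypothesis g_inj : injective g.

Lemma marks_map (S : {set E}) seen s :
  marks (g @: S) (map g seen) (map g s) = marks S seen s.
Proof.
elim: s seen => //= e s IHs seen.
by rewrite (mem_imset _ _ g_inj) (mem_map g_inj) -(IHs (e :: seen)).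
Qed.

End MarksMap.

Section Isomorphism.
Variables (V V' : finType) (n : nat) (G : multigraph V 'I_n) (G' : multigraph V' 'I_n).
Variables (f : V -> V') (g : 'I_n -> 'I_n).
Hypotheses (f_bij : bijective f) (g_bij : bijective g).
Hypothesis joins_fg : forall e u v, joins G' (g e) (f u) (f v) = joins G e u v.

Lemma rigid_iso e : rigid G' (g e) = rigid G e.
Proof.
have [f' fK f'K] := f_bij; have [g' gK g'K] := g_bij.
apply/idP/idP => [|re]; last exact (rigid_map joins_fg (bij_inj f_bij) (bij_inj g_bij) re).
have joins_fg' e' u v : joins G (g' e') (f' u) (f' v) = joins G' e' u v.
  by rewrite -joins_fg !f'K g'K.
by move/(rigid_map joins_fg' (can_inj f'K) (can_inj g'K)); rewrite gK.
Qed.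

Lemma bridges_iso c : bridges G' (map_walk f g c) = bridges G c.
Proof.
rewrite /bridges unzip2_map_walk (map_inj_uniq (bij_inj g_bij)) all_map.
by congr (_ && _); apply: eq_all => x /=; rewrite rigid_iso.
Qed.

Lemma choices_iso c : choices G' (map_walk f g c) = g @: choices G c.
Proof.
have gi := bij_inj g_bij; have [g' gK g'K] := g_bij.
apply/setP => e; rewrite -(g'K e) (mem_imset _ _ gi) !inE rigid_iso.
rewrite unzip2_map_walk; congr (_ && ~~ _); case: (unzip2 c) => //= a s.
by apply/eqP/eqP => -[]; [move/gi -> | move->].
Qed.

Lemma selected_iso (S : {set 'I_n}) c :
  selected (g @: S) (map_walk f g c) = map_walk f g (selected S c).
Proof.
rewrite /selected unzip2_map_walk -(marks_map (bij_inj g_bij) S [::]).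
by rewrite /map_walk map_mask.
Qed.

Lemma side_iso o (x : 'I_n.*2) : all (fun d => joins G d.2 d.1 (opposite G d.2 d.1)) o ->
  side G' (map_walk f g o) x = omap f (side G o x).
Proof.
move=> /allP jo; rewrite /side /map_walk onth_map.
case E: (onth o _) => [[u e]|] //=; congr Some; case: ifP => // _.
apply: (opposite_map joins_fg (v := opposite G e u)); apply: (jo (u, e)).
by apply/onthP; exists (half_ord x).
Qed.

End Isomorphism.

Lemma selected_head (V : finType) n (G : multigraph V 'I_n) c (S : {set 'I_n}) :
  S \subset choices G c -> ohead (selected S c) = ohead c.
Proof.
case: c => [|[u e] c] sub; first by rewrite /selected.
rewrite /selected /= (_ : (e \in S) = false) //.
by apply/negP => /(subsetP sub); rewrite inE /= eqxx andbF.
Qed.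

(** * Counting oriented cacti *)

Import GRing.Theory.

Section BlockWeight.
Local Open Scope ring_scope.
Variables (F : GRing.ComNzRing.type) (k N : nat) (kappa : nat -> 'I_k -> F).
Implicit Types V : {set 'I_N}.

(** The mixed cumulant of a block of free variables. For a nonempty block the sum has one term if
    the block is monochromatic and none otherwise; this form avoids choosing a point of the
    block. *)
Definition block_weight (col : 'I_N -> 'I_k) (V : {set 'I_N}) : F :=
  \sum_(c | V \subset [set x | col x == c]) kappa #|V| c.

Lemma block_weight_mono col V x : x \in V -> (forall y, y \in V -> col y = col x) ->
  block_weight col V = kappa #|V| (col x).
Proof.
move=> xV mono; rewrite /block_weight (big_pred1 (col x)) // => c.
apply/subsetP/eqP => [/(_ _ xV)|-> y yV]; rewrite inE; first by move/eqP.
by rewrite mono.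
Qed.

Lemma block_weight0 col V x y : x \in V -> y \in V -> col x != col y ->
  block_weight col V = 0.
Proof.
move=> xV yV xy; rewrite /block_weight big_pred0 // => c.
apply: contraNF xy => /subsetP sub.
by move: (sub _ xV) (sub _ yV); rewrite !inE => /eqP -> /eqP ->.
Qed.

End BlockWeight.

Section Configurations.
Variables (k n : nat).
Hypothesis n_gt0 : (0 < n)%N.
Variable k0 : 'I_k.
Let half := @half_ord n.

Definition point_color (i : {ffun 'I_n -> 'I_k * 'I_k}) (x : 'I_n.*2) : 'I_k :=
  if odd x then (i (half x)).2 else (i (half x)).1.

(** The indices of the terms of the connected sum that colours do not force to vanish. *)
Definition configurations :
    {set {ffun 'I_n -> 'I_k * 'I_k} * {set {set 'I_n.*2}}} :=
  [set Y | (Y.2 \in connected_NC half [set: 'I_n.*2]) &&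
     [forall V in Y.2, forall x in V, forall y in V,
        point_color Y.1 x == point_color Y.1 y]].

(** [k0] is a mere default: on [choice_pairs] every [side] is defined. *)
Definition reading (XS : colored_walk k n * {set 'I_n}) :
    {ffun 'I_n -> 'I_k * 'I_k} * {set {set 'I_n.*2}} :=
  let side_of := @side _ n (graph_of XS.1) (selected XS.2 (walk_of XS.1)) in
  let col x := odflt k0 (omap (@color_of k n XS.1) (side_of x)) in
  ([ffun l => (col (point l false), col (point l true))], kernel side_of).

Definition choice_pairs : {set colored_walk k n * {set 'I_n}} :=
  [set XS : colored_walk k n * {set 'I_n} | (XS.1 \in OCG k n) &&
     (XS.2 \subset choices (graph_of XS.1) (walk_of XS.1))].

Lemma point_color_point i l b : point_color i (point l b) = if b then (i l).2 else (i l).1.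
Proof. by rewrite /point_color odd_point /half half_point. Qed.

Lemma readingP X (S : {set 'I_n}) : oriented_cactus X ->
  S \subset choices (graph_of X) (walk_of X) ->
  exists (lab : 'I_n.*2 -> vertex X) (ed : 'I_n -> 'I_n),
  [/\ selected S (walk_of X) = [seq (lab (point l false), ed l) | l <- enum 'I_n],
      forall l, joins (graph_of X) (ed l) (lab (point l false)) (lab (point l true)),
      bijective ed, forall v, exists x, lab x = v
    & [/\ (reading (X, S)).2 = kernel lab,
          forall x, point_color (reading (X, S)).1 x = color_of (lab x) &
          kernel lab \in connected_NC half [set: 'I_n.*2]]].
Proof.
move=> [cG oc] sub; have [lab [ed [sE oE je be nc]]] := reading_labels cG oc sub.
exists lab, ed; split=> //; first by apply: labelling_surjective je cG.1 n_gt0.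
split.
- by apply: eq_kernel => x y; rewrite /= !sE.
- move=> x; rewrite -(point_half x) point_color_point /= ffunE /= !sE /=.
  by case: (odd x).
- exact: kernel_connected be je cG.1 n_gt0 (kernel_NCD nc).
Qed.

Lemma OCG_oriented X : X \in OCG k n -> oriented_cactus X.
Proof.
by move/(subsetP (transversal_sub (OCG_transversal k n))); rewrite inE => /asboolP.
Qed.

Lemma isomorphism_equivalence :
  {in oriented_cacti k n & &, equivalence_rel (fun X Y => `[< isomorphic X Y >])}.
Proof.
move=> X Y Z _ _ _; split; first exact/asboolP/isomorphic_refl.
move=> /asboolP XY; apply/asboolP/asboolP.
  exact/isomorphic_trans/isomorphic_sym.
exact: isomorphic_trans.
Qed.

Lemma mem_isomorphism_class X Y : oriented_cactus X -> oriented_cactus Y ->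
  reflect (isomorphic X Y) (Y \in pblock (isomorphism_classes k n) X).
Proof.
move=> oX oY; rewrite (pblock_equivalence_partition isomorphism_equivalence);
  by rewrite ?inE; apply/asboolP.
Qed.

Lemma OCG_isomorphic X Y : X \in OCG k n -> Y \in OCG k n -> isomorphic X Y -> X = Y.
Proof.
move=> XO YO iXY; apply: (pblock_inj (OCG_transversal k n)) => //.
have tI := partition_trivIset (equivalence_partitionP isomorphism_equivalence).
apply/esym/same_pblock => //; apply/mem_isomorphism_class => //; exact: OCG_oriented.
Qed.

Lemma OCG_representative X : oriented_cactus X ->
  exists2 Y, Y \in OCG k n & isomorphic X Y.
Proof.
move=> oX; have pP := equivalence_partitionP isomorphism_equivalence.
have cX : X \in cover (isomorphism_classes k n).
  by rewrite (cover_partition pP) inE; apply/asboolP.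
have YO := repr_mem_transversal (OCG_transversal k n) X (pblock_mem cX).
exists (transversal_repr X (OCG k n) (pblock (isomorphism_classes k n) X)) => //.
apply/mem_isomorphism_class => //; first exact: OCG_oriented.
exact: (repr_mem_pblock (OCG_transversal k n) X (pblock_mem cX)).
Qed.

Lemma reading_configuration X (S : {set 'I_n}) : oriented_cactus X ->
  S \subset choices (graph_of X) (walk_of X) -> reading (X, S) \in configurations.
Proof.
move=> oX sub; have [lab [ed [_ _ _ _ [PE cE con]]]] := readingP oX sub.
rewrite inE PE con /=; apply/forall_inP => V VP.
apply/forall_inP => x xV; apply/forall_inP => y.
by rewrite !cE (mem_kernel VP xV) inE => /eqP ->.
Qed.

(** Labellings with the same kernel give a bijection [f] of the vertices, and [g] matches the edges
    of the outer steps of equal rank. The outer steps then correspond, and [marked_trail_uniq]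
    extends this to the whole walks and to their masks. *)
Lemma reading_isomorphic X X' (S S' : {set 'I_n}) :
  oriented_cactus X -> oriented_cactus X' ->
  S \subset choices (graph_of X) (walk_of X) ->
  S' \subset choices (graph_of X') (walk_of X') ->
  reading (X, S) = reading (X', S') ->
  isomorphic X X' /\
  marks S [::] (unzip2 (walk_of X)) = marks S' [::] (unzip2 (walk_of X')).
Proof.
move=> oX oX' sub sub' rE.
have [lab [ed [oE je be sur [PE cE _]]]] := readingP oX sub.
have [lab' [ed' [oE' je' be' sur' [PE' cE' _]]]] := readingP oX' sub'.
have labE x y : (lab x == lab y) = (lab' x == lab' y).
  by apply: kernel_inj; rewrite -PE -PE' rE.
pose pt v := sval (cid (sur v)); have ptK v : lab (pt v) = v := svalP (cid (sur v)).
pose pt' v := sval (cid (sur' v)); have ptK' v : lab' (pt' v) = v := svalP (cid (sur' v)).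
pose f v := lab' (pt v); pose f' v := lab (pt' v).
have fE x : f (lab x) = lab' x by apply/eqP; rewrite -labE ptK.
have fE' x : f' (lab' x) = lab x by apply/eqP; rewrite labE ptK'.
have bf : bijective f.
  by exists f' => v; [rewrite -(ptK v) fE fE' | rewrite -(ptK' v) fE' fE].
have [ed1 edK edK1] := be.
pose g e := ed' (ed1 e).
have gE l : g (ed l) = ed' l by rewrite /g edK.
have bg : bijective g by apply: bij_comp be' _; exists ed.
have jfg e u v : joins (graph_of X') (g e) (f u) (f v) = joins (graph_of X) e u v.
  rewrite -(edK1 e) gE (joinsE _ _ (je _)) (joinsE _ _ (je' _)).
  by rewrite -(ptK u) -(ptK v) !fE -!labE.
have [cG oc] := oX; have [cG' oc'] := oX'.
have [u0 c0 t] := graph_cycleP _ _ oc.1; have [u1 c0' t'] := graph_cycleP _ _ oc'.1.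
have selE : map_walk f g (selected S (walk_of X)) = selected S' (walk_of X').
  by rewrite oE oE' /map_walk -map_comp; apply: eq_map => l /=; rewrite fE gE.
(* The first step of either walk is selected, so [f] respects the starting vertices. *)
have hd : f u0 = u1.
  have := congr1 ohead selE; rewrite (selected_head sub').
  have : ohead (map_walk f g (selected S (walk_of X))) =
      omap (fun x => (f x.1, g x.2)) (ohead (selected S (walk_of X))).
    by case: (selected _ _).
  move=> ->; rewrite (selected_head sub).
  case: (walk_of X) c0 t => // -[x e] c _ /trail_head <-.
  by case: (walk_of X') c0' t' => // -[x' e'] c' _ /trail_head <- /= [].
have := trail_map jfg t; rewrite hd => tm.
have [] := marked_trail_uniq (b := marks S [::] (unzip2 (walk_of X)))
  (b' := marks S' [::] (unzip2 (walk_of X'))) _ _ _ tm t'.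
- by rewrite size_marks !size_map.
- by rewrite size_marks size_map.
- by rewrite -[RHS]selE /map_walk /selected map_mask.
- rewrite -map_mask -/(map_walk f g _) (bridges_iso bf bg jfg).
  exact: bridges_unselected.
- exact: bridges_unselected.
move=> wE mE; split=> //; exists f, g; split=> //.
by move=> v; rewrite -(ptK v) fE -cE -cE' rE.
Qed.

Lemma mem_outercycle (V : finType) (G : multigraph V 'I_n) c e :
  outercycle G c -> e \in unzip2 c.
Proof. by case=> _ cnt; rewrite -has_pred1 has_count cnt; case: ifP. Qed.

Lemma reading_inj : {in choice_pairs &, injective reading}.
Proof.
move=> [X S] [X' S']; rewrite !inE /= => /andP[XO sub] /andP[XO' sub'] rE.
have [iso mE] := reading_isomorphic (OCG_oriented XO) (OCG_oriented XO') sub sub' rE.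
have XX := OCG_isomorphic XO XO' iso; case: X' / XX in XO' sub' rE iso mE *.
have [_ oc] := OCG_oriented XO.
by rewrite (marks_inj _ _ mE) // => e _; apply: mem_outercycle oc.
Qed.

Lemma configuration_reading Y : Y \in configurations ->
  exists2 XS, XS \in choice_pairs & reading XS = Y.
Proof.
case: Y => i P; rewrite inE /= => /andP[con /forall_inP mono].
have PN := connected_NCD con; have cP := NCD_cover PN.
have tP := partition_trivIset (NCD_partition PN).
have cx x : x \in cover P by rewrite cP inE.
have bP x : pblock P x \in P := pblock_mem (cx x).
have xP x : x \in pblock P x by rewrite mem_pblock.
pose x0 : 'I_n.*2 := point (Ordinal n_gt0) false.
pose labo x : 'I_#|P| := enum_rank_in (bP x0) (pblock P x).
have labE x y : (labo x == labo y) = (pblock P x == pblock P y).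
  by apply/eqP/eqP => [/enum_rank_in_inj-> //|]; rewrite /labo => ->.
have laboP x y : labo x = labo y -> y \in pblock P x.
  by move/eqP; rewrite labE => /eqP ->.
have sur v : exists x, labo x = v.
  have [x xv] := NCD_neq0 PN (enum_valP v); exists x.
  by rewrite /labo (def_pblock tP (enum_valP v) xv) enum_valK_in.
(* The default is the label of the point 0, so that [n.*2] and 0 get the same label. *)
pose lab m := odflt (labo x0) (omap labo (insub m)).
have labN (x : 'I_n.*2) : lab x = labo x by rewrite /lab valK.
have labL m (mN : (m < n.*2)%N) : lab m = labo (Ordinal mN) by rewrite -labN.
have lab_wrap : lab n.*2 = lab 0.
  by rewrite [LHS]/lab insubF ?ltnn //= -(labN x0).
have lab_nc x y z t : (x < y)%N -> (y < z)%N -> (z < t)%N -> (t < n.*2)%N ->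
    lab x = lab z -> lab y = lab t -> lab x = lab y.
  move=> xy yz zt tN; have zN := ltn_trans zt tN; have yN := ltn_trans yz zN.
  have xN := ltn_trans xy yN; rewrite !labL => /laboP xz /laboP yt.
  apply/eqP; rewrite labE; apply/eqP.
  exact: (NCD_crossing (x := Ordinal xN) (y := Ordinal yN) (z := Ordinal zN)
    (t := Ordinal tN) PN (bP _) (bP _) xy yz zt (xP _) xz (xP _) yt).
have lab_con (Z : pred nat) :
    (forall x y, (x < n.*2)%N -> (y < n.*2)%N -> lab x = lab y -> Z x -> Z y) ->
    (forall l, (l < n)%N -> Z l.*2 = Z l.*2.+1) ->
    forall x y, (x < n.*2)%N -> (y < n.*2)%N -> Z x -> Z y.
  move=> Z1 Z2 x y xN yN Zx.
  have := @glued_closed _ _ half P [set z : 'I_n.*2 | Z z] _ _ (Ordinal xN) (Ordinal yN)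
    (connected_NCP con (in_setT _) (in_setT _)).
  rewrite !inE /= Zx => h; rewrite -h //.
    move=> B u v BP uB vB; rewrite !inE; apply: Z1 => //; rewrite !labN; apply/eqP.
    by rewrite labE (def_pblock tP BP uB) (def_pblock tP BP vB).
  move=> u v _ _ uv; rewrite !inE -(point_half u) -(point_half v) -[half_ord u]/(half u) uv.
  have := Z2 _ (ltn_ord (half v)); rewrite /half /=.
  by case: (odd u); case: (odd v); rewrite /= ?add0n ?add1n // => ->.
have lab_sur v : exists2 x, (x < n.*2)%N & lab x = v.
  by have [x <-] := sur v; exists x; rewrite ?labN.
set G := labelled_graph n lab; set c := boundary_walk lab n_gt0 n.
have cG : cactus G := labelled_cactus n_gt0 lab_nc lab_con lab_sur.
have oc : outercycle G c := boundary_outercycle n_gt0 lab_wrap lab_nc lab_con.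
have [S1 sub1 selE] := boundary_selected n_gt0 lab_nc lab_con.
rewrite -/c -/G in sub1 selE.
have mb : (#|P| < n.+2)%N by have := walk_vertex_bound cG oc; rewrite card_ord.
have sc : (size c <= n.*2)%N := outercycle_size oc.
pose pt v := sval (cid (sur v)); have ptK v : labo (pt v) = v := svalP (cid (sur v)).
pose colr : {ffun 'I_#|P| -> 'I_k} := [ffun v => point_color i (pt v)].
have colrE x : colr (labo x) = point_color i x.
  rewrite ffunE; apply/eqP; move/forall_inP: (mono _ (bP x)) => /(_ (pt (labo x))).
  move=> h; have /h/forall_inP : pt (labo x) \in pblock P x by apply: laboP; rewrite ptK.
  by apply.
pose X1 : colored_walk k n := existT _ (Ordinal mb) (G, Bseq sc, colr).
(* [OCG] holds only a representative of the class of [X1]; the set of choices is carried to it by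
   [g]. *)
have [X XO [f [g [bf bg jfg wE colE]]]] := @OCG_representative X1 (conj cG oc).
have wE' : walk_of X = map_walk f g c := wE.
have sub : g @: S1 \subset choices (graph_of X) (walk_of X).
  by rewrite wE' (choices_iso bf bg jfg) imsetS.
exists (X, g @: S1); first by rewrite inE /= XO.
have sE x : side (graph_of X) (selected (g @: S1) (walk_of X)) x = Some (f (labo x)).
  have oE : selected S1 c = [seq (lab (val j).*2, side_edge n_gt0 (val j).*2) | j <- enum 'I_n].
    by rewrite selE -val_enum_ord -map_comp.
  have val_e (j : 'I_n) : side_edge n_gt0 j.*2 = j.
    by apply/val_inj; rewrite /= val_side_edge ?doubleK // ltn_double.
  rewrite wE' (selected_iso _ bg) (side_iso jfg); last first.
    apply/allP => d; rewrite oE => /mapP[j _ ->] /=; rewrite val_e.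
    by rewrite (joins_opposite (joins_labelled lab j)) joins_labelled.
  rewrite /side oE onthE -map_comp (nth_map (half x)) ?size_enum_ord // nth_ord_enum /=.
  congr (Some (f _)); have ve := val_e (half x).
  have oppE := joins_opposite (joins_labelled lab (half x)); rewrite /= in ve oppE.
  rewrite ve oppE.
  rewrite -[in RHS](point_half x) -[RHS]labN /=.
  by case: (odd x).
rewrite /reading /=; congr (_, _).
  apply/ffunP => l; rewrite ffunE !sE /= !colE.
  have E x : @color_of k n X1 (labo x) = point_color i x := colrE x.
  by rewrite !E !point_color_point; case: (i l).
rewrite -[RHS](equivalence_partition_pblock (NCD_partition PN)).
congr (imset _ _); apply/funext => x; apply/setP => y; rewrite !inE /= !sE.
rewrite (inj_eq (@Some_inj _)) (inj_eq (bij_inj bf)) labE eq_pblock //.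
Qed.

Local Open Scope ring_scope.
Variables (F : GRing.ComNzRing.type) (w : 'I_k -> 'I_k -> F) (kappa : nat -> 'I_k -> F).
Hypothesis w_sym : forall c d, w c d = w d c.

Definition configuration_weight
    (Y : {ffun 'I_n -> 'I_k * 'I_k} * {set {set 'I_n.*2}}) : F :=
  (\prod_l w (Y.1 l).1 (Y.1 l).2) *
  \prod_(V in Y.2) block_weight kappa (point_color Y.1) V.

Lemma reading_weight X (S : {set 'I_n}) : oriented_cactus X ->
  S \subset choices (graph_of X) (walk_of X) ->
  configuration_weight (reading (X, S)) = graph_weight w X *
    \prod_(c < k) \prod_(v | color_of v == c) kappa (degree (graph_of X) v) c.
Proof.
move=> oX sub; have [lab [ed [_ je be sur [PE cE _]]]] := readingP oX sub.
rewrite /configuration_weight; congr (_ * _).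
  rewrite /graph_weight -(prod_labelled_edges be je (fun u v => w_sym (color_of u) (color_of v))).
  by apply: eq_bigr => l _; rewrite -!cE !point_color_point.
rewrite PE (prod_kernel (g := fun v => kappa (degree (graph_of X) v) (color_of v)) sur).
  rewrite (partition_big (@color_of k n X) predT) //=.
  by apply: eq_bigr => c _; apply: eq_bigr => v /eqP ->.
move=> v; have [x xv] := sur v.
have mem y : (y \in [set y | lab y == v]) = (lab y == v) by rewrite inE.
rewrite (@block_weight_mono _ _ _ _ _ _ x) ?mem ?xv // => [|y].
  by rewrite -xv -cE (card_label be je).
by rewrite mem => /eqP yv; rewrite !cE yv xv.
Qed.

Lemma sum_configurations :
  \sum_(i : {ffun 'I_n -> 'I_k * 'I_k}) (\prod_l w (i l).1 (i l).2) *
     \sum_(P in connected_NC half [set: 'I_n.*2])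
       \prod_(V in P) block_weight kappa (point_color i) V
  = \sum_(X in OCG k n)
      2 ^+ flexible_count (graph_of X) (walk_of X) * graph_weight w X *
      \prod_(c < k) \prod_(v | color_of v == c) kappa (degree (graph_of X) v) c.
Proof.
transitivity (\sum_(Y in configurations) configuration_weight Y).
  under eq_bigr do rewrite mulr_sumr.
  rewrite pair_big_dep /= (bigID [in configurations]) /= [X in _ + X]big1 ?addr0.
    by apply: eq_bigl => Y; rewrite [Y \in configurations]inE; case: (Y.2 \in _).
  move=> [i P] /= /andP[con]; rewrite inE con /= => /forall_inPn[V VP].
  case/forall_inPn => x xV /forall_inPn[y yV xy].
  by rewrite (bigD1 V) //= (block_weight0 _ xV yV xy) mul0r mulr0.
have -> : configurations = reading @: choice_pairs.
  apply/setP => Y; apply/idP/imsetP => [/configuration_reading[XS]|[[X S]]].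
    by exists XS.
  rewrite inE /= => /andP[XO sub] ->; apply: reading_configuration => //.
  exact: OCG_oriented.
rewrite big_imset /=; last exact: reading_inj.
rewrite (eq_bigl (fun XS : colored_walk k n * {set 'I_n} => (XS.1 \in OCG k n) &&
     (XS.2 \subset choices (graph_of XS.1) (walk_of XS.1)))); last by move=> XS; rewrite inE.
rewrite -(pair_big_dep [in OCG k n] (fun X (S : {set 'I_n}) => S \subset choices (graph_of X) (walk_of X))
  (fun X S => configuration_weight (reading (X, S)))) /=.
apply: eq_bigr => X XO; rewrite -mulrA.
rewrite (eq_bigr _ (fun S => reading_weight (OCG_oriented XO) (S := S))).
rewrite (eq_bigl [in powerset (choices (graph_of X) (walk_of X))]); last first.
  by move=> S; rewrite powersetE.
(* The weight of a reading does not depend on [S], so the choices contribute only their number. *)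
by rewrite sumr_const card_powerset -[LHS]mulr_natl natrX.
Qed.

End Configurations.

(** * Coarsening noncrossing partitions *)

Lemma connect_exit (T : finType) (e : rel T) (A : pred T) s t :
  connect e s t -> A s -> ~~ A t ->
  exists u v, [/\ connect e s u, e u v, A u & ~~ A v].
Proof.
move=> st As nAt; apply: contrapT => no.
have cl u v : connect e s u -> A u -> e u v -> A v.
  by move=> su Au uv; apply: contraT => nAv; case: no; exists u, v.
case/connectP: st nAt => p; elim/last_ind: p t => [|p z IHp] t; first by move=> _ -> /negP.
rewrite rcons_path last_rcons => /andP[pp lz] -> nAz.
have Al : A (last s p) by apply: contraT => /(IHp _ pp erefl).
by case/negP: nAz; apply: cl lz => //; apply/connectP; exists p.
Qed.

Lemma outside_interval N (x u v : 'I_N) :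
  ~~ (u < x < v)%N -> x != u -> x != v -> (x < u)%N || (v < x)%N.
Proof.
move=> nb xu xv; have [//|ux|/val_inj e] := ltngtP x u; last by rewrite e eqxx in xu.
move: nb; rewrite ux /= -leqNgt leq_eqVlt => /orP[/eqP/val_inj e|//].
by rewrite e eqxx in xv.
Qed.

Section Coarsening.
Variables (N M : nat) (q : 'I_N -> 'I_M) (D : {set 'I_N}).
Hypothesis q_mono : {in D &, forall x y : 'I_N, (x <= y)%N -> (q x <= q y)%N}.
Implicit Types (P Q : {set {set 'I_N}}) (V B : {set 'I_N}) (rho : {set {set 'I_M}}).
Implicit Types (W : {set 'I_M}) (x y : 'I_N).

Definition above W := [set x in D | q x \in W].

Lemma connect_glued_sym P : connect_sym (glued q P).
Proof. exact/sym_connect_sym/glued_sym. Qed.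

Lemma glued_block P V x y : V \in P -> x \in V -> y \in V -> glued q P x y.
Proof.
move=> VP xV yV; apply/and3P; split; try by apply/bigcupP; exists V.
by apply/orP; right; apply/exists_inP; exists V; rewrite ?xV.
Qed.

Lemma glued_fibre P x y : P \in NCD D -> x \in D -> y \in D -> q x = q y -> glued q P x y.
Proof. by move=> PN xD yD xy; rewrite /glued (NCD_cover PN) xD yD xy eqxx. Qed.

Lemma connect_cover P x y : x \in cover P -> connect (glued q P) x y -> y \in cover P.
Proof.
move=> xP xy; suff <- : (x \in cover P) = (y \in cover P) by [].
by apply: closed_connect xy => u v /and3P[-> ->].
Qed.

(** A component not containing [u] cannot leave the interval between two points of [B]. A step out
    of it along a fibre would, [q] being monotone, put [u] or [v] into that fibre; a step out of it
    along a block would cross [B]. *)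
Lemma glued_noncrossing P B u v s t : P \in NCD D -> B \in P -> u \in B -> v \in B ->
  s \in D -> connect (glued q P) s t -> ~~ connect (glued q P) s u ->
  (u < s)%N -> (s < v)%N -> (u < t < v)%N.
Proof.
move=> PN BP uB vB sD st nsu us sv; apply: contraT => nt.
have uD : u \in D by apply: subsetP uB; apply: NCD_sub PN BP.
have vD : v \in D by apply: subsetP vB; apply: NCD_sub PN BP.
have nsv : ~~ connect (glued q P) s v.
  apply: contra nsu => sv'; apply: connect_trans sv' (connect1 _).
  exact: glued_block BP vB uB.
have [||a [b [sa ab /andP[ua av] nb]]] :=
  connect_exit (A := fun x => (u < x < v)%N) st => //.
  by rewrite us sv.
have sb := connect_trans sa (connect1 ab).
have nbu : b != u by apply: contraNneq nsu => <-.
have nbv : b != v by apply: contraNneq nsv => <-.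
have aD : a \in D by have := connect_cover (_ : s \in cover P) sa; rewrite (NCD_cover PN); apply.
have bD : b \in D by have := connect_cover (_ : s \in cover P) sb; rewrite (NCD_cover PN); apply.
have out : (b < u)%N || (v < b)%N.
  exact: outside_interval nb nbu nbv.
case/and3P: (ab) => _ _ /orP[/eqP qab|/exists_inP[B' B'P /andP[aB' bB']]].
  case/orP: out => [bu|vb].
    have : q a = q u.
      apply/val_inj/anti_leq; rewrite (q_mono uD aD (ltnW ua)) andbT qab.
      exact: q_mono (ltnW bu).
    move/(glued_fibre PN aD uD) => au.
    by rewrite (connect_trans sa (connect1 au)) in nsu.
  have : q a = q v.
    apply/val_inj/anti_leq; rewrite (q_mono aD vD (ltnW av)) /= qab.
    exact: q_mono (ltnW vb).
  move/(glued_fibre PN aD vD) => au.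
  by rewrite (connect_trans sa (connect1 au)) in nsv.
have BB : B = B'.
  case/orP: out => [bu|vb].
    exact/esym/(NCD_crossing PN B'P BP bu ua av).
  exact: (NCD_crossing PN BP B'P ua av vb).
rewrite -BB in aB'.
by case/negP: nsu; apply: connect_trans sa (connect1 (glued_block BP aB' uB)).
Qed.

(** Components do not cross. On the way from [x2] to [x4] some step leaves the interval from [x1] to
    [x3]. If it is along a fibre, monotonicity puts [x1] or [x3] into that fibre. If it is along a
    block, it encloses exactly one of [x1] and [x3], against [glued_noncrossing]. *)
Lemma connected_crossing P x1 x2 x3 x4 : P \in NCD D -> x1 \in D -> x2 \in D ->
  (x1 < x2)%N -> (x2 < x3)%N -> (x3 < x4)%N ->
  connect (glued q P) x1 x3 -> connect (glued q P) x2 x4 ->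
  connect (glued q P) x1 x2.
Proof.
move=> PN x1D x2D l12 l23 l34 c13 c24; apply: contraT => n12.
have x1P : x1 \in cover P by rewrite (NCD_cover PN).
have x2P : x2 \in cover P by rewrite (NCD_cover PN).
have x3D : x3 \in D by have := connect_cover x1P c13; rewrite (NCD_cover PN).
have [||u [v [c2u uv /andP[u1 u3] nv]]] :=
  connect_exit (A := fun x => (x1 < x < x3)%N) c24.
- by rewrite l12 l23.
- by rewrite negb_and -!leqNgt (ltnW l34) orbT.
have c2v := connect_trans c2u (connect1 uv).
have n1 z : connect (glued q P) x2 z -> ~~ connect (glued q P) x1 z.
  move=> c2z; apply: contra n12 => c1z; apply: connect_trans c1z _.
  by rewrite connect_glued_sym.
have n3 z : connect (glued q P) x2 z -> ~~ connect (glued q P) x3 z.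
  by move=> c2z; apply: contra (n1 z c2z); apply: connect_trans.
have uD : u \in D by have := connect_cover x2P c2u; rewrite (NCD_cover PN).
have vD : v \in D by have := connect_cover x2P c2v; rewrite (NCD_cover PN).
have v1 : v != x1 by apply: contraNneq (n1 v c2v) => ->; apply: connect0.
have v3 : v != x3 by apply: contraNneq (n3 v c2v) => ->; apply: connect0.
have out : (v < x1)%N || (x3 < v)%N.
  exact: outside_interval nv v1 v3.
case/and3P: (uv) => _ _ /orP[/eqP quv|/exists_inP[B BP /andP[uB vB]]].
  case/orP: out => [vx|xv].
    have : q x1 = q u.
      apply/val_inj/anti_leq; rewrite (q_mono x1D uD (ltnW u1)) quv.
      exact: q_mono (ltnW vx).
    by move/(glued_fibre PN x1D uD)/connect1; rewrite (negPf (n1 u c2u)).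
  have : q x3 = q u.
    apply/val_inj/anti_leq; rewrite (q_mono uD x3D (ltnW u3)) andbT quv.
    exact: q_mono (ltnW xv).
  by move/(glued_fibre PN x3D uD)/connect1; rewrite (negPf (n3 u c2u)).
case/orP: out => [vx|xv].
  by have := glued_noncrossing PN BP vB uB x1D c13 (n1 v c2v) vx u1;
    rewrite [(x3 < u)%N]ltnNge (ltnW u3) andbF.
have c31 : connect (glued q P) x3 x1 by rewrite connect_glued_sym.
by have := glued_noncrossing PN BP uB vB x3D c31 (n3 u c2u) u3 xv;
  rewrite [(u < x1)%N]ltnNge (ltnW u1).
Qed.

Definition linked P : rel 'I_M := fun i j =>
  [exists x in D, exists y in D, [&& q x == i, q y == j & connect (glued q P) x y]].

Definition coarsening P := equivalence_partition (linked P) (q @: D).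

Lemma linkedE P x y : P \in NCD D -> x \in D -> y \in D ->
  linked P (q x) (q y) = connect (glued q P) x y.
Proof.
move=> PN xD yD; apply/exists_inP/idP => [[x' x'D /exists_inP[y' y'D]]|xy].
  case/and3P => /eqP qx /eqP qy xy.
  apply: connect_trans (connect1 (glued_fibre PN xD x'D (esym qx))) _.
  exact: connect_trans xy (connect1 (glued_fibre PN y'D yD qy)).
by exists x => //; apply/exists_inP; exists y; rewrite ?eqxx.
Qed.

Lemma linked_equivalence P : P \in NCD D ->
  {in q @: D & &, equivalence_rel (linked P)}.
Proof.
move=> PN _ _ _ /imsetP[x xD ->] /imsetP[y yD ->] /imsetP[z zD ->].
rewrite !linkedE //; split=> [|xy]; first exact: connect0.
by rewrite (same_connect (@connect_glued_sym P) xy).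
Qed.

Lemma coarsening_partition P : P \in NCD D -> partition (coarsening P) (q @: D).
Proof. by move=> PN; apply: equivalence_partitionP (linked_equivalence PN). Qed.

Lemma coarsening_block P W x y : P \in NCD D -> W \in coarsening P ->
  x \in above W -> y \in D -> (y \in above W) = connect (glued q P) x y.
Proof.
move=> PN WP; rewrite !inE => /andP[xD xW] yD; rewrite yD /=.
rewrite -(def_pblock (partition_trivIset (coarsening_partition PN)) WP xW).
by rewrite (pblock_equivalence_partition (linked_equivalence PN)) ?imset_f // linkedE.
Qed.

Lemma coarsening_NCD P : P \in NCD D -> coarsening P \in NCD (q @: D).
Proof.
move=> PN; have cP := coarsening_partition PN; rewrite inE cP.
have lift W i : W \in coarsening P -> i \in W -> exists x, [/\ x \in D, q x = i & x \in above W].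
  move=> WP iW; have : i \in q @: D by rewrite -(cover_partition cP); apply/bigcupP; exists W.
  by case/imsetP => x xD ix; exists x; rewrite inE xD -ix iW.
apply/noncrossingP => W W' i1 i2 i3 i4 WP W'P l12 l23 l34 i1W i3W i2W' i4W'.
have [x1 [x1D q1 x1W]] := lift _ _ WP i1W; have [x2 [x2D q2 x2W]] := lift _ _ W'P i2W'.
have [x3 [x3D q3 x3W]] := lift _ _ WP i3W; have [x4 [x4D q4 x4W]] := lift _ _ W'P i4W'.
have lt a b : a \in D -> b \in D -> (q a < q b)%N -> (a < b)%N.
  by move=> aD bD; apply: contraTT; rewrite -!leqNgt => /q_mono -> .
rewrite -q1 -q2 in l12; rewrite -q2 -q3 in l23; rewrite -q3 -q4 in l34.
have c12 := connected_crossing PN x1D x2D (lt _ _ x1D x2D l12) (lt _ _ x2D x3D l23)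
  (lt _ _ x3D x4D l34).
rewrite -(coarsening_block PN WP x1W x3D) -(coarsening_block PN W'P x2W x4D) x3W x4W in c12.
have := c12 isT isT; rewrite -(coarsening_block PN WP x1W x2D) inE => /andP[_ x2W'].
move: x2W; rewrite inE => /andP[_ x2W''].
have tP := partition_trivIset cP.
by rewrite -(def_pblock tP WP x2W') (def_pblock tP W'P x2W'').
Qed.

Definition restricted P W := [set V in P | V \subset above W].

Lemma coarsening_sub P V x W : P \in NCD D -> W \in coarsening P -> V \in P ->
  x \in V -> x \in above W -> V \subset above W.
Proof.
move=> PN WP VP xV xW; apply/subsetP => y yV.
have yD : y \in D by apply: subsetP yV; apply: NCD_sub PN VP.
rewrite (coarsening_block PN WP xW yD); apply: connect1; exact: glued_block VP xV yV.
Qed.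

Lemma sub_noncrossing P Q : Q \subset P -> noncrossing P -> noncrossing Q.
Proof.
move=> /subsetP QP /noncrossingP nc; apply/noncrossingP => V V' x y z t /QP VP /QP V'P.
exact: nc.
Qed.

Lemma restricted_connected P W : P \in NCD D -> W \in coarsening P ->
  restricted P W \in connected_NC q (above W).
Proof.
move=> PN WP; have cP := NCD_cover PN; have tP := partition_trivIset (NCD_partition PN).
have RP : restricted P W \subset P by apply/subsetP => V; rewrite inE => /andP[].
have bR x : x \in above W -> pblock P x \in restricted P W.
  move=> xW; have xD : x \in cover P by move: xW; rewrite cP inE => /andP[].
  rewrite inE pblock_mem //=; apply: (coarsening_sub PN WP _ _ xW).
    exact: pblock_mem.
  by rewrite mem_pblock.
have cR : cover (restricted P W) = above W.
  apply/setP => x; apply/bigcupP/idP => [[V]|xW].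
    by rewrite inE => /andP[_ /subsetP]; apply.
  exists (pblock P x); first exact: bR.
  by rewrite mem_pblock cP; move: xW; rewrite inE => /andP[].
have RN : restricted P W \in NCD (above W).
  rewrite inE; apply/andP; split; last first.
    by apply: sub_noncrossing RP _; move: PN; rewrite inE => /andP[].
  apply/and3P; split; first by rewrite cR.
    exact: trivIsetS RP tP.
  by have /and3P[_ _] := NCD_partition PN; apply: contra; apply: subsetP.
rewrite inE RN; apply/forall_inP => x xW; apply/forall_inP => y yW.
have [xD yD] : x \in D /\ y \in D by move: xW yW; rewrite !inE => /andP[-> _] /andP[-> _].
have xy : connect (glued q P) x y by rewrite -(coarsening_block PN WP xW yD).
apply: contraT => nxy.
have [||u [v [xu uv /= ru nrv]]] := connect_exit
  (A := connect (glued q (restricted P W)) x) xy => //.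
case/negP: nrv; apply: connect_trans ru (connect1 _).
have uD : u \in D by have := connect_cover (_ : x \in cover P) xu; rewrite cP; apply.
have xv := connect_trans xu (connect1 uv).
have vD : v \in D by have := connect_cover (_ : x \in cover P) xv; rewrite cP; apply.
have uW : u \in above W by rewrite (coarsening_block PN WP xW).
have vW : v \in above W by rewrite (coarsening_block PN WP xW).
apply/and3P; rewrite cR; split=> //.
case/and3P: uv => _ _ /orP[->//|/exists_inP[V VP /andP[uV vV]]].
apply/orP; right; apply/exists_inP; exists V; last by rewrite uV.
by rewrite inE VP (coarsening_sub PN WP VP uV uW).
Qed.

(** * Gluing connected partitions over the blocks of a noncrossing one *)

Section Refinement.
Variables (rho : {set {set 'I_M}}) (g : {set 'I_M} -> {set {set 'I_N}}).
Hypothesis rhoN : rho \in NCD (q @: D).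
Hypothesis g_out : forall W, W \notin rho -> g W = set0.
Hypothesis g_in : forall W, W \in rho -> g W \in connected_NC q (above W).

Let P := \bigcup_W g W.

Lemma refinementP V : reflect (exists W, [/\ W \in rho, V \in g W & V \subset above W]) (V \in P).
Proof.
apply: (iffP bigcupP) => [[W _ VW]|[W [Wr VW _]]]; last by exists W.
have Wr : W \in rho by apply: contraT => /g_out W0; rewrite W0 inE in VW.
by exists W; split=> //; apply: NCD_sub (connected_NCD (g_in Wr)) VW.
Qed.

Lemma above_disjoint W W' x : W \in rho -> W' \in rho -> x \in above W -> x \in above W' -> W = W'.
Proof.
move=> Wr W'r; rewrite !inE => /andP[_ xW] /andP[_ xW'].
by have tr := partition_trivIset (NCD_partition rhoN);
  rewrite -(def_pblock tr Wr xW) (def_pblock tr W'r xW').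
Qed.

Lemma refinement_NCD : P \in NCD D.
Proof.
rewrite inE; apply/andP; split.
  apply/and3P; split.
  - apply/eqP/setP => x; apply/bigcupP/idP => [[V /refinementP[W [Wr _ /subsetP VW]] /VW]|xD].
      by rewrite inE => /andP[].
    have : q x \in cover rho by rewrite (NCD_cover rhoN) imset_f.
    case/bigcupP => W Wr qxW.
    have : x \in cover (g W) by rewrite (NCD_cover (connected_NCD (g_in Wr))) inE xD.
    by case/bigcupP => V VW xV; exists V => //; apply/bigcupP; exists W.
  - apply/trivIsetP => V V' /refinementP[W [Wr VW /subsetP sV]] /refinementP[W' [W'r VW' /subsetP sV']].
    apply: contraNT; rewrite -setI_eq0 => /set0Pn[x]; rewrite inE => /andP[xV xV'].
    have WW := above_disjoint Wr W'r (sV _ xV) (sV' _ xV'); rewrite -WW in VW'.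
    by rewrite (NCD_block (connected_NCD (g_in Wr)) VW VW' xV xV').
  - apply/negP => /refinementP[W [Wr VW _]].
    by have [x] := NCD_neq0 (connected_NCD (g_in Wr)) VW; rewrite inE.
apply/noncrossingP => V V' x y z t.
case/refinementP => [W [Wr VW /subsetP sV]] /refinementP[W' [W'r VW' /subsetP sV']].
move=> xy yz zt xV zV yV tV.
(* Blocks lying over different [W] and [W'] have disjoint images, so the four points keep strictly
   increasing images and a crossing would persist in [rho]. *)
have WW : W = W'.
  have [-> //|nW] := eqVneq W W'.
  have mm a b : a \in above W -> b \in above W' -> q a != q b.
    rewrite !inE => /andP[_ aW] /andP[_ bW']; apply: contraNneq nW => ab.
    have tr := partition_trivIset (NCD_partition rhoN).
    by rewrite -(def_pblock tr Wr aW) ab (def_pblock tr W'r bW').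
  have inD W0 a : a \in above W0 -> a \in D by rewrite inE => /andP[].
  have inW W0 a : a \in above W0 -> q a \in W0 by rewrite inE => /andP[].
  have xW := sV _ xV; have zW := sV _ zV; have yW := sV' _ yV; have tW := sV' _ tV.
  have lt a b : a \in D -> b \in D -> q a != q b -> (a < b)%N -> (q a < q b)%N.
    move=> aD bD ne ab; rewrite ltn_neqAle q_mono ?(ltnW ab) // andbT.
    by rewrite val_eqE.
  have zy : q y != q z by rewrite eq_sym mm.
  exact: (NCD_crossing rhoN Wr W'r (lt _ _ (inD _ _ xW) (inD _ _ yW) (mm _ _ xW yW) xy)
    (lt _ _ (inD _ _ yW) (inD _ _ zW) zy yz)
    (lt _ _ (inD _ _ zW) (inD _ _ tW) (mm _ _ zW tW) zt) (inW _ _ xW) (inW _ _ zW)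
    (inW _ _ yW) (inW _ _ tW)).
rewrite -WW in VW'.
exact: (NCD_crossing (connected_NCD (g_in Wr)) VW VW' xy yz zt).
Qed.

Lemma refinement_restricted W : W \in rho -> restricted P W = g W.
Proof.
move=> Wr; have gN := connected_NCD (g_in Wr).
apply/setP => V; rewrite inE; apply/andP/idP => [[/refinementP[W' [W'r VW' sV']] sV]|VW].
  have [x xV] := NCD_neq0 (connected_NCD (g_in W'r)) VW'.
  by rewrite (above_disjoint Wr W'r (subsetP sV _ xV) (subsetP sV' _ xV)).
split; last exact: NCD_sub gN VW.
by apply/bigcupP; exists W.
Qed.

(** The sets above the blocks of [rho] are unions of blocks and of fibres, so a component stays in
    one of them; it fills it because [g W] is connected. *)
Lemma refinement_coarsening : coarsening P = rho.
Proof.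
have PN := refinement_NCD; have tr := partition_trivIset (NCD_partition rhoN).
rewrite -[RHS](equivalence_partition_pblock (NCD_partition rhoN)).
apply: eq_in_imset => _ /imsetP[x xD ->]; apply/setP => j; rewrite !inE.
apply: andb_id2l => /imsetP[y yD ->]; rewrite linkedE //.
have bl z : z \in D -> exists2 W, W \in rho & z \in above W.
  move=> zD; have : q z \in cover rho by rewrite (NCD_cover rhoN) imset_f.
  by case/bigcupP => W Wr zW; exists W; rewrite // inE zD.
have [W Wr xW] := bl x xD.
have -> : (q y \in pblock rho (q x)) = (y \in above W).
  by rewrite inE yD (def_pblock tr Wr) //; move: xW; rewrite inE => /andP[].
apply/idP/idP => [xy|yW].
  have <- // : (x \in above W) = (y \in above W).
  apply: (glued_closed (q := q) (P := P)) xy => [V u v|u v].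
    case/refinementP => W' [W'r VW' /subsetP sV] uV vV uW.
    by rewrite (above_disjoint Wr W'r uW (sV _ uV)) sV.
  by rewrite (NCD_cover PN) !inE => -> -> -> /andP[].
have := connected_NCP (g_in Wr) xW yW; apply: connect_sub => u v /and3P[uc vc].
have sub V : V \in g W -> V \in P by move=> VW; apply/bigcupP; exists W.
have inP z : z \in cover (g W) -> z \in cover P.
  by case/bigcupP => V /sub VP zV; apply/bigcupP; exists V.
move=> h; apply: connect1; rewrite /glued !inP //=.
case/orP: h => [->//|/exists_inP[V /sub VP uv]].
by apply/orP; right; apply/exists_inP; exists V.
Qed.

End Refinement.

Local Open Scope ring_scope.

Lemma sum_coarsening (F : GRing.ComNzRing.type) (f : {set 'I_N} -> F) :
  \sum_(P in NCD D) \prod_(V in P) f V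
  = \sum_(rho in NCD (q @: D)) \prod_(W in rho)
      \sum_(Q in connected_NC q (above W)) \prod_(V in Q) f V.
Proof.
rewrite (partition_big coarsening [in NCD (q @: D)]) /=; last exact: coarsening_NCD.
apply: eq_bigr => rho rhoN.
rewrite (big_distr_big_dep set0) /=.
(* The maps [h] and [h'] are inverse bijections between the families of connected partitions above
   the blocks of [rho] and the partitions with coarsening [rho]. *)
pose h (g : {ffun {set 'I_M} -> {set {set 'I_N}}}) := \bigcup_W g W.
pose h' P := [ffun W : {set 'I_M} => if W \in rho then restricted P W else set0].
have disj (g : {ffun {set 'I_M} -> {set {set 'I_N}}}) : (forall W, W \notin rho -> g W = set0) ->
    (forall W, W \in rho -> g W \in connected_NC q (above W)) ->
    forall W W', W != W' -> [disjoint g W & g W'].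
  move=> g0 gi W W'; apply: contraNT; rewrite -setI_eq0 => /set0Pn[V].
  rewrite inE => /andP[VW VW'].
  have Wr : W \in rho by apply: contraT => /g0 W0; rewrite W0 inE in VW.
  have W'r : W' \in rho by apply: contraT => /g0 W0; rewrite W0 inE in VW'.
  have [x xV] := NCD_neq0 (connected_NCD (gi _ Wr)) VW.
  apply/eqP; apply: (above_disjoint rhoN Wr W'r (x := x)).
    by apply: subsetP xV; apply: NCD_sub (connected_NCD (gi _ Wr)) VW.
  by apply: subsetP xV; apply: NCD_sub (connected_NCD (gi _ W'r)) VW'.
have famP (g : {ffun {set 'I_M} -> {set {set 'I_N}}}) :
    g \in pfamily set0 [in rho] (fun W => [in connected_NC q (above W)]) ->
    (forall W, W \notin rho -> g W = set0) /\
    (forall W, W \in rho -> g W \in connected_NC q (above W)).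
  case/pfamilyP => /subsetP sg gi; split=> // W Wr; apply/eqP; apply: contraNT Wr => nz.
  by apply: sg; rewrite inE.
rewrite (reindex_onto h h') /=; last first.
  move=> P /andP[PN /eqP cE]; apply/setP => V; apply/bigcupP/idP => [[W _]|VP].
    by rewrite ffunE; case: ifP; rewrite ?inE // => _ /andP[].
  have [x xV] := NCD_neq0 PN VP.
  have xD : x \in D by apply: subsetP xV; apply: NCD_sub PN VP.
  have : q x \in cover rho by rewrite (NCD_cover rhoN) imset_f.
  case/bigcupP => W Wr qxW; exists W => //; rewrite ffunE Wr inE VP /=.
  rewrite -cE in Wr; apply: (coarsening_sub PN Wr VP xV).
  by rewrite inE xD.
apply: eq_big => [g|g].
  apply/idP/idP => [/andP[/andP[PN /eqP cE] /eqP gE]|gf].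
    apply/pfamilyP; split=> [|W Wr]; first apply/subsetP => W.
      by rewrite inE -gE ffunE; case: ifP; rewrite ?eqxx.
    by rewrite -gE ffunE Wr; apply: restricted_connected => //; rewrite cE.
  have [g0 gi] := famP g gf.
  rewrite (refinement_NCD rhoN g0 gi) (refinement_coarsening rhoN g0 gi) eqxx /=.
  apply/eqP/ffunP => W; rewrite ffunE; case: ifP => Wr.
    exact: (refinement_restricted rhoN g0 gi Wr).
  by rewrite g0 ?Wr.
case/andP => /andP[PN /eqP cE] /eqP gE.
have gi W : W \in rho -> g W \in connected_NC q (above W).
  by move=> Wr; rewrite -gE ffunE Wr; apply: restricted_connected => //; rewrite cE.
have g0 W : W \notin rho -> g W = set0 by move=> Wr; rewrite -gE ffunE (negPf Wr).
rewrite partition_disjoint_bigcup; last exact: disj.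
rewrite (bigID [in rho]) /= [X in _ * X]big1 ?mulr1 // => W Wr.
by rewrite g0 // big_set0.
Qed.

End Coarsening.

(** * Relabelling points by an increasing map *)

Section Transport.
Variables (N N' M M' : nat) (q : 'I_N -> 'I_M) (q' : 'I_N' -> 'I_M') (h : 'I_N -> 'I_N').
Hypothesis h_mono : forall x y : 'I_N, (h x < h y)%N = (x < y)%N.
Hypothesis h_q : forall x y, (q' (h x) == q' (h y)) = (q x == q y).
Implicit Types (P : {set {set 'I_N}}).

Lemma transport_inj : injective h.
Proof.
move=> x y xy; have := h_mono x y; have := h_mono y x; rewrite xy ltnn.
by case: (ltngtP x y) => // /val_inj.
Qed.

Definition transport P : {set {set 'I_N'}} := [set h @: V | V : {set 'I_N} in P].

Lemma set_imset_inj : injective (fun V : {set 'I_N} => h @: V).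
Proof. exact: imset_inj transport_inj. Qed.

Lemma transport_block P (V : {set 'I_N}) : (h @: V \in transport P) = (V \in P).
Proof. exact: (mem_imset _ _ set_imset_inj). Qed.

Lemma transport_cover P : cover (transport P) = h @: cover P.
Proof.
apply/setP => y; apply/bigcupP/imsetP => [[_ /imsetP[V VP ->] /imsetP[x xV ->]]|[x]].
  by exists x => //; apply/bigcupP; exists V.
case/bigcupP => V VP xV ->; exists (h @: V); first exact: imset_f.
exact: imset_f.
Qed.

Lemma mem_himset (V : {set 'I_N}) x : (h x \in h @: V) = (x \in V).
Proof. exact: (mem_imset _ _ transport_inj). Qed.

Lemma transport_NCD P : (transport P \in NCD (h @: [set: 'I_N])) = (P \in NCD [set: 'I_N]).
Proof.
rewrite !inE; congr (_ && _).
  rewrite /partition transport_cover (inj_eq set_imset_inj); congr [&& _, _ & ~~ _].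
    apply/trivIsetP/trivIsetP => tI V V' VP V'P nV.
      have := tI (h @: V) (h @: V'); rewrite !transport_block (inj_eq set_imset_inj).
      move=> /(_ VP V'P nV); rewrite -!setI_eq0 -imsetI ?imset_eq0 //.
      by move=> x y _ _ /transport_inj.
    case/imsetP: VP nV => V1 V1P ->; case/imsetP: V'P => V2 V2P ->.
    rewrite (inj_eq set_imset_inj) => /(tI _ _ V1P V2P).
    rewrite -!setI_eq0 -imsetI ?imset_eq0 //.
    by move=> x y _ _ /transport_inj.
  by rewrite -(imset0 h) transport_block.
apply/noncrossingP/noncrossingP => nc V W x y z t VP WP xy yz zt xV zV yW tW.
  apply: set_imset_inj; apply: (nc _ _ (h x) (h y) (h z) (h t));
    by rewrite ?transport_block ?h_mono ?mem_himset.
case/imsetP: VP xV zV => V1 V1P -> /imsetP[x1 x1V xE] /imsetP[z1 z1V zE].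
case/imsetP: WP yW tW => W1 W1P -> /imsetP[y1 y1W yE] /imsetP[t1 t1W tE].
rewrite xE yE zE tE !h_mono in xy yz zt.
by rewrite (nc _ _ _ _ _ _ V1P W1P xy yz zt).
Qed.

Lemma NCD_transport Q : Q \in NCD (h @: [set: 'I_N]) -> exists P, Q = transport P.
Proof.
move=> QN; exists [set V : {set 'I_N} | h @: V \in Q]; apply/setP => V; apply/idP/imsetP => [VQ|[W]].
  have VE : V = h @: (h @^-1: V).
    apply/setP => y; apply/idP/imsetP => [yV|[x]]; last by rewrite inE => ? ->.
    have /imsetP[x _ yE] : y \in h @: [set: 'I_N] by apply: subsetP yV; apply: NCD_sub QN VQ.
    by exists x; rewrite // inE -yE.
  by exists (h @^-1: V) => //; rewrite inE -VE.
by rewrite inE => ? ->.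
Qed.

Lemma glued_transport P x y : glued q' (transport P) (h x) (h y) = glued q P x y.
Proof.
rewrite /glued transport_cover !mem_himset h_q; congr [&& _, _ & _ || _].
apply/exists_inP/exists_inP => [[_ /imsetP[V VP ->]]|[V VP xy]].
  by rewrite !mem_himset => xy; exists V.
by exists (h @: V); rewrite ?transport_block // !mem_himset.
Qed.

Lemma connect_transport P x y :
  connect (glued q' (transport P)) (h x) (h y) = connect (glued q P) x y.
Proof.
apply/idP/idP => xy; apply: contraT => nxy.
  have [||u [v [_ uv /existsP[x1 /andP[/eqP uE c1]] nv]]] := connect_exit
    (A := fun u => [exists x1, (u == h x1) && connect (glued q P) x x1]) xy.
  - by apply/existsP; exists x; rewrite eqxx connect0.
  - apply: contra nxy => /existsP[x1 /andP[/eqP/transport_inj -> //]].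
  have : v \in cover (transport P) by case/and3P: uv.
  rewrite transport_cover => /imsetP[y1 _ vE]; case/negP: nv; apply/existsP; exists y1.
  rewrite vE eqxx; rewrite uE vE glued_transport in uv.
  exact: connect_trans c1 (connect1 uv).
have [||u [v [_ uv hu nv]]] := connect_exit
  (A := fun u => connect (glued q' (transport P)) (h x) (h u)) xy => //.
case/negP: nv; apply: connect_trans hu (connect1 _).
by rewrite glued_transport.
Qed.

Lemma transport_connected P : (transport P \in connected_NC q' (h @: [set: 'I_N]))
  = (P \in connected_NC q [set: 'I_N]).
Proof.
rewrite [LHS]inE [RHS]inE transport_NCD; congr (_ && _).
apply/forall_inP/forall_inP => c x.
  move=> _; have /forall_inP h1 := c (h x) (imset_f h (in_setT x)).
  apply/forall_inP => y _; rewrite -connect_transport; apply: h1.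
  exact (imset_f h (in_setT y)).
case/imsetP => x1 _ ->; apply/forall_inP => _ /imsetP[y1 _ ->].
by rewrite connect_transport; apply: (forall_inP (c x1 (in_setT _))); apply: in_setT.
Qed.

Lemma transport_injective : injective transport.
Proof. exact: imset_inj set_imset_inj. Qed.

Local Open Scope ring_scope.
Variables (F : GRing.ComNzRing.type) (f : {set 'I_N'} -> F).

Lemma prod_transport P :
  \prod_(V in transport P) f V = \prod_(V in P) f (h @: V).
Proof. by rewrite big_imset //= => V W _ _; apply: set_imset_inj. Qed.

Lemma sum_NCD_transport :
  \sum_(Q in NCD (h @: [set: 'I_N])) \prod_(V in Q) f V
  = \sum_(P in NCD [set: 'I_N]) \prod_(V in P) f (h @: V).
Proof.
have -> : NCD (h @: [set: 'I_N]) = transport @: NCD [set: 'I_N].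
  apply/setP => Q; apply/idP/imsetP => [QN|[P PN ->]]; last by rewrite transport_NCD.
  by have [P QE] := NCD_transport QN; exists P; rewrite // -transport_NCD -QE.
rewrite big_imset /=; last by move=> P P' _ _; apply: transport_injective.
by apply: eq_bigr => P _; apply: prod_transport.
Qed.

Lemma sum_connected_transport :
  \sum_(Q in connected_NC q' (h @: [set: 'I_N])) \prod_(V in Q) f V
  = \sum_(P in connected_NC q [set: 'I_N]) \prod_(V in P) f (h @: V).
Proof.
have -> : connected_NC q' (h @: [set: 'I_N]) = transport @: connected_NC q [set: 'I_N].
  apply/setP => Q; apply/idP/imsetP => [QN|[P PN ->]]; last by rewrite transport_connected.
  have [P QE] := NCD_transport (connected_NCD QN).
  by exists P; rewrite // -transport_connected -QE.
rewrite big_imset /=; last by move=> P P' _ _; apply: transport_injective.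
by apply: eq_bigr => P _; apply: prod_transport.
Qed.

End Transport.

Lemma enum_val_mono n (W : {set 'I_n}) (i j : 'I_#|W|) :
  (enum_val i < enum_val j)%N = (i < j)%N.
Proof.
have sE : sorted ltn (map val (enum W)).
  have : subseq (map val (enum W)) (map val (enum 'I_n)).
    by apply: map_subseq; rewrite enumT {1}/enum_mem -enumT; apply: filter_subseq.
  by rewrite val_enum_ord => /(subseq_sorted ltn_trans); apply; apply: iota_ltn_sorted.
have mono (a b : 'I_#|W|) : (a < b)%N -> (enum_val a < enum_val b)%N.
  move=> ab; have an : (a < size (enum W))%N by rewrite -cardE.
  have bn : (b < size (enum W))%N by rewrite -cardE.
  have := sorted_ltn_nth ltn_trans 0 sE; move=> /(_ a b).
  rewrite !inE !size_map => /(_ an bn ab).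
  by rewrite !(nth_map (enum_default a)) // -!enum_val_nth.
case: (ltngtP i j) => [/mono ->//|/mono|/val_inj ->]; last by rewrite ltnn.
by move/ltnW; rewrite leqNgt => /negPf.
Qed.

(** * Factoring a sum over colourings along a partition *)

Section Distribution.
Local Open Scope ring_scope.
Variables (I K : finType) (k0 : K) (F : GRing.ComNzRing.type).
Variables (G : {ffun I -> K} -> {set I} -> F).
Hypothesis G_local : forall (W : {set I}) (i j : {ffun I -> K}), {in W, i =1 j} -> G i W = G j W.

(** Colourings of [W] alone, encoded as colourings of [I] with a fixed value elsewhere; all factors
    of the product then have the same index type. *)
Definition supported (W : {set I}) (j : {ffun I -> K}) := [forall x, (x \in W) || (j x == k0)].

Lemma sum_prod_partition (rho : {set {set I}}) : partition rho [set: I] ->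
  \sum_(i : {ffun I -> K}) \prod_(W in rho) G i W
  = \prod_(W in rho) \sum_(j | supported W j) G j W.
Proof.
move=> pr; have tr := partition_trivIset pr.
have cr x : x \in cover rho by rewrite (cover_partition pr) inE.
pose j0 : {ffun I -> K} := [ffun=> k0].
pose res (i : {ffun I -> K}) (W : {set I}) : {ffun I -> K} := [ffun x => if x \in W then i x else k0].
rewrite (big_distr_big_dep j0) /=.
pose h (g : {ffun {set I} -> {ffun I -> K}}) : {ffun I -> K} := [ffun x => g (pblock rho x) x].
pose h' (i : {ffun I -> K}) := [ffun W => if W \in rho then res i W else j0].
rewrite (reindex_onto h h') /=; last first.
  by move=> i _; apply/ffunP => x; rewrite !ffunE pblock_mem // ffunE mem_pblock cr.
have hE (g : {ffun {set I} -> {ffun I -> K}}) W : W \in rho -> {in W, h g =1 g W}.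
  by move=> Wr x xW; rewrite ffunE (def_pblock tr Wr xW).
apply: eq_big => [g|g _].
  apply/eqP/pfamilyP => [gE|[/subsetP s0 gi]].
    split=> [|W Wr]; first apply/subsetP => W; first by rewrite inE -gE ffunE; case: ifP; rewrite ?eqxx.
    by apply/forallP => x; rewrite -gE ffunE Wr ffunE; case: (x \in W); rewrite ?eqxx.
  apply/ffunP => W; rewrite ffunE; case: ifP => Wr; last first.
    by apply/esym/eqP; apply: contraFT Wr => nz; apply: s0; rewrite inE.
  apply/ffunP => x; rewrite ffunE; case: ifP => xW; first exact: hE.
  by have /forallP/(_ x) := gi W Wr; rewrite xW => /eqP.
by apply: eq_bigr => W Wr; apply: G_local; apply: hE.
Qed.

Lemma sum_supported (W : {set I}) (H : {ffun 'I_#|W| -> K} -> F) : W != set0 ->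
  (forall j, G j W = H [ffun l => j (enum_val l)]) ->
  \sum_(j | supported W j) G j W = \sum_i H i.
Proof.
case/set0Pn => x0 x0W GH.
pose h (i : {ffun 'I_#|W| -> K}) : {ffun I -> K} :=
  [ffun x => if x \in W then i (enum_rank_in x0W x) else k0].
pose h' (j : {ffun I -> K}) : {ffun 'I_#|W| -> K} := [ffun l => j (enum_val l)].
rewrite (reindex_onto h h') /=; last first.
  move=> j /forallP sj; apply/ffunP => x; rewrite !ffunE; case: ifP => xW.
    by rewrite enum_rankK_in.
  by have := sj x; rewrite xW => /eqP.
have hK i : h' (h i) = i.
  by apply/ffunP => l; rewrite !ffunE enum_valP enum_valK_in.
apply: eq_big => [i|i _]; last by rewrite GH -/(h' _) hK.
rewrite hK eqxx andbT; apply/forallP => x; rewrite ffunE.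
by case: (x \in W); rewrite ?eqxx.
Qed.

End Distribution.

(** * Joint moments of free variables *)

Lemma sorted_enum_ord n (S : {set 'I_n}) : sorted (fun x y : 'I_n => (x < y)%N) (enum S).
Proof.
rewrite {1}/enum_mem -enumT; apply: sorted_filter => [y x z|]; first exact: ltn_trans.
by have := iota_ltn_sorted 0 n; rewrite -val_enum_ord sorted_map.
Qed.

Lemma NCD_set0 n (P : {set {set 'I_n}}) : (P \in NCD set0) = (P == set0).
Proof.
rewrite inE partition_set0; case: eqP => //= ->; apply/noncrossingP => V W x y z t.
by rewrite inE.
Qed.

(** Take two points of one block at the least distance. A point of [S] between them would belong to
    another block, trapped there by noncrossingness and not a singleton, hence to a closer pair. *)
Lemma NCD_adjacent n (S : {set 'I_n}) P : P \in NCD S -> S != set0 ->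
  (forall V, V \in P -> (1 < #|V|)%N) ->
  exists V x y, [/\ V \in P, x \in V, y \in V, (x < y)%N &
    forall z, z \in S -> (x < z)%N -> (z < y)%N -> False].
Proof.
move=> PN /set0Pn[s sS] P2.
have other V x : V \in P -> x \in V -> exists2 y, y \in V & y != x.
  move=> /P2 V2 xV; have : (0 < #|V :\ x|)%N by rewrite (cardsD1 x) xV in V2.
  by case/card_gt0P => y; rewrite !inE => /andP[yx yV]; exists y.
have blk z : z \in S -> exists2 V, V \in P & z \in V.
  by rewrite -(NCD_cover PN) => /bigcupP[V]; exists V.
pose good d := [exists V in P, exists x in V, exists y in V, (x < y)%N && (y - x == d)%N].
have [d0 d0P] : exists d, good d.
  have [V VP sV] := blk s sS; have [t tV ts] := other V s VP sV.
  have [lt|lt|/val_inj e] := ltngtP s t; last by rewrite e eqxx in ts.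
    exists (t - s)%N; apply/exists_inP; exists V => //; apply/exists_inP; exists s => //.
    by apply/exists_inP; exists t; rewrite // lt eqxx.
  exists (s - t)%N; apply/exists_inP; exists V => //; apply/exists_inP; exists t => //.
  by apply/exists_inP; exists s; rewrite // lt eqxx.
have [d /exists_inP[V VP /exists_inP[x xV /exists_inP[y yV /andP[xy /eqP dE]]]] dmin] :=
  ex_minnP (ex_intro _ d0 d0P).
have close W u v : W \in P -> u \in W -> v \in W -> (x <= u)%N -> (u < v)%N -> (v <= y)%N ->
    (x < u)%N || (v < y)%N -> False.
  move=> WP uW vW xu uv vy h; have : (d <= v - u)%N.
    apply: dmin; apply/exists_inP; exists W => //; apply/exists_inP; exists u => //.
    by apply/exists_inP; exists v; rewrite // uv eqxx.
  by move: xy uv xu vy h; clear -dE; lia.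
exists V, x, y; split=> // z zS xz zy.
have zV : z \notin V.
  by apply/negP => zV; apply: (close V x z) => //; rewrite ?zy ?orbT // ltnW.
have [W WP zW] := blk z zS; have [t tW tz] := other W z WP zW.
have tV : t \notin V by apply: contraNN zV => tV; rewrite -(NCD_block PN WP VP tW tV).
have WV : W = V -> False by move=> e; rewrite -e zW in zV.
have [tx|tx|/val_inj e] := ltngtP t x; last by rewrite e xV in tV.
  exact: WV (NCD_crossing PN WP VP tx xz zy tW zW xV yV).
have [ty|ty|/val_inj e] := ltngtP t y; last by rewrite e yV in tV.
  have [lt|lt|/val_inj e] := ltngtP t z; last by rewrite e eqxx in tz.
    by apply: (close W t z) => //; rewrite ?tx // ltnW.
  by apply: (close W z t) => //; rewrite ?xz // ltnW.
exact: WV (esym (NCD_crossing PN VP WP xz zy ty xV yV zW tW)).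
Qed.

Section Singleton.
Local Open Scope ring_scope.
Variables (n : nat) (F : GRing.ComNzRing.type) (S : {set 'I_n}) (r : 'I_n).
Hypothesis rS : r \in S.

Lemma NCD_add_singleton P : P \in NCD (S :\ r) ->
  [set r] \notin P /\ [set r] |: P \in NCD S.
Proof.
move=> PN; have nr V : V \in P -> r \notin V.
  by move=> VP; apply/negP => /(subsetP (NCD_sub PN VP)); rewrite !inE eqxx.
have nP : [set r] \notin P by apply/negP => /nr; rewrite inE eqxx.
have /and3P[/eqP cP tP P0] := NCD_partition PN.
split=> //; rewrite inE; apply/andP; split.
  apply/and3P; split.
  - by rewrite /cover bigcup_setU big_set1 -/(cover P) cP setD1K.
  - apply/trivIsetP => V W; rewrite !inE => /orP[/eqP ->|VP] /orP[/eqP ->|WP].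
    + by rewrite eqxx.
    + by rewrite disjoints1 nr.
    + by rewrite disjoint_sym disjoints1 nr.
    + exact: (trivIsetP tP).
  - rewrite !inE negb_or P0 andbT; apply/negP => /eqP/setP/(_ r).
    by rewrite !inE eqxx.
apply/noncrossingP => V W x y z t; rewrite !inE => /orP[/eqP ->|VP] /orP[/eqP ->|WP] //.
- by move=> xy yz zt; rewrite !inE => /eqP xr /eqP zr; rewrite xr zr in xy yz; lia.
- by move=> xy yz zt; rewrite !inE => _ _ /eqP yr /eqP tr; rewrite yr tr in yz zt; lia.
- exact: (NCD_crossing PN VP WP).
Qed.

Lemma NCD_remove_singleton P : P \in NCD S -> [set r] \in P ->
  P :\ [set r] \in NCD (S :\ r).
Proof.
move=> PN rP; have /and3P[/eqP cP tP P0] := NCD_partition PN.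
have sub : P :\ [set r] \subset P by apply: subsetDl.
rewrite inE; apply/andP; split; last first.
  by apply: sub_noncrossing sub _; move: PN; rewrite inE => /andP[].
apply/and3P; split.
- apply/eqP/setP => x; apply/bigcupP/idP => [[V]|].
    rewrite !inE => /andP[Vr VP] xV; rewrite -cP; apply/andP; split.
      apply: contraNneq Vr => xr; rewrite xr in xV.
      by rewrite (NCD_block PN VP rP xV) // inE.
    by apply/bigcupP; exists V.
  rewrite !inE -cP => /andP[xr /bigcupP[V VP xV]]; exists V => //.
  by rewrite !inE VP andbT; apply: contraNneq xr => Vr; rewrite Vr inE in xV.
- exact: trivIsetS sub tP.
- by rewrite !inE (negPf P0) andbF.
Qed.

(** The counterpart for partitions of centring one factor of a product: changing the weight of a
    single singleton removes [m] times the sum without its point. *)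
Lemma sum_NCD_singleton (K K' : {set 'I_n} -> F) (m : F) :
  (forall W, K' W = K W - (if W == [set r] then m else 0)) ->
  \sum_(P in NCD S) \prod_(W in P) K' W
  = \sum_(P in NCD S) \prod_(W in P) K W
    - m * \sum_(P in NCD (S :\ r)) \prod_(W in P) K W.
Proof.
move=> KE; have K'E (P : {set {set 'I_n}}) : [set r] \notin P ->
    \prod_(W in P) K' W = \prod_(W in P) K W.
  move=> nP; apply: eq_bigr => W WP; rewrite KE ifN ?subr0 //.
  by apply: contraNneq nP => <-.
have split (G : {set {set 'I_n}} -> F) : \sum_(P in NCD S) G P =
    \sum_(P in NCD S | [set r] \notin P) G P + \sum_(P in NCD (S :\ r)) G ([set r] |: P).
  rewrite (bigID (fun P : {set {set 'I_n}} => [set r] \in P)) /= addrC; congr (_ + _).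
  rewrite (reindex_onto (fun P : {set {set 'I_n}} => [set r] |: P) (fun P => P :\ [set r])) /=.
    apply: eq_bigl => P; apply/idP/idP => [/andP[/andP[PN rP] /eqP PE]|PN].
      by rewrite -PE; apply: NCD_remove_singleton.
    have [nP rN] := NCD_add_singleton PN.
    by rewrite rN setU11 setU1K ?eqxx.
  by move=> P /andP[_ rP]; rewrite setD1K.
rewrite split [in RHS]split -addrA; congr (_ + _).
  by apply: eq_bigr => P /andP[_]; apply: K'E.
rewrite mulr_sumr -sumrB; apply: eq_bigr => P PN.
have [nP _] := NCD_add_singleton PN.
by rewrite !big_setU1 //= K'E // KE eqxx mulrBl.
Qed.

End Singleton.

(** * Maximal runs of equal letters *)

Section Runs.
Variables (N : nat) (T : eqType) (c : 'I_N -> T) (D : {set 'I_N}).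
Implicit Types x y z : 'I_N.

Definition same_run r x := [&& r \in D, (r <= x)%N &
  [forall z in D, (r <= z <= x)%N ==> (c z == c x)]].

(** A run is named by its first point, so that the set of runs is a subset of the points with the
    induced order. Runs are taken inside [D]: the points outside [D] do not interrupt them. *)
Definition run_start x : 'I_N := [arg min_(r < x | same_run r x) (r : nat)].

Lemma same_run_refl x : x \in D -> same_run x x.
Proof.
move=> xD; rewrite /same_run xD leqnn; apply/forall_inP => z _; apply/implyP.
by move/anti_leq/val_inj => ->.
Qed.

Lemma run_startP x : x \in D -> same_run (run_start x) x /\
  (forall r, same_run r x -> (run_start x <= r)%N).
Proof.
by move=> /same_run_refl xx; rewrite /run_start; case: arg_minnP.
Qed.

Lemma run_start_in x : x \in D -> run_start x \in D.
Proof. by case/run_startP => /and3P[]. Qed.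

Lemma run_start_le x : x \in D -> (run_start x <= x)%N.
Proof. by case/run_startP => /and3P[]. Qed.

Lemma run_start_eq x z : x \in D -> z \in D -> (run_start x <= z)%N -> (z <= x)%N -> c z = c x.
Proof.
case/run_startP => /and3P[_ _ /forall_inP h] _ zD rz zx.
by apply/eqP; move/implyP: (h z zD); apply; rewrite rz.
Qed.

Lemma color_run_start x : x \in D -> c (run_start x) = c x.
Proof.
by move=> xD; apply: run_start_eq => //; [exact: run_start_in | exact: run_start_le].
Qed.

Lemma run_start_mono : {in D &, forall x y, (x <= y)%N -> (run_start x <= run_start y)%N}.
Proof.
move=> x y xD yD xy; have [lt|le] := ltnP x (run_start y).
  by apply: leq_trans (run_start_le xD) (ltnW lt).
have [_ mx] := run_startP xD; apply: mx.
rewrite /same_run run_start_in // le /=; apply/forall_inP => z zD; apply/implyP => /andP[rz zx].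
rewrite (run_start_eq yD zD rz (leq_trans zx xy)).
by rewrite (run_start_eq yD xD le xy).
Qed.

Lemma run_startK x : x \in D -> run_start (run_start x) = run_start x.
Proof.
move=> xD; apply/val_inj/anti_leq; rewrite run_start_le ?run_start_in //=.
have [_ mx] := run_startP xD; apply: mx.
have rD := run_start_in xD; have le := run_start_le rD.
rewrite /same_run run_start_in // (leq_trans le (run_start_le xD)) /=.
apply/forall_inP => z zD; apply/implyP => /andP[rz zx].
have [zr|rz'] := leqP z (run_start x); last by rewrite (run_start_eq xD zD (ltnW rz') zx).
by rewrite (run_start_eq rD zD rz zr) color_run_start.
Qed.

(** With equal letters the two runs would merge and [r'] would not start one. *)
Lemma consecutive_runs r r' : r \in run_start @: D -> r' \in run_start @: D -> (r < r')%N ->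
  (forall z, z \in run_start @: D -> (r < z)%N -> (z < r')%N -> False) -> c r != c r'.
Proof.
case/imsetP => x xD rE /imsetP[x' x'D r'E] lt no; apply/negP => /eqP cc.
have rD : r \in D by rewrite rE run_start_in.
have r'D : r' \in D by rewrite r'E run_start_in.
have qr : run_start r = r by rewrite rE run_startK.
have qr' : run_start r' = r' by rewrite r'E run_startK.
have [_ mr] := run_startP r'D; suff /mr : same_run r r' by rewrite qr' leqNgt lt.
rewrite /same_run rD (ltnW lt) /=; apply/forall_inP => z zD; apply/implyP => /andP[rz].
rewrite leq_eqVlt => /orP[/eqP/val_inj -> //|zr'].
have rq : (r <= run_start z)%N by rewrite -[X in (X <= _)%N]/(val r) -{1}qr run_start_mono.
move: rq; rewrite leq_eqVlt => /orP[/eqP/val_inj e|gt].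
  by rewrite -(color_run_start zD) -e cc.
by case: (no _ (imset_f _ zD) gt (leq_ltn_trans (run_start_le zD) zr')).
Qed.

End Runs.

Section FreeMoments.
Local Open Scope ring_scope.
Variables (F : GRing.ComNzRing.type) (A : GRing.Algebra.type F) (phi : {scalar A}).
Hypothesis phi1 : phi 1 = 1.

Lemma moment_power (b : A) m : phi (b ^+ m)
  = \sum_(P in NCD [set: 'I_m]) \prod_(V in P) cumulant1 phi #|V| b.
Proof.
case: m => [|m]; last first.
  by have := moment_cumulant phi (fun _ : 'I_m.+1 => b) isT; rewrite prodr_const card_ord.
have -> : [set: 'I_0] = set0 by apply/setP => -[].
rewrite (eq_bigl (pred1 set0)) => [|P]; last exact: NCD_set0.
by rewrite big_pred1_eq big_set0 phi1.
Qed.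

Variables (k : nat) (a : 'I_k -> A).
Hypothesis a_free : freely_independent phi a.

Let kappa m i := cumulant1 phi m (a i).

Section Word.
Variables (N : nat) (c : 'I_N -> 'I_k).

Let word (D : {set 'I_N}) := \prod_(x <- enum D) a (c x).
Let NCsum (D : {set 'I_N}) := \sum_(P in NCD D) \prod_(V in P) block_weight kappa c V.

Lemma NCsum_monochrome (D : {set 'I_N}) i : (forall x, x \in D -> c x = i) ->
  NCsum D = phi (a i ^+ #|D|).
Proof.
move=> cD; rewrite moment_power; pose h (l : 'I_#|D|) : 'I_N := enum_val l.
have hD : h @: [set: 'I_#|D|] = D.
  apply/setP => x; apply/imsetP/idP => [[l _ ->]|xD]; first exact: enum_valP.
  by exists (enum_rank_in xD x); rewrite // /h enum_rankK_in.
rewrite /NCsum -{1}hD (sum_NCD_transport (@enum_val_mono _ D)).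
apply: eq_bigr => P PN; apply: eq_bigr => V VP.
have [x xV] := NCD_neq0 PN VP.
rewrite (block_weight_mono _ (x := h x)) ?imset_f //.
  by rewrite card_imset ?cD ?enum_valP //; apply: enum_val_inj.
by move=> _ /imsetP[z _ ->]; rewrite !cD //; apply: enum_valP.
Qed.

(* In the moment of D, centre the syllables (the maximal runs of equal letters) one
   at a time: each step creates a term with fewer letters. Once all of them are
   centred, the moment vanishes by freeness, and so does the sum over noncrossing
   partitions of the syllables: each partition has a singleton, or two consecutive
   syllables in the same block. *)
Section Step.
Variable D : {set 'I_N}.
Hypothesis D_neq0 : D != set0.
Hypothesis IH : forall D' : {set 'I_N}, D' \proper D -> phi (word D') = NCsum D'.

Let q := run_start c D.
Let E := q @: D.
Let q_mono := @run_start_mono _ _ c D.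
Let syllable r := word (above q D [set r]).
Let mean r := phi (syllable r).
Let K W := \sum_(Q in connected_NC q (above q D W)) \prod_(V in Q) block_weight kappa c V.
Let centred_K (C W : {set 'I_N}) := K W - \sum_(r in C | W == [set r]) mean r.
Let Phi u v := phi (\prod_(r <- u) (syllable r - (mean r)%:A) * \prod_(r <- v) syllable r).
Let Psi (S C : {set 'I_N}) := \sum_(rho in NCD S) \prod_(W in rho) centred_K C W.

Lemma run_start_id r : r \in E -> q r = r.
Proof. by case/imsetP => x xD ->; apply: run_startK. Qed.

Lemma E_sub r : r \in E -> r \in D.
Proof. by case/imsetP => x xD ->; apply: run_start_in. Qed.

Lemma above_color r x : x \in above q D [set r] -> c x = c r.
Proof.
rewrite !inE => /andP[xD /eqP <-]; exact/esym/color_run_start.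
Qed.

Lemma syllable_power r : syllable r = a (c r) ^+ #|above q D [set r]|.
Proof.
rewrite /syllable /word cardE -iter_mulr_1 -(count_predT (enum _)) -big_const_seq.
by apply: eq_big_seq => x; rewrite mem_enum => /above_color ->.
Qed.

Lemma enum_above (v : seq 'I_N) : sorted (fun x y : 'I_N => (x < y)%N) v ->
  {subset v <= E} ->
  enum (above q D [set r in v]) = flatten [seq enum (above q D [set r]) | r <- v].
Proof.
have tr : transitive (fun x y : 'I_N => (x < y)%N) by move=> y x z; apply: ltn_trans.
have ir : irreflexive (fun x y : 'I_N => (x < y)%N) by move=> x; apply: ltnn.
move=> sv vE; apply: (irr_sorted_eq tr ir); first exact: sorted_enum_ord.
  elim: v sv vE => //= r v IHv sv vE.
  rewrite sorted_pairwise // pairwise_cat -!sorted_pairwise // sorted_enum_ord.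
  rewrite IHv ?(path_sorted sv) ?andbT //; last by move=> x xv; apply: vE; rewrite inE xv orbT.
  apply/allrelP => x y; rewrite mem_enum !inE => /andP[xD /eqP qx].
  case/flatten_mapP => r' r'v; rewrite mem_enum !inE => /andP[yD /eqP qy].
  have : (r < r')%N by move/allP: (order_path_min tr sv); apply.
  by apply: contraTT; rewrite -!leqNgt => /(q_mono yD xD); rewrite -/q qx qy.
move=> x; rewrite mem_enum inE; apply/andP/flatten_mapP => [[xD]|[r rv]].
  by rewrite inE => qx; exists (q x); rewrite // mem_enum !inE xD eqxx.
by rewrite mem_enum !inE => /andP[-> /eqP ->].
Qed.

Lemma word_above (v : seq 'I_N) : sorted (fun x y : 'I_N => (x < y)%N) v ->
  {subset v <= E} ->
  word (above q D [set r in v]) = \prod_(r <- v) syllable r.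
Proof. by move=> sv vE; rewrite /word enum_above // big_flatten big_map. Qed.

Lemma centred_K0 W : centred_K set0 W = K W.
Proof. by rewrite /centred_K big_pred0 ?subr0 // => r; rewrite inE. Qed.

Lemma NCsum_above (S : {set 'I_N}) : S \subset E -> NCsum (above q D S) = Psi S set0.
Proof.
move=> /subsetP SE; have qS : q @: above q D S = S.
  apply/setP => r; apply/imsetP/idP => [[x]|rS]; first by rewrite inE => /andP[_ ? ->].
  by exists r; rewrite ?inE ?run_start_id ?E_sub ?SE.
have mono : {in above q D S &, forall x y : 'I_N, (x <= y)%N -> (q x <= q y)%N}.
  by move=> x y; rewrite !inE => /andP[xD _] /andP[yD _]; apply: q_mono.
rewrite /NCsum (sum_coarsening mono) qS; apply: eq_bigr => rho rN.
apply: eq_bigr => W Wr; rewrite centred_K0 /K.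
suff -> : above q (above q D S) W = above q D W by [].
apply/setP => x; rewrite !inE; case: (x \in D) => //=; apply: andb_idl => qx.
by apply: subsetP qx; apply: NCD_sub rN Wr.
Qed.

Lemma above_proper (S : {set 'I_N}) : S \subset E -> S != E -> above q D S \proper D.
Proof.
move=> SE nSE; apply/properP; split; first by apply/subsetP => x; rewrite inE => /andP[].
have /properP[_ [r rE rS]] : S \proper E by rewrite properEneq nSE.
by exists r; rewrite ?E_sub // inE run_start_id // (negPf rS) andbF.
Qed.

(** In [Phi] the syllables of [u] are centred and those of [v] are not, and [C] is the centred part
    in [Psi S C]. Both satisfy the same recursion, see [PsiE]. *)
Lemma PhiE u r v : Phi u (r :: v) = Phi (rcons u r) v + mean r * Phi u v.
Proof.
rewrite /Phi big_rcons big_cons /= mulrBr mulr_algr mulrBl linearB /=.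
by rewrite -scalerAl linearZ /= mulrA subrK.
Qed.

Lemma PsiE (S C : {set 'I_N}) r : r \in S -> r \notin C ->
  Psi S (r |: C) = Psi S C - mean r * Psi (S :\ r) C.
Proof.
move=> rS rC; apply: (sum_NCD_singleton rS) => W; rewrite /centred_K.
rewrite big_mkcondr big_setU1 //= -big_mkcondr [_ + \sum_(_ in _ | _) _]addrC.
by rewrite opprD addrA.
Qed.

Lemma set_of_rcons (u : seq 'I_N) r : [set x in rcons u r] = r |: [set x in u].
Proof. by apply/setP => x; rewrite !inE mem_rcons inE. Qed.

(** When a syllable is missing, the uncentred moment is known by [IH], and the recursion centres the
    syllables of [u] one by one. *)
Lemma Phi_proper u v : sorted (fun x y : 'I_N => (x < y)%N) (u ++ v) ->
  {subset u ++ v <= E} -> [set x in u ++ v] != E ->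
  Phi u v = Psi [set x in u ++ v] [set x in u].
Proof.
have tr : transitive (fun x y : 'I_N => (x < y)%N) by move=> y x z; apply: ltn_trans.
have ir : irreflexive (fun x y : 'I_N => (x < y)%N) by move=> x; apply: ltnn.
elim/last_ind: u v => [|u r IHu] v sv vE nE.
  have sE : [set x in v] \subset E by apply/subsetP => x; rewrite inE => /vE.
  have -> : [set x in [::]] = set0 :> {set 'I_N} by apply/setP => x; rewrite !inE.
  rewrite -NCsum_above //= -IH; last exact: above_proper.
  by rewrite /Phi big_nil mul1r word_above.
rewrite cat_rcons in sv vE nE *.
have us : uniq (u ++ r :: v) := sorted_uniq tr ir sv.
have sub : subseq (u ++ v) (u ++ r :: v).
  by rewrite (cat_subseq (subseq_refl u)) ?subseq_cons.
have nr : r \notin u ++ v.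
  by move: us; rewrite -cat1s uniq_catCA cat1s => /andP[].
have rE : r \in E by apply: vE; rewrite mem_cat mem_head orbT.
have SE : [set x in u ++ v] = [set x in u ++ r :: v] :\ r.
  apply/setP => x; rewrite !inE !mem_cat inE; have [->|//] := eqVneq x r.
  by move: nr; rewrite mem_cat => /negPf ->.
have PE := PhiE u r v; rewrite IHu // in PE.
rewrite IHu in PE; first last.
- by apply: contraTneq rE => <-; rewrite inE.
- by move=> x /(mem_subseq sub)/vE.
- exact: subseq_sorted sub sv.
rewrite set_of_rcons PsiE -?SE; first by rewrite PE addrK.
  by rewrite inE mem_cat mem_head orbT.
by move: nr; rewrite inE mem_cat; case: (r \in u).
Qed.

Lemma syllables_consecutive : sorted (fun x y => c x != c y) (enum E).
Proof.
have sE := sorted_enum_ord E.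
case eE : (enum E) => [|x0 s] //; rewrite -eE.
apply/(sortedP x0) => i ilt; set r := nth _ _ i; set r' := nth _ _ i.+1.
have rE : r \in E by rewrite -mem_enum mem_nth // ltnW.
have r'E : r' \in E by rewrite -mem_enum mem_nth.
have mono j l : (j < size (enum E))%N -> (l < size (enum E))%N -> (j < l)%N ->
    (nth x0 (enum E) j < nth x0 (enum E) l)%N.
  by move=> js ls; apply: (sorted_ltn_nth _ x0 sE) => // y x z; apply: ltn_trans.
apply: (consecutive_runs rE r'E); first exact: mono (ltnW ilt) ilt (ltnSn i).
move=> z; rewrite -mem_enum => zE rz zr'.
have zs : (index z (enum E) < size (enum E))%N by rewrite index_mem.
have zn : nth x0 (enum E) (index z (enum E)) = z by rewrite nth_index.
have [le|gt] := leqP (index z (enum E)) i.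
  move: le; rewrite leq_eqVlt => /orP[/eqP e|lt].
    by rewrite -zn e ltnn in rz.
  by have := mono _ _ zs (ltnW ilt) lt; rewrite zn ltnNge (ltnW rz).
move: gt; rewrite leq_eqVlt => /orP[/eqP e|lt].
  by rewrite -zn -e ltnn in zr'.
by have := mono _ _ ilt zs lt; rewrite zn ltnNge (ltnW zr').
Qed.

Lemma E_neq0 : E != set0.
Proof. by have /set0Pn[x xD] := D_neq0; apply/set0Pn; exists (q x); apply: imset_f. Qed.

Lemma Phi_centred : Phi (enum E) [::] = 0.
Proof.
pose s := [seq (c r, 'X ^+ #|above q D [set r]| - (mean r)%:P) | r <- enum E].
rewrite /Phi big_nil mulr1.
have pE r : horner_alg (a (c r)) ('X ^+ #|above q D [set r]| - (mean r)%:P)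
    = syllable r - (mean r)%:A.
  by rewrite rmorphB rmorphXn /= horner_algX horner_algC syllable_power.
have <- : \prod_(x <- s) horner_alg (a x.1) x.2 =
    \prod_(r <- enum E) (syllable r - (mean r)%:A).
  by rewrite big_map; apply: eq_bigr => r _; rewrite pE.
apply: a_free.
- have /set0Pn[r] := E_neq0; rewrite -mem_enum /s; by case: (enum E).
- by rewrite sorted_map; apply: syllables_consecutive.
- move=> _ /mapP[r _ ->] /=; rewrite pE linearB linearZ /= phi1 mulr1.
  by rewrite -/(mean r) subrr.
Qed.

Lemma K_singleton r : r \in E -> K [set r] = mean r.
Proof.
move=> rE; transitivity (NCsum (above q D [set r])).
  apply: eq_bigl => Q; rewrite inE andb_idr // => QN.
  apply/forall_inP => x xr; apply/forall_inP => y yr; apply: connect1.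
  rewrite /glued (NCD_cover QN) xr yr /=.
  by move: xr yr; rewrite !inE => /andP[_ /eqP ->] /andP[_ /eqP ->]; rewrite eqxx.
rewrite (@NCsum_monochrome _ (c r)); last by move=> x /above_color.
by rewrite -syllable_power.
Qed.

(** If all blocks of a connected partition were monochromatic, the letter, being constant on
    syllables too, would be constant on [W]. *)
Lemma K_color (W : {set 'I_N}) x y : W \subset E -> x \in W -> y \in W -> c x != c y -> K W = 0.
Proof.
move=> /subsetP WE xW yW nxy; apply: big1 => Q QN.
case: (pselect (forall V : {set 'I_N}, V \in Q -> forall u v, u \in V -> v \in V -> c u = c v)) => [mono|nm].
  case/eqP: nxy; have xE := WE x xW; have yE := WE y yW.
  have xA : x \in above q D W by rewrite inE E_sub // run_start_id.
  have yA : y \in above q D W by rewrite inE E_sub // run_start_id.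
  have := @glued_closed _ _ q Q [set z | c z == c x] _ _ x y (connected_NCP QN xA yA).
  rewrite !inE eqxx => h; apply/esym/eqP; rewrite -h //.
    by move=> V u v VQ uV vV; rewrite !inE (mono V VQ u v uV vV).
  move=> u v; rewrite (NCD_cover (connected_NCD QN)) !inE => /andP[uD _] /andP[vD _] uv.
  by rewrite -(color_run_start c uD) -(color_run_start c vD) -/q uv.
have [V [VQ [u [v [uV vV uv]]]]] : exists V : {set 'I_N}, V \in Q /\ exists u v, [/\ u \in V, v \in V & c u != c v].
  apply: contrapT => no; apply: nm => V VQ u v uV vV; apply/eqP; apply: contraT => uv.
  by case: no; exists V; split=> //; exists u, v.
by rewrite (bigD1 V) //= (block_weight0 _ uV vV uv) mul0r.
Qed.

Lemma Psi_centred : Psi E E = 0.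
Proof.
apply: big1 => rho rN; case: (pselect (exists r, [set r] \in rho)) => [[r rr]|ns].
  have rE : r \in E by apply: subsetP (NCD_sub rN rr) _ _; rewrite inE.
  rewrite (bigD1 [set r]) //= {1}/centred_K K_singleton // (bigD1 r) ?eqxx ?rE //=.
  rewrite big1 ?addr0 ?subrr ?mul0r // => r' /andP[/andP[_ /eqP/set1_inj ->]].
  by rewrite eqxx.
have [|W [x [y [Wr xW yW xy no]]]] := NCD_adjacent rN E_neq0.
  move=> W Wr; rewrite ltn_neqAle eq_sym; apply/andP; split.
    by apply/negP => /cards1P[r WE]; case: ns; exists r; rewrite -WE.
  by rewrite card_gt0; apply/set0Pn; apply: NCD_neq0 rN Wr.
have WE := NCD_sub rN Wr.
have nxy : c x != c y.
  by apply: (consecutive_runs (subsetP WE x xW) (subsetP WE y yW) xy no).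
have cW : centred_K E W = 0.
  rewrite /centred_K (K_color WE xW yW nxy) big_pred0 ?subr0 // => r.
  by apply/negP => /andP[_ /eqP e]; case: ns; exists r; rewrite -e.
by rewrite (bigD1 W) //= cW mul0r.
Qed.

(** The recursion used backwards: with all syllables present it is the fully centred case that is
    known, both sides being 0, and the terms with a syllable less come from [Phi_proper]. *)
Lemma Phi_full v u : u ++ v = enum E -> Phi u v = Psi E [set x in u].
Proof.
elim: v u => [|r v IHv] u uv.
  rewrite cats0 in uv; rewrite uv Phi_centred.
  have -> : [set x in enum E] = E by apply/setP => x; rewrite inE mem_enum.
  by rewrite Psi_centred.
have tr : transitive (fun x y : 'I_N => (x < y)%N) by move=> y x z; apply: ltn_trans.
have sE := sorted_enum_ord E.
have us : uniq (u ++ r :: v) by rewrite uv enum_uniq.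
have sub : subseq (u ++ v) (enum E).
  by rewrite -uv (cat_subseq (subseq_refl u)) ?subseq_cons.
have nr : r \notin u ++ v.
  by move: us; rewrite -cat1s uniq_catCA cat1s => /andP[].
have rE : r \in E by rewrite -mem_enum -uv mem_cat mem_head orbT.
have nru : r \notin [set x in u] by move: nr; rewrite inE mem_cat; case: (r \in u).
rewrite PhiE IHv ?cat_rcons // set_of_rcons PsiE // Phi_proper.
- have -> : [set x in u ++ v] = E :\ r.
    apply/setP => x; rewrite !inE -(mem_enum E) -uv !mem_cat inE.
    by have [->|//] := eqVneq x r; move: nr; rewrite mem_cat => /negPf ->.
  by rewrite subrK.
- exact: subseq_sorted tr _ _ sub sE.
- by move=> x /(mem_subseq sub); rewrite mem_enum.
- by apply: contraTneq rE => <-; rewrite inE.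
Qed.

Lemma word_step : phi (word D) = NCsum D.
Proof.
have EE : [set x in enum E] = E by apply/setP => x; rewrite inE mem_enum.
have DE : above q D E = D.
  by apply/setP => x; rewrite inE andb_idr // => xD; apply: imset_f.
have := Phi_full (erefl : [::] ++ enum E = enum E).
rewrite /Phi big_nil mul1r -word_above ?sorted_enum_ord ?EE ?DE // => [->|x].
  have -> : [set x in [::]] = set0 :> {set 'I_N} by apply/setP => x; rewrite !inE.
  by rewrite -NCsum_above // DE.
by rewrite mem_enum.
Qed.

End Step.

Lemma free_moment (D : {set 'I_N}) :
  phi (\prod_(x <- enum D) a (c x))
  = \sum_(P in NCD D) \prod_(V in P) block_weight (fun m i => cumulant1 phi m (a i)) c V.
Proof.
move Em : #|D| => m; elim/ltn_ind: m D Em => m IHm D Dm.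
have [->|D0] := eqVneq D set0; last first.
  by apply: word_step => // D' /proper_card lt; apply: IHm erefl; rewrite -Dm.
rewrite enum_set0 big_nil phi1 (eq_bigl (pred1 set0)) => [|P]; last exact: NCD_set0.
by rewrite big_pred1_eq big_set0.
Qed.

End Word.
End FreeMoments.

(** * Cumulants of a quadratic form *)

Local Open Scope ring_scope.

(** The moment formula is triangular: in order [m] only the one-block partition involves [Z m]. *)
Lemma cumulant1_unique (F : GRing.ComNzRing.type) (A : GRing.Algebra.type F) (phi : A -> F)
    (b : A) (Z : nat -> F) :
  (forall m, (0 < m)%N ->
    phi (b ^+ m) = \sum_(P in NCD [set: 'I_m]) \prod_(V in P) Z #|V|) ->
  forall m, (0 < m)%N -> cumulant1 phi m b = Z m.
Proof.
move=> mZ m; elim/ltn_ind: m => m IHm m0.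
have mc : phi (b ^+ m) = \sum_(P in NCD [set: 'I_m]) \prod_(V in P) cumulant1 phi #|V| b.
  by have := moment_cumulant phi (fun _ : 'I_m => b) m0; rewrite prodr_const card_ord.
have one := NC_one_block m0.
move: mc; rewrite mZ // (bigD1 [set [set: 'I_m]]) //= [in RHS](bigD1 [set [set: 'I_m]]) //=.
rewrite !big_set1 !cardsT !card_ord.
rewrite [X in _ + X = _](eq_bigr (fun P : {set {set 'I_m}} => \prod_(V in P) cumulant1 phi #|V| b)).
  by move/addIr.
move=> P /andP[PN PT]; apply: eq_bigr => V VP.
by rewrite IHm //; [exact: NC_block_lt PN PT VP | exact: NC_block_gt0 PN VP].
Qed.

Lemma big_enum_setT (R : Type) (idx : R) (op : Monoid.law idx) n (f : 'I_n -> R) :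
  \big[op/idx]_(x <- enum [set: 'I_n]) f x = \big[op/idx]_(x < n) f x.
Proof. by rewrite enum_setT [index_enum _]unlock. Qed.

(** * The points of the copies in a block *)

Section SubsetPoints.
Variables (n : nat) (W : {set 'I_n}).

Definition subset_point (x : 'I_#|W|.*2) : 'I_n.*2 :=
  point (enum_val (half_ord x)) (odd x).

Lemma half_subset_point x : half_ord (subset_point x) = enum_val (half_ord x).
Proof. exact: half_point. Qed.

Lemma subset_point_mono x y : (subset_point x < subset_point y)%N = (x < y)%N.
Proof.
have := enum_val_mono (half_ord x) (half_ord y).
have := enum_val_mono (half_ord y) (half_ord x).
rewrite /subset_point /=; have := odd_double_half x; have := odd_double_half y.
move: (nat_of_ord (enum_val (half_ord x))) (nat_of_ord (enum_val (half_ord y))) => u v.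
by case: (odd x); case: (odd y) => /=; lia.
Qed.

Lemma subset_point_half x y : (half_ord (subset_point x) == half_ord (subset_point y))
  = (half_ord x == half_ord y).
Proof. by rewrite !half_subset_point (inj_eq enum_val_inj). Qed.

Lemma subset_point_above :
  above (@half_ord n) [set: 'I_n.*2] W = subset_point @: [set: 'I_#|W|.*2].
Proof.
apply/setP => x; rewrite !inE /=; apply/idP/imsetP => [xW|[y _ ->]]; last first.
  by rewrite half_subset_point enum_valP.
exists (point (enum_rank_in xW (half_ord x)) (odd x)); first exact: in_setT.
by rewrite /subset_point half_point odd_point enum_rankK_in ?point_half.
Qed.

End SubsetPoints.

Lemma half_ord_mono n : {in [set: 'I_n.*2] &, forall x y : 'I_n.*2,
  (x <= y)%N -> (half_ord x <= half_ord y)%N}.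
Proof. by move=> x y _ _; apply: half_leq. Qed.

Lemma half_ord_image n : @half_ord n @: [set: 'I_n.*2] = [set: 'I_n].
Proof.
apply/setP => l; rewrite inE; apply/imsetP; exists (point l false) => //.
by rewrite half_point.
Qed.

Section QuadraticForm.
Variables (F : GRing.ComNzRing.type) (A : GRing.Algebra.type F) (phi : {scalar A}).
Hypothesis phi1 : phi 1 = 1.
Variables (k : nat) (k0 : 'I_k) (a : 'I_k -> A).
Hypothesis a_free : freely_independent phi a.
Variable w : 'I_k -> 'I_k -> F.

Let kappa m i := cumulant1 phi m (a i).
Let quadratic := \sum_(i < k) \sum_(j < k) w i j *: (a i * a j).

Definition connected_sum m : F :=
  \sum_(i : {ffun 'I_m -> 'I_k * 'I_k}) (\prod_l w (i l).1 (i l).2) *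
     \sum_(P in connected_NC (@half_ord m) [set: 'I_m.*2])
       \prod_(V in P) block_weight kappa (point_color i) V.

Lemma block_weight_eq N (col col' : 'I_N -> 'I_k) (V : {set 'I_N}) :
  {in V, col =1 col'} -> block_weight kappa col V = block_weight kappa col' V.
Proof.
move=> e; apply: eq_bigl => c.
by apply/subsetP/subsetP => h x xV; move: (h x xV); rewrite !inE e.
Qed.

Let component n (i : {ffun 'I_n -> 'I_k * 'I_k}) (W : {set 'I_n}) : F :=
  (\prod_(l in W) w (i l).1 (i l).2) *
  \sum_(Q in connected_NC (@half_ord n) (above (@half_ord n) [set: 'I_n.*2] W))
    \prod_(V in Q) block_weight kappa (point_color i) V.

Lemma component_local n (W : {set 'I_n}) (i j : {ffun 'I_n -> 'I_k * 'I_k}) :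
  {in W, i =1 j} -> component i W = component j W.
Proof.
move=> ij; congr (_ * _); first by apply: eq_bigr => l lW; rewrite ij.
apply: eq_bigr => Q QN; apply: eq_bigr => V VQ; apply: block_weight_eq => x xV.
have := subsetP (NCD_sub (connected_NCD QN) VQ) x xV; rewrite !inE /= => xW.
by rewrite /point_color ij.
Qed.

Lemma sum_component n (W : {set 'I_n}) : W != set0 ->
  \sum_(j | supported (k0, k0) W j) component j W = connected_sum #|W|.
Proof.
move=> W0; apply: (@sum_supported _ _ (k0, k0) F (@component n) W (fun i : {ffun 'I_#|W| -> 'I_k * 'I_k} =>
  (\prod_l w (i l).1 (i l).2) *
     \sum_(P in connected_NC (@half_ord #|W|) [set: 'I_#|W|.*2])
       \prod_(V in P) block_weight kappa (point_color i) V)) => // j.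
congr (_ * _); first by rewrite big_enum_val; apply: eq_bigr => l _; rewrite ffunE.
rewrite subset_point_above (sum_connected_transport (@subset_point_mono n W) (@subset_point_half n W)).
apply: eq_bigr => P _; apply: eq_bigr => V _.
have inj := transport_inj (@subset_point_mono n W).
rewrite /block_weight card_imset //; apply: eq_bigl => c.
have pc x : point_color j (subset_point x) = point_color [ffun l => j (enum_val l)] x.
  by rewrite /subset_point point_color_point /point_color ffunE.
apply/subsetP/subsetP => h x.
  by move=> xV; move: (h _ (imset_f _ xV)); rewrite !inE pc.
by case/imsetP => y /h; rewrite !inE -pc => ? ->.
Qed.

(** This has the shape of a moment-cumulant formula because the sum over colourings factors along
    [rho], and each factor depends only on the size of the block, through the increasing relabelling
    of its points. *)
Lemma quadratic_moment m : phi (quadratic ^+ m)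
  = \sum_(rho in NCD [set: 'I_m]) \prod_(W in rho) connected_sum #|W|.
Proof.
have -> : quadratic = \sum_(p : 'I_k * 'I_k) w p.1 p.2 *: (a p.1 * a p.2).
  by rewrite /quadratic pair_big.
rewrite -[in LHS](card_ord m) -prodr_const bigA_distr_bigA linear_sum /=.
transitivity (\sum_(i : {ffun 'I_m -> 'I_k * 'I_k})
    \sum_(rho in NCD [set: 'I_m]) \prod_(W in rho) component i W).
  apply: eq_bigr => i _; rewrite scaler_prod linearZ /=.
  have -> : \prod_(l < m) (a (i l).1 * a (i l).2) =
      \prod_(x <- enum [set: 'I_m.*2]) a (point_color i x).
    by rewrite big_enum_setT big_points; apply: eq_bigr => l _; rewrite !point_color_point.
  rewrite (free_moment phi1 a_free) (sum_coarsening (@half_ord_mono m)) half_ord_image.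
  rewrite mulr_sumr; apply: eq_bigr => rho rN.
  have -> : \prod_l w (i l).1 (i l).2 = \prod_(W in rho) \prod_(l in W) w (i l).1 (i l).2.
    rewrite -(set_partition_big _ (NCD_partition rN)).
    by apply: eq_bigl => l; rewrite inE.
  by rewrite -big_split.
rewrite exchange_big /=; apply: eq_bigr => rho rN.
rewrite (sum_prod_partition (k0, k0) (@component_local m) (NCD_partition rN)).
apply: eq_bigr => W Wr; apply: sum_component; apply/set0Pn; exact: NCD_neq0 rN Wr.
Qed.

Hypothesis w_sym : forall i j, w i j = w j i.

Lemma quadratic_cumulant n : (0 < n)%N -> cumulant1 phi n quadratic
  = \sum_(X in OCG k n)
      2 ^+ flexible_count (graph_of X) (walk_of X) * graph_weight w X *
      \prod_(c < k) \prod_(v | color_of v == c)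
        cumulant1 phi (degree (graph_of X) v) (a c).
Proof.
move=> n0; rewrite (cumulant1_unique (Z := connected_sum)) //.
  exact: (sum_configurations n0 k0 kappa w_sym).
by move=> m _; apply: quadratic_moment.
Qed.

End QuadraticForm.

Unset Implicit Arguments.
Set Strict Implicit.
Import Order.TTheory GRing.Theory Num.Theory.
Local Open Scope ring_scope.
Local Open Scope complex_scope.

Theorem theorem1p18 (R : realType) (A : algType R[i]) (phi : {scalar A})
    (phi1 : phi 1 = 1) (k : nat) (k_gt0 : (1 <= k)%N) (a : 'I_k -> A)
    (a_free : freely_independent phi a) (w : 'I_k -> 'I_k -> R)
    (w_sym : forall i j : 'I_k, w j i = w i j) (n : nat) (n_gt0 : (1 <= n)%N) :
  cumulant1 phi n (\sum_(i < k) \sum_(j < k) (w i j)%:C *: (a i * a j))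
  = \sum_(X in OCG k n)
      2 ^+ flexible_count (graph_of X) (walk_of X) * (graph_weight w X)%:C *
      \prod_(i < k) \prod_(v | color_of v == i)
        cumulant1 phi (degree (graph_of X) v) (a i).
Proof.
have wC_sym i j : (w i j)%:C = (w j i)%:C by rewrite w_sym.
rewrite (quadratic_cumulant phi1 (Ordinal k_gt0) a_free wC_sym n_gt0).
by apply: eq_bigr => X _; rewrite /graph_weight rmorph_prod.
Qed.
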